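(* Suppose $R$ is a PID and $M_R$ is an infinite free right $R$-module. For $n\geq 1$ let $\Omega^n_n$ be the group of all definable self-bijections of $M^n$. Then $$K_1(M_R) = \varinjlim_{n\in \mathbb N}(\Omega_n^n)^{ab}.$$
   Context: A right $R$-module $M_R$ is regarded as a first-order structure in the language $L_R=\langle +,-,0,\{\cdot_r\mid r\in R\}\rangle$, where $\cdot_r$ is a unary function symbol for right multiplication by $r$. ''Definable'' means definable with parameters. Let $\mathcal S(M_R)$ be the groupoid whose objects are all definable subsets of $M^n$, $n\geq 1$, and whose morphisms are definable bijections; it is symmetric monoidal under disjoint union $\sqcup$ (of disjoint definably isomorphic copies), with unit $\emptyset$. The model-theoretic $K$-groups are $K_n(M_R):=\pi_n$ of the geometric realization of Quillen's category $\mathcal S^{-1}\mathcal S$ for $\mathcal S=\mathcal S(M_R)$ with the operation $\sqcup$ (objects are pairs of objects of $\mathcal S$; morphisms $(A,B)\to(C,D)$ are equivalence classes of triples $(s,\ s\sqcup A\to C,\ s\sqcup B\to D)$ with the two arrows in $\mathcal S$, modulo isomorphism in $s$). $G^{ab}$ is the abelianization of a group $G$. The transition map $(\Omega^n_n)^{ab}\to(\Omega^{n+1}_{n+1})^{ab}$ is induced by the embedding $\Omega^n_n\hookrightarrow\Omega^{n+1}_{n+1}$ which lets a definable bijection of $M^n$ act on the copy $M^n\times\{0\}\subseteq M^{n+1}$ and extends it by the identity on $M^{n+1}\setminus(M^n\times\{0\})$. *)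

(* Defs.v *)
From HB Require Import structures.
From Stdlib Require Import Relations.
From mathcomp Require Import all_boot all_order all_algebra.
From mathcomp Require Import all_classical all_reals topology normedtype.
From mathcomp Require Import homotopy ring lra.

Set Implicit Arguments.
Unset Strict Implicit.
Unset Printing Implicit Defensive.

Import Order.TTheory GRing.Theory Num.Theory.
Import numFieldNormedType.Exports.

Local Open Scope classical_set_scope.
Local Open Scope quotient_scope.

Section GeneratedQuotient.
Variables (T : choiceType) (E : T -> T -> Prop).

Definition gen_equiv (x y : T) : bool := `[< clos_refl_sym_trans T E x y >].

Lemma gen_equiv_refl : reflexive gen_equiv.
Proof. by move=> x; apply/asboolP; exact: rst_refl. Qed.

Lemma gen_equiv_sym : symmetric gen_equiv.
Proof. by move=> x y; apply/asboolP/asboolP; exact: rst_sym. Qed.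

Lemma gen_equiv_trans : transitive gen_equiv.
Proof.
by move=> y x z /asboolP xy /asboolP yz; apply/asboolP; exact: rst_trans yz.
Qed.

Canonical gen_equiv_rel :=
  EquivRel gen_equiv gen_equiv_refl gen_equiv_sym gen_equiv_trans.

Definition gen_quot := {eq_quot gen_equiv_rel}.
HB.instance Definition _ := Choice.on gen_quot.
HB.instance Definition _ := Quotient.on gen_quot.

Definition gen_pi (x : T) : gen_quot := \pi_gen_quot x.

Lemma gen_piP (x y : T) : gen_pi x = gen_pi y <-> clos_refl_sym_trans T E x y.
Proof.
rewrite -(asboolE (clos_refl_sym_trans T E x y)).
exact: rwP (@eqquotP _ _ {eq_quot gen_equiv_rel} x y).
Qed.

Lemma gen_pi_eq (x y : T) : E x y -> gen_pi x = gen_pi y.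
Proof. by move=> xy; apply/gen_piP; exact: rst_step. Qed.

Lemma gen_piK (q : gen_quot) : gen_pi (repr q) = q.
Proof. exact: reprK. Qed.

Lemma gen_quotP (q : gen_quot) : exists x, q = gen_pi x.
Proof. by exists (repr q); rewrite gen_piK. Qed.

Lemma equiv_piP : equivalence T E ->
  forall x y, gen_pi x = gen_pi y <-> E x y.
Proof.
move=> [Er Et Es] x y; split=> [|/gen_pi_eq//]; move/gen_piP.
elim=> // [a b _ /Es//|a b c _ + _]; exact: Et.
Qed.

Lemma equiv_repr : equivalence T E -> forall x, E (repr (gen_pi x)) x.
Proof. by move=> eE x; apply/equiv_piP => //; rewrite gen_piK. Qed.

End GeneratedQuotient.

Section Abelianization.
Local Open Scope group_scope.

Inductive in_derived (G : groupType) : G -> Prop :=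
| derived_comm x y : in_derived [~ x, y]
| derived1 : in_derived 1
| derivedM x y : in_derived x -> in_derived y -> in_derived (x * y)
| derivedV x : in_derived x -> in_derived x^-1.

Lemma derivedJ (G : groupType) (x y : G) : in_derived x -> in_derived (x ^ y).
Proof.
move=> dx; have -> : x ^ y = x * [~ x, y] by rewrite /commg mulVKg.
by apply: derivedM => //; exact: derived_comm.
Qed.

Definition ab_eq (G : groupType) (x y : G) : Prop := in_derived (x^-1 * y).

Lemma ab_eq_equiv (G : groupType) : equivalence G (@ab_eq G).
Proof.
split=> [x|x y z xy yz|x y xy].
- by rewrite /ab_eq mulVg; exact: derived1.
- by have := derivedM xy yz; rewrite /ab_eq mulgA mulgK.
- by have := derivedV xy; rewrite /ab_eq invgM invgK.
Qed.

Lemma ab_eqM (G : groupType) (x x' y y' : G) :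
  ab_eq x x' -> ab_eq y y' -> ab_eq (x * y) (x' * y').
Proof.
move=> xx' yy'; rewrite /ab_eq.
have -> : (x * y)^-1 * (x' * y') = (x^-1 * x') ^ y * (y^-1 * y').
  by rewrite /conjg invgM !mulgA mulgK.
by apply: derivedM => //; exact: derivedJ.
Qed.

Lemma ab_eqV (G : groupType) (x x' : G) : ab_eq x x' -> ab_eq x^-1 x'^-1.
Proof.
move=> xx'; rewrite /ab_eq invgK.
have -> : x * x'^-1 = ((x^-1 * x')^-1) ^ x^-1.
  by rewrite /conjg invgM !invgK !mulgA mulgK.
by apply: derivedJ; exact: derivedV.
Qed.

Variable G : groupType.

Definition ab := gen_quot (@ab_eq G).
HB.instance Definition _ := Choice.on ab.

Definition ab_pi (x : G) : ab := gen_pi (@ab_eq G) x.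

Lemma ab_piP x y : ab_pi x = ab_pi y <-> ab_eq x y.
Proof. exact: equiv_piP (@ab_eq_equiv G) _ _. Qed.

Definition ab_one : ab := ab_pi 1.
Definition ab_mul (a b : ab) : ab := ab_pi (repr a * repr b).
Definition ab_inv (a : ab) : ab := ab_pi (repr a)^-1.

Lemma ab_mulE x y : ab_mul (ab_pi x) (ab_pi y) = ab_pi (x * y).
Proof.
by apply/ab_piP; apply: ab_eqM; exact: equiv_repr (@ab_eq_equiv G) _.
Qed.

Lemma ab_invE x : ab_inv (ab_pi x) = ab_pi x^-1.
Proof. by apply/ab_piP; apply: ab_eqV; exact: equiv_repr (@ab_eq_equiv G) _. Qed.

Lemma ab_ind (P : ab -> Prop) : (forall x, P (ab_pi x)) -> forall a, P a.
Proof. by move=> H a; have [x ->] := gen_quotP a. Qed.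

Lemma ab_mulA : associative ab_mul.
Proof.
elim/ab_ind=> x; elim/ab_ind=> y; elim/ab_ind=> z.
by rewrite !ab_mulE mulgA.
Qed.

Lemma ab_mul1 : left_id ab_one ab_mul.
Proof. by elim/ab_ind=> x; rewrite ab_mulE mul1g. Qed.

Lemma ab_mul1r : right_id ab_one ab_mul.
Proof. by elim/ab_ind=> x; rewrite ab_mulE mulg1. Qed.

Lemma ab_mulV : left_inverse ab_one ab_inv ab_mul.
Proof. by elim/ab_ind=> x; rewrite ab_invE ab_mulE mulVg. Qed.

Lemma ab_mulVr : right_inverse ab_one ab_inv ab_mul.
Proof. by elim/ab_ind=> x; rewrite ab_invE ab_mulE mulgV. Qed.

HB.instance Definition _ :=
  isGroup.Build ab ab_mulA ab_mul1 ab_mul1r ab_mulV ab_mulVr.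

End Abelianization.

Section AbMap.
Local Open Scope group_scope.
Variables (G H : groupType) (f : {multiplicative G -> H}).

Lemma mult1 : f 1 = 1.
Proof. by apply: (mulgI (f 1)); rewrite -gmulfM !mulg1. Qed.

Lemma multV x : f x^-1 = (f x)^-1.
Proof. by apply: (mulgI (f x)); rewrite -gmulfM !mulgV mult1. Qed.

Lemma derived_map x : in_derived x -> in_derived (f x).
Proof.
elim=> [a b||a b _ ? _ ?|a _ ?].
- by rewrite /commg /conjg !gmulfM !multV; exact: derived_comm.
- by rewrite mult1; exact: derived1.
- by rewrite gmulfM; exact: derivedM.
- by rewrite multV; exact: derivedV.
Qed.

Definition ab_map (a : ab G) : ab H := ab_pi (f (repr a)).

Lemma ab_mapE x : ab_map (ab_pi x) = ab_pi (f x).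
Proof.
apply/ab_piP; rewrite /ab_eq -multV -gmulfM; apply: derived_map.
exact: equiv_repr (@ab_eq_equiv G) _.
Qed.

Lemma ab_mapM : {morph ab_map : a b / a * b}.
Proof.
elim/ab_ind=> x; elim/ab_ind=> y.
have mE (K : groupType) (u v : K) : ab_pi u * ab_pi v = ab_pi (u * v).
  exact: ab_mulE.
by rewrite mE !ab_mapE mE gmulfM.
Qed.

HB.instance Definition _ := isMultiplicative.Build (ab G) (ab H) ab_map ab_mapM.

End AbMap.

(* The universal property is tested against all groups; when the G n are
   abelian this agrees with the direct limit of abelian groups. *)
Definition is_direct_limit (G : nat -> groupType)
    (f : forall n, {multiplicative G n -> G n.+1})
    (L : groupType) (u : forall n, {multiplicative G n -> L}) : Prop :=
  (forall n x, u n.+1 (f n x) = u n x) /\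
  (forall (H : groupType) (v : forall n, {multiplicative G n -> H}),
     (forall n x, v n.+1 (f n x) = v n x) ->
     exists h : {multiplicative L -> H},
       (forall n x, h (u n x) = v n x) /\
       (forall h' : {multiplicative L -> H},
          (forall n x, h' (u n x) = v n x) -> h' =1 h)).

Section FundamentalGroup.
Local Open Scope ring_scope.
Variable K : realType.

Definition unitI : Type := set_type (`[0, 1]%classic : set K).
HB.instance Definition _ := Topological.on unitI.

Lemma unitI_proof (r : K) : Num.max 0 (Num.min 1 r) \in (`[0, 1]%classic : set K).
Proof.
by rewrite inE/= in_itv/= le_max lexx/= ge_max ler01 ge_min lexx.
Qed.

Definition clamp (r : K) : unitI :=
  exist (fun x : K => x \in (`[0, 1]%classic : set K)) _ (unitI_proof r).

Lemma clampE (r : K) : 0 <= r <= 1 -> \val (clamp r) = r.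
Proof. by move=> /andP[r0 r1] /=; rewrite min_r// max_r. Qed.

Lemma unitI_ge0 (s : unitI) : 0 <= \val s.
Proof. by case: s => r /=; rewrite inE/= in_itv/= => /andP[]. Qed.

Lemma unitI_le1 (s : unitI) : \val s <= 1.
Proof. by case: s => r /=; rewrite inE/= in_itv/= => /andP[]. Qed.

Lemma clampK (s : unitI) : clamp (\val s) = s.
Proof. by apply: val_inj; rewrite clampE // unitI_ge0 unitI_le1. Qed.

Lemma clamp0 (r : K) : r <= 0 -> clamp r = clamp 0.
Proof.
move=> r0; apply: val_inj => /=.
by rewrite [in LHS]max_l ?ge_min ?r0 ?orbT// max_l// ge_min lexx orbT.
Qed.

Lemma clamp1 (r : K) : 1 <= r -> clamp r = clamp 1.
Proof. by move=> r1; apply: val_inj => /=; rewrite !min_l. Qed.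

Lemma unitI_neq : clamp 0 != clamp 1.
Proof.
apply/eqP => /(congr1 val); rewrite !clampE ?lexx ?ler01// => /eqP.
by rewrite eq_sym oner_eq0.
Qed.

HB.instance Definition _ := isBiPointed.Build unitI unitI_neq.

Lemma val_unitI_continuous : continuous (\val : unitI -> K).
Proof. exact: initial_continuous. Qed.

Lemma into_unitI_continuous (Z : topologicalType) (f : Z -> unitI) :
  continuous (\val \o f) -> continuous f.
Proof.
by move=> cf; apply/continuousP => A [B oB <-]; move/continuousP: cf; exact.
Qed.

Lemma clamp_continuous : continuous clamp.
Proof.
apply: into_unitI_continuous => r.
have cmin : {for r, continuous (cst (1 : K^o) \min id)}.
  by apply: continuous_min; [exact: cvg_cst|exact: cvg_id].
have := @continuous_max _ _ (cst (0 : K^o)) _ r (@cvg_cst _ _ _ _ _) cmin.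
exact.
Qed.

Lemma paste_continuous (Z X : topologicalType) (h : Z -> K) (c : K)
    (f g : Z -> X) :
  continuous h -> continuous f -> continuous g ->
  (forall z, h z = c -> f z = g z) ->
  continuous (fun z => if h z <= c then f z else g z).
Proof.
move=> ch cf cg fg; apply/continuous_subspace_setT.
have -> : [set: Z] = (h @^-1` [set x | x <= c]) `|` (h @^-1` [set x | c <= x]).
  by apply/seteqP; split=> // z _ /=; case: (leP (h z) c) => [|/ltW]; [left|right].
apply: withinU_continuous.
- by apply: preimage_closed => // x _; exact: ch.
- by apply: preimage_closed => // x _; exact: ch.
- apply: (@subspace_eq_continuous _ _ _ f); last exact: continuous_subspaceT.
  by move=> z; rewrite inE => hz; rewrite /from_subspace; rewrite (hz : is_true (h z <= c)).
- apply: (@subspace_eq_continuous _ _ _ g); last exact: continuous_subspaceT.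
  move=> z; rewrite inE => hz; rewrite /from_subspace; case: ifPn => // hz'.
  by apply/esym/fg/eqP; rewrite eq_le hz hz'.
Qed.

Variable X : topologicalType.

Notation path x y := {path unitI from x to y in X}.

Definition path_homotopic (x y : X) (a b : path x y) : Prop :=
  exists H : unitI * unitI -> X,
    [/\ continuous H,
        forall s, H (s, zero) = a s,
        forall s, H (s, one) = b s,
        forall t, H (zero, t) = x &
        forall t, H (one, t) = y].

Lemma path_cts (x y : X) (a : path x y) : continuous a.
Proof. exact: cts_fun. Qed.

Lemma reparam_homotopic (x y x' y' : X) (a : path x y) (b b' : path x' y')
    (phi psi : unitI -> unitI) :
  continuous phi -> continuous psi ->
  phi zero = psi zero -> phi one = psi one ->
  b =1 a \o phi -> b' =1 a \o psi -> path_homotopic b b'.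
Proof.
move=> cphi cpsi e0 e1 bE b'E.
pose L (st : unitI * unitI) : K :=
  (1 - \val st.2) * \val (phi st.1) + \val st.2 * \val (psi st.1).
have Leq s t : phi s = psi s -> clamp (L (s, t)) = psi s.
  by move=> e; rewrite -[RHS]clampK; congr clamp; rewrite /L e -mulrDl subrK mul1r.
exists (a \o (clamp \o L)).
have cfst : continuous (fst : unitI * unitI -> unitI).
  by move=> z; exact: cvg_fst.
have csnd : continuous (snd : unitI * unitI -> unitI).
  by move=> z; exact: cvg_snd.
have cv2 : continuous (fun st : unitI * unitI => \val st.2).
  move=> z; apply: continuous_comp; [exact: csnd|exact: val_unitI_continuous].
have cc (f : unitI -> unitI) : continuous f ->
    continuous (fun st : unitI * unitI => \val (f st.1)).
  move=> cf z; apply: (@continuous_comp _ _ _ (f \o fst) val).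
    by apply: continuous_comp; [exact: cfst|exact: cf].
  exact: val_unitI_continuous.
split.
- move=> z; apply: continuous_comp; last exact: path_cts.
  apply: continuous_comp; last exact: clamp_continuous.
  apply: continuousD; apply: continuousM.
  + by apply: continuousB; [exact: cvg_cst|exact: cv2].
  + exact: cc.
  + exact: cv2.
  + exact: cc.
- move=> s; rewrite bE /= /L /= (_ : _ + _ = \val (phi s)) ?clampK//.
  by rewrite /zero /= min_r// maxxx; ring.
- move=> s; rewrite b'E /= /L /= (_ : _ + _ = \val (psi s)) ?clampK//.
  by rewrite /one /= minxx max_r//; ring.
- move=> t; rewrite [LHS]/= Leq// -[LHS]/((a \o psi) zero) -b'E.
  exact: path_zero.
- move=> t; rewrite [LHS]/= Leq// -[LHS]/((a \o psi) one) -b'E.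
  exact: path_one.
Qed.

Lemma homotopic_refl (x y : X) (a : path x y) : path_homotopic a a.
Proof. by apply: (@reparam_homotopic _ _ _ _ a a a id id) => // s; exact: cvg_id. Qed.

Definition affI (u v : K) (s : unitI) : unitI := clamp (u * \val s + v).

Lemma aff_continuous (u v : K) : continuous (fun s : unitI => u * \val s + v).
Proof.
move=> s.
suff : {for s, continuous (fun s : unitI => u * \val s + v)} by [].
apply: continuousD; last exact: cst_continuous.
by apply: continuousM; [exact: cst_continuous|exact: val_unitI_continuous].
Qed.

Lemma affI_continuous u v : continuous (affI u v).
Proof.
by move=> s; apply: continuous_comp; [exact: aff_continuous|exact: clamp_continuous].
Qed.

Lemma val0 : \val (zero : unitI) = 0 :> K.
Proof. by rewrite clampE // lexx ler01. Qed.

Lemma val1 : \val (one : unitI) = 1 :> K.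
Proof. by rewrite clampE // lexx ler01. Qed.

Lemma affI0 u v s : u * \val s + v <= 0 -> affI u v s = zero.
Proof. exact: clamp0. Qed.

Lemma affI1 u v s : 1 <= u * \val s + v -> affI u v s = one.
Proof. exact: clamp1. Qed.

Lemma fst_continuous (Y Z : topologicalType) : continuous (fst : Y * Z -> Y).
Proof. by move=> z; exact: cvg_fst. Qed.

Lemma snd_continuous (Y Z : topologicalType) : continuous (snd : Y * Z -> Z).
Proof. by move=> z; exact: cvg_snd. Qed.

Lemma mapl_continuous (Y Z W : topologicalType) (f : Y -> Z) : continuous f ->
  continuous (fun z : Y * W => (f z.1, z.2)).
Proof.
move=> cf z; apply: cvg_pair; last exact: cvg_snd.
by apply: (@continuous_comp _ _ _ fst f); [exact: fst_continuous|exact: cf].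
Qed.

Lemma mapr_continuous (Y Z W : topologicalType) (f : Y -> Z) : continuous f ->
  continuous (fun z : W * Y => (z.1, f z.2)).
Proof.
move=> cf z; apply: cvg_pair; first exact: cvg_fst.
by apply: (@continuous_comp _ _ _ snd f); [exact: snd_continuous|exact: cf].
Qed.

Lemma compc (Y Z W : topologicalType) (f : Y -> Z) (g : Z -> W) :
  continuous f -> continuous g -> continuous (g \o f).
Proof. by move=> cf cg z; apply: continuous_comp; [exact: cf|exact: cg]. Qed.

Lemma homotopic_sym (x y : X) (a b : path x y) :
  path_homotopic a b -> path_homotopic b a.
Proof.
move=> [H [cH Ha Hb H0 H1]].
exists (H \o (fun z => (z.1, affI (-1) 1 z.2))); split.
- apply: compc => //; apply: mapr_continuous; exact: affI_continuous.
- by move=> s /=; rewrite affI1 ?Hb// val0; lra.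
- by move=> s /=; rewrite affI0 ?Ha// val1; lra.
- by move=> t /=; rewrite H0.
- by move=> t /=; rewrite H1.
Qed.

Lemma homotopic_trans (x y : X) (a b c : path x y) :
  path_homotopic a b -> path_homotopic b c -> path_homotopic a c.
Proof.
move=> [H [cH Ha Hb H0 H1]] [H' [cH' Hb' Hc H0' H1']].
exists (fun z => if \val z.2 <= 2^-1 :> K then H (z.1, affI 2 0 z.2)
                 else H' (z.1, affI 2 (-1) z.2)); split.
- apply: (@paste_continuous _ _ (fun z : unitI * unitI => \val z.2) 2^-1
    (H \o (fun z => (z.1, affI 2 0 z.2)))
    (H' \o (fun z => (z.1, affI 2 (-1) z.2)))).
  + apply: (@compc _ _ _ (@snd unitI unitI) (fun s : unitI => \val s : K)); first exact: snd_continuous.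
    exact: val_unitI_continuous.
  + by apply: compc => //; apply: mapr_continuous; exact: affI_continuous.
  + by apply: compc => //; apply: mapr_continuous; exact: affI_continuous.
  + by move=> z ez /=; rewrite affI1 ?affI0 ?Hb ?Hb'// ez; lra.
- move=> s; rewrite val0 ifT; last lra.
  by rewrite affI0 ?Ha// val0; lra.
- move=> s; rewrite val1 ifF; last by apply/negbTE; rewrite -ltNge; lra.
  by rewrite affI1 ?Hc// val1; lra.
- by move=> t /=; case: ifP; rewrite ?H0 ?H0'.
- by move=> t /=; case: ifP; rewrite ?H1 ?H1'.
Qed.

Lemma path_homotopic_equiv (x y : X) : equivalence (path x y) (@path_homotopic x y).
Proof.
by split; [exact: homotopic_refl|exact: homotopic_trans|exact: homotopic_sym].
Qed.

Section Concat.
Variables (x y z : X) (a : path x y) (b : path y z).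

Definition concat_fun (s : unitI) : X :=
  if \val s <= 2^-1 :> K then a (affI 2 0 s) else b (affI 2 (-1) s).

Lemma concat_continuous : continuous concat_fun.
Proof.
apply: (@paste_continuous _ _ (fun s : unitI => \val s) 2^-1 (a \o affI 2 0) (b \o affI 2 (-1))).
- exact: val_unitI_continuous.
- by apply: compc; [exact: affI_continuous|exact: path_cts].
- by apply: compc; [exact: affI_continuous|exact: path_cts].
- by move=> s es /=; rewrite affI1 ?affI0 ?path_one ?path_zero// es; lra.
Qed.

Lemma concat_zero : concat_fun zero = x.
Proof.
rewrite /concat_fun val0 ifT; last lra.
by rewrite affI0 ?path_zero// val0; lra.
Qed.

Lemma concat_one : concat_fun one = z.
Proof.
rewrite /concat_fun val1 ifF; last by apply/negbTE; rewrite -ltNge; lra.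
by rewrite affI1 ?path_one// val1; lra.
Qed.

Definition concat : path x z := mk_path concat_continuous concat_zero concat_one.

Lemma concatE s : concat s =
  if \val s <= 2^-1 :> K then a (affI 2 0 s) else b (affI 2 (-1) s).
Proof. by []. Qed.

Lemma concat_path_zero : concat zero = x. Proof. exact: concat_zero. Qed.
Lemma concat_path_one : concat one = z. Proof. exact: concat_one. Qed.

End Concat.

Section Reverse.
Variables (x y : X) (a : path x y).

Lemma reverse_continuous : continuous (a \o affI (-1) 1).
Proof. by apply: compc; [exact: affI_continuous|exact: path_cts]. Qed.

Lemma reverse_zero : (a \o affI (-1) 1) zero = y.
Proof. by rewrite /= affI1 ?path_one// val0; lra. Qed.

Lemma reverse_one : (a \o affI (-1) 1) one = x.
Proof. by rewrite /= affI0 ?path_zero// val1; lra. Qed.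

Definition reverse : path y x := mk_path reverse_continuous reverse_zero reverse_one.

Lemma reverseE s : reverse s = a (affI (-1) 1 s).
Proof. by []. Qed.

End Reverse.

Definition const_path (x : X) : path x x :=
  mk_path (@cst_continuous unitI X x) erefl erefl.

Lemma concat_homotopic (x y z : X) (a a' : path x y) (b b' : path y z) :
  path_homotopic a a' -> path_homotopic b b' ->
  path_homotopic (concat a b) (concat a' b').
Proof.
move=> [H [cH Ha Ha' H0 H1]] [H' [cH' Hb Hb' H0' H1']].
exists (fun z => if \val z.1 <= 2^-1 :> K then H (affI 2 0 z.1, z.2)
                 else H' (affI 2 (-1) z.1, z.2)); split.
- apply: (@paste_continuous _ _ (fun z : unitI * unitI => \val z.1) 2^-1
    (H \o (fun z => (affI 2 0 z.1, z.2)))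
    (H' \o (fun z => (affI 2 (-1) z.1, z.2)))).
  + apply: (@compc _ _ _ (@fst unitI unitI) (fun s : unitI => \val s : K)); first exact: fst_continuous.
    exact: val_unitI_continuous.
  + by apply: compc => //; apply: mapl_continuous; exact: affI_continuous.
  + by apply: compc => //; apply: mapl_continuous; exact: affI_continuous.
  + by move=> w ez /=; rewrite affI1 ?affI0 ?H1 ?H0'// ez; lra.
- by move=> s /=; rewrite concatE; case: ifP; rewrite ?Ha ?Hb.
- by move=> s /=; rewrite concatE; case: ifP; rewrite ?Ha' ?Hb'.
- move=> t; rewrite val0 ifT; last lra.
  by rewrite affI0 ?H0// val0; lra.
- move=> t; rewrite val1 ifF; last by apply/negbTE; rewrite -ltNge; lra.
  by rewrite affI1 ?H1'// val1; lra.
Qed.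

Lemma reverse_homotopic (x y : X) (a a' : path x y) :
  path_homotopic a a' -> path_homotopic (reverse a) (reverse a').
Proof.
move=> [H [cH Ha Ha' H0 H1]].
exists (H \o (fun z => (affI (-1) 1 z.1, z.2))); split.
- by apply: compc => //; apply: mapl_continuous; exact: affI_continuous.
- by move=> s /=; rewrite reverseE Ha.
- by move=> s /=; rewrite reverseE Ha'.
- by move=> t /=; rewrite affI1 ?H1// val0; lra.
- by move=> t /=; rewrite affI0 ?H0// val1; lra.
Qed.


Lemma minI_continuous (f g : unitI -> K) : continuous f -> continuous g ->
  continuous (fun s => Num.min (f s) (g s)).
Proof. by move=> cf cg s; exact: (@continuous_min _ _ _ _ s (cf s) (cg s)). Qed.

Variable x : X.
Notation loop := (path x x).

Lemma unitI_bounds (s : unitI) : 0 <= \val s <= 1.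
Proof. by rewrite unitI_ge0 unitI_le1. Qed.

Lemma val_affI u v (s : unitI) : 0 <= u * \val s + v <= 1 ->
  \val (affI u v s) = u * \val s + v.
Proof. exact: clampE. Qed.

Lemma valL (s : unitI) : \val s <= 2^-1 -> \val (affI 2 0 s) = 2 * \val s.
Proof. by move=> h; have bs := unitI_bounds s; rewrite val_affI ?addr0//; lra. Qed.

Lemma valR (s : unitI) : 2^-1 <= \val s -> \val (affI 2 (-1) s) = 2 * \val s - 1.
Proof. by move=> h; have bs := unitI_bounds s; rewrite val_affI//; lra. Qed.

Lemma concatL (a b : loop) (s : unitI) : \val s <= 2^-1 ->
  concat a b s = a (affI 2 0 s).
Proof. by rewrite concatE => ->. Qed.

Lemma concatR (a b : loop) (s : unitI) : 2^-1 <= \val s ->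
  concat a b s = b (affI 2 (-1) s).
Proof.
move=> h; rewrite concatE; case: ifPn => // h'.
by rewrite affI1 ?affI0 ?path_zero ?path_one//; lra.
Qed.

Lemma concatA (a b c : loop) :
  path_homotopic (concat (concat a b) c) (concat a (concat b c)).
Proof.
pose phi (s : unitI) : unitI := clamp (Num.min (2 * \val s + 0)
  (Num.min (1 * \val s + 4^-1) (2^-1 * \val s + 2^-1))).
have cphi : continuous phi.
  apply: (compc _ clamp_continuous); apply: minI_continuous.
    exact: aff_continuous.
  by apply: minI_continuous; exact: aff_continuous.
have vphi s : \val (phi s) = Num.min (2 * \val s + 0)
    (Num.min (1 * \val s + 4^-1) (2^-1 * \val s + 2^-1)).
  apply: clampE; have := unitI_bounds s; move: (\val s) => r /andP[r0 r1].
  by rewrite !le_min !ge_min; lra.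
have phi1 (s : unitI) : \val s <= 4^-1 -> \val (phi s) = 2 * \val s.
  have := unitI_bounds s; rewrite vphi; move: (\val s) => r /andP[r0 r1] h.
  by rewrite min_l ?addr0// le_min; lra.
have phi2 (s : unitI) : 4^-1 <= \val s <= 2^-1 -> \val (phi s) = \val s + 4^-1.
  have := unitI_bounds s; rewrite vphi; move: (\val s) => r /andP[r0 r1] h.
  by rewrite [Num.min (_ * _ + 4^-1) _]min_l ?min_r ?mul1r//; lra.
have phi3 (s : unitI) : 2^-1 <= \val s -> \val (phi s) = 2^-1 * \val s + 2^-1.
  have := unitI_bounds s; rewrite vphi; move: (\val s) => r /andP[r0 r1] h.
  by rewrite [Num.min (_ * _ + 4^-1) _]min_r ?min_r//; lra.
apply: (@reparam_homotopic _ _ _ _ (concat a (concat b c)) _ _ phi id) => //.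
- by move=> s; exact: cvg_id.
- by apply: val_inj; rewrite phi1 val0; lra.
- by apply: val_inj; rewrite phi3 val1; lra.
move=> s; have bs := unitI_bounds s; rewrite [RHS]/=.
have [s4|s4] := leP (\val s) 4^-1.
  have p1 := phi1 _ s4.
  rewrite concatL; last by lra.
  rewrite concatL; last by rewrite valL; lra.
  rewrite [RHS]concatL; last by rewrite p1; lra.
  congr (a _); apply: val_inj; rewrite !valL ?p1 ?valL//; lra.
have [s2|s2] := leP (\val s) 2^-1.
  have p2 : \val (phi s) = \val s + 4^-1 by apply: phi2; lra.
  rewrite concatL; last by lra.
  rewrite concatR; last by rewrite valL; lra.
  rewrite [RHS]concatR; last by rewrite p2; lra.
  rewrite [RHS]concatL; last by rewrite valR p2; lra.
  congr (b _); apply: val_inj; rewrite valR valL ?valL ?valR ?p2//; lra.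
have p3 : \val (phi s) = 2^-1 * \val s + 2^-1 by apply: phi3; lra.
rewrite concatR; last by lra.
rewrite [RHS]concatR; last by rewrite p3; lra.
rewrite [RHS]concatR; last by rewrite valR p3; lra.
by congr (c _); apply: val_inj; rewrite !valR ?p3 ?valR ?p3; lra.
Qed.

Lemma concat1 (a : loop) : path_homotopic (concat (const_path x) a) a.
Proof.
apply: (@reparam_homotopic _ _ _ _ a _ _ (affI 2 (-1)) id) => //.
- exact: affI_continuous.
- by move=> s; exact: cvg_id.
- by rewrite affI0// val0; lra.
- by rewrite affI1// val1; lra.
move=> s; rewrite [RHS]/=; have [h|/ltW h] := leP (\val s) 2^-1.
  by rewrite concatL// [affI 2 (-1) s]affI0 ?path_zero//; lra.
by rewrite concatR.
Qed.

Lemma concat1r (a : loop) : path_homotopic (concat a (const_path x)) a.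
Proof.
apply: (@reparam_homotopic _ _ _ _ a _ _ (affI 2 0) id) => //.
- exact: affI_continuous.
- by move=> s; exact: cvg_id.
- by rewrite affI0// val0; lra.
- by rewrite affI1// val1; lra.
move=> s; rewrite [RHS]/=; have [h|/ltW h] := leP (\val s) 2^-1.
  by rewrite concatL.
by rewrite concatR// [affI 2 0 s]affI1 ?path_one//; lra.
Qed.

Lemma concatVr (a : loop) :
  path_homotopic (concat a (reverse a)) (const_path x).
Proof.
pose phi (s : unitI) : unitI :=
  clamp (Num.min (2 * \val s + 0) ((-2) * \val s + 2)).
have cphi : continuous phi.
  apply: (compc _ clamp_continuous); apply: minI_continuous; exact: aff_continuous.
have vphi s : \val (phi s) = Num.min (2 * \val s + 0) ((-2) * \val s + 2).
  apply: clampE; have := unitI_bounds s; move: (\val s) => r /andP[r0 r1].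
  by rewrite le_min ge_min; lra.
apply: (@reparam_homotopic _ _ _ _ a _ _ phi (cst zero)) => //.
- exact: cst_continuous.
- by apply: val_inj; rewrite vphi val0 min_l; lra.
- by apply: val_inj; rewrite vphi val0 val1 min_r; lra.
- move=> s; rewrite [RHS]/=; have bs := unitI_bounds s.
  have [h|/ltW h] := leP (\val s) 2^-1.
    rewrite concatL//; congr (a _); apply: val_inj.
    by rewrite valL// vphi min_l; lra.
  rewrite concatR// reverseE; congr (a _); apply: val_inj.
  by rewrite val_affI valR// ?vphi ?min_r; lra.
- by move=> s; rewrite [RHS]/= path_zero.
Qed.

Lemma concatV (a : loop) :
  path_homotopic (concat (reverse a) a) (const_path x).
Proof.
have rr : reverse (reverse a) = a.
  apply/path_eqP => s; rewrite !reverseE; congr (a _); apply: val_inj.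
  by have bs := unitI_bounds s; rewrite !val_affI; lra.
by rewrite -[X in concat _ X]rr; exact: concatVr.
Qed.

Definition pi1 := gen_quot (@path_homotopic x x).
HB.instance Definition _ := Choice.on pi1.

Definition loop_class (a : loop) : pi1 := gen_pi (@path_homotopic x x) a.

Lemma loop_classP (a b : loop) :
  loop_class a = loop_class b <-> path_homotopic a b.
Proof. exact: equiv_piP (path_homotopic_equiv x x) _ _. Qed.

Definition pi1_one : pi1 := loop_class (const_path x).
Definition pi1_mul (a b : pi1) : pi1 := loop_class (concat (repr a) (repr b)).
Definition pi1_inv (a : pi1) : pi1 := loop_class (reverse (repr a)).

Lemma pi1_mulE a b :
  pi1_mul (loop_class a) (loop_class b) = loop_class (concat a b).
Proof.
apply/loop_classP; apply: concat_homotopic;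
  exact: equiv_repr (path_homotopic_equiv x x) _.
Qed.

Lemma pi1_invE a : pi1_inv (loop_class a) = loop_class (reverse a).
Proof.
apply/loop_classP; apply: reverse_homotopic.
exact: equiv_repr (path_homotopic_equiv x x) _.
Qed.

Lemma pi1_ind (P : pi1 -> Prop) : (forall a, P (loop_class a)) -> forall a, P a.
Proof. by move=> H a; have [b ->] := gen_quotP a. Qed.

Lemma pi1_mulA : associative pi1_mul.
Proof.
elim/pi1_ind=> a; elim/pi1_ind=> b; elim/pi1_ind=> c; rewrite !pi1_mulE.
by apply/esym/loop_classP; exact: concatA.
Qed.

Lemma pi1_mul1 : left_id pi1_one pi1_mul.
Proof.
by elim/pi1_ind=> a; rewrite pi1_mulE; apply/loop_classP; exact: concat1.
Qed.

Lemma pi1_mul1r : right_id pi1_one pi1_mul.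
Proof.
by elim/pi1_ind=> a; rewrite pi1_mulE; apply/loop_classP; exact: concat1r.
Qed.

Lemma pi1_mulV : left_inverse pi1_one pi1_inv pi1_mul.
Proof.
elim/pi1_ind=> a; rewrite pi1_invE pi1_mulE.
by apply/loop_classP; exact: concatV.
Qed.

Lemma pi1_mulVr : right_inverse pi1_one pi1_inv pi1_mul.
Proof.
elim/pi1_ind=> a; rewrite pi1_invE pi1_mulE.
by apply/loop_classP; exact: concatVr.
Qed.

HB.instance Definition _ :=
  isGroup.Build pi1 pi1_mulA pi1_mul1 pi1_mul1r pi1_mulV pi1_mulVr.

End FundamentalGroup.
Arguments pi1 K {X} x.

(* Order-preserving maps [m] -> [n], where [n] = {0, ..., n}. *)
Record monomap (m n : nat) := MonoMap {
  mono_fun :> 'I_m.+1 -> 'I_n.+1;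
  mono_homo : forall i j : 'I_m.+1, (i <= j)%N -> (mono_fun i <= mono_fun j)%N
}.

Definition mono_id (n : nat) : monomap n n := @MonoMap n n id (fun _ _ h => h).

Definition mono_comp (m n p : nat) (f : monomap n p) (g : monomap m n) :
    monomap m p :=
  @MonoMap m p (f \o g) (fun _ _ h => mono_homo f (mono_homo g h)).

Record simplicial_set := SimplicialSet {
  simp :> nat -> Type;
  sact : forall m n, monomap m n -> simp n -> simp m;
  sact_id : forall n (s : simp n), sact (mono_id n) s = s;
  sact_comp : forall m n p (f : monomap n p) (g : monomap m n) (s : simp p),
    sact (mono_comp f g) s = sact g (sact f s)
}.

Section GeometricRealization.
Local Open Scope ring_scope.
Variable K : realType.

Definition std_simplex (n : nat) : set 'rV[K]_n.+1 :=
  [set t | (forall i, 0 <= t 0 i) /\ \sum_i t 0 i = 1].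

Definition stdsimp (n : nat) : Type := set_type (@std_simplex n).
HB.instance Definition _ n := Topological.on (stdsimp n).

Lemma push_proof m n (f : monomap m n) (t : stdsimp m) :
  (\row_j \sum_(i | f i == j) \val t 0 i) \in @std_simplex n.
Proof.
have [t0 t1] := set_mem (valP t); rewrite inE; split=> [i|] /=.
  by rewrite mxE; apply: sumr_ge0 => j _; exact: t0.
rewrite -t1 [RHS](partition_big f predT)//=.
by apply: eq_bigr => j _; rewrite mxE.
Qed.

(* The affine map of standard simplices that sends the vertex i to f i. *)
Definition push m n (f : monomap m n) (t : stdsimp m) : stdsimp n :=
  exist (fun t => t \in @std_simplex n) _ (push_proof f t).

Variable X : simplicial_set.

(* The disjoint union of the X_n x Delta^n with X_n discrete, as a disjoint
   union of one copy of Delta^n for each n-simplex of X. *)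
Definition presimp : Type :=
  {s : {classic {n : nat & X n}} & stdsimp (tag s)}.
HB.instance Definition _ := Topological.on presimp.

Definition presimp_pair n (s : X n) (t : stdsimp n) : presimp :=
  existT (fun s : {classic {n : nat & X n}} => stdsimp (tag s))
    (existT (fun n => X n) n s) t.

Definition glue (p q : presimp) : Prop :=
  exists m n (f : monomap m n) (s : X n) (t : stdsimp m),
    p = presimp_pair (sact f s) t /\ q = presimp_pair s (push f t).

Definition realization := quotient_topology (gen_quot glue).
HB.instance Definition _ := Topological.on realization.

Lemma vertex_proof : const_mx 1 \in @std_simplex 0.
Proof.
by rewrite inE; split=> [i|]; rewrite ?big_ord1 mxE ?ler01.
Qed.

Definition realization_vertex (s : X 0%N) : realization :=
  gen_pi glue (presimp_pair s
    (exist (fun t => t \in @std_simplex 0) _ vertex_proof)).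

End GeometricRealization.

(* [comp g f] is g after f. *)
Record category := Category {
  obj :> Type;
  hom : obj -> obj -> Type;
  idm : forall A, hom A A;
  comp : forall A B C, hom B C -> hom A B -> hom A C;
  comp1m : forall A B (f : hom A B), comp (idm B) f = f;
  compm1 : forall A B (f : hom A B), comp f (idm A) = f;
  compA : forall A B C D (h : hom C D) (g : hom B C) (f : hom A B),
    comp h (comp g f) = comp (comp h g) f
}.
Arguments idm {c} A.
Arguments comp {c A B C} g f.

Section Nerve.
Variable C : category.

(* A functor [n] -> C, where the poset [n] = {0 < ... < n} is viewed as a
   category. *)
Record nsimplex (n : nat) := NSimplex {
  vert : 'I_n.+1 -> C;
  edge : forall i j : 'I_n.+1, (i <= j)%N -> hom (vert i) (vert j);
  edge_id : forall (i : 'I_n.+1) (h : (i <= i)%N), edge h = idm (vert i);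
  edge_comp : forall (i j k : 'I_n.+1) (ij : (i <= j)%N) (jk : (j <= k)%N) (ik : (i <= k)%N),
    edge ik = comp (edge jk) (edge ij)
}.

Definition nsimplex_act m n (f : monomap m n) (s : nsimplex n) : nsimplex m :=
  @NSimplex m (fun i => vert s (f i))
    (fun i j h => edge s (mono_homo f h))
    (fun i h => edge_id s _)
    (fun i j k ij jk ik => edge_comp s _ _ _).

Lemma nsimplex_eq n (v : 'I_n.+1 -> C)
    (e e' : forall i j : 'I_n.+1, (i <= j)%N -> hom (v i) (v j)) h1 h2 h1' h2' :
  (forall (i j : 'I_n.+1) (h : (i <= j)%N), e i j h = e' i j h) ->
  @NSimplex n v e h1 h2 = @NSimplex n v e' h1' h2'.
Proof.
move=> ee'; have E : e = e'.
  by apply: functional_extensionality_dep => i;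
     apply: functional_extensionality_dep => j;
     apply: functional_extensionality_dep => h.
by case: _ / E h1' h2' => h1' h2'; congr NSimplex; exact: Prop_irrelevance.
Qed.

Lemma nsimplex_act_id n (s : nsimplex n) : nsimplex_act (mono_id n) s = s.
Proof. by case: s => v e h1 h2; exact: nsimplex_eq. Qed.

Lemma nsimplex_act_comp m n p (f : monomap n p) (g : monomap m n)
    (s : nsimplex p) :
  nsimplex_act (mono_comp f g) s = nsimplex_act g (nsimplex_act f s).
Proof. by case: s => v e h1 h2; exact: nsimplex_eq. Qed.

Definition nerve : simplicial_set :=
  SimplicialSet nsimplex_act_id nsimplex_act_comp.

Definition nerve_vertex (A : C) : nerve 0%N :=
  @NSimplex 0 (fun _ => A) (fun _ _ _ => idm A) (fun _ _ => erefl)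
    (fun _ _ _ _ _ _ => esym (comp1m (idm A))).

End Nerve.

Definition classifying_space (K : realType) (C : category) : topologicalType :=
  realization K (nerve C).

Definition base_vertex (K : realType) (C : category) (A : C) :
    classifying_space K C :=
  realization_vertex K (nerve_vertex A).

(* The law [tunitlA] follows from the other coherence laws of a monoidal
   category; it is a field in order to avoid that derivation. *)
Record sym_mon_groupoid := SymMonGroupoid {
  smg_cat :> category;
  invm : forall A B : smg_cat, hom A B -> hom B A;
  invm_l : forall (A B : smg_cat) (f : hom A B), comp (invm f) f = idm A;
  invm_r : forall (A B : smg_cat) (f : hom A B), comp f (invm f) = idm B;
  tens : smg_cat -> smg_cat -> smg_cat;
  tensm : forall A B C D : smg_cat, hom A B -> hom C D -> hom (tens A C) (tens B D);
  tensm1 : forall A B : smg_cat, tensm (idm A) (idm B) = idm (tens A B);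
  tensmM : forall (A B C A' B' C' : smg_cat) (g : hom B C) (f : hom A B)
      (g' : hom B' C') (f' : hom A' B'),
    tensm (comp g f) (comp g' f') = comp (tensm g g') (tensm f f');
  tunit : smg_cat;
  tassoc : forall A B C : smg_cat, hom (tens (tens A B) C) (tens A (tens B C));
  tunitl : forall A : smg_cat, hom (tens tunit A) A;
  tunitr : forall A : smg_cat, hom (tens A tunit) A;
  tbraid : forall A B : smg_cat, hom (tens A B) (tens B A);
  tassoc_nat : forall (A B C A' B' C' : smg_cat)
      (f : hom A A') (g : hom B B') (h : hom C C'),
    comp (tassoc A' B' C') (tensm (tensm f g) h) =
    comp (tensm f (tensm g h)) (tassoc A B C);
  tunitl_nat : forall (A B : smg_cat) (f : hom A B),
    comp (tunitl B) (tensm (idm tunit) f) = comp f (tunitl A);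
  tunitr_nat : forall (A B : smg_cat) (f : hom A B),
    comp (tunitr B) (tensm f (idm tunit)) = comp f (tunitr A);
  tbraid_nat : forall (A B A' B' : smg_cat) (f : hom A A') (g : hom B B'),
    comp (tbraid A' B') (tensm f g) = comp (tensm g f) (tbraid A B);
  tpentagon : forall A B C D : smg_cat,
    comp (tassoc A B (tens C D)) (tassoc (tens A B) C D) =
    comp (tensm (idm A) (tassoc B C D))
      (comp (tassoc A (tens B C) D) (tensm (tassoc A B C) (idm D)));
  ttriangle : forall A B : smg_cat,
    comp (tensm (idm A) (tunitl B)) (tassoc A tunit B) =
    tensm (tunitr A) (idm B);
  tunitlA : forall A B : smg_cat,
    comp (tunitl (tens A B)) (tassoc tunit A B) = tensm (tunitl A) (idm B);
  tbraidK : forall A B : smg_cat, comp (tbraid B A) (tbraid A B) = idm (tens A B);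
  thexagon : forall A B C : smg_cat,
    comp (tassoc B C A) (comp (tbraid A (tens B C)) (tassoc A B C)) =
    comp (tensm (idm B) (tbraid A C))
      (comp (tassoc B A C) (tensm (tbraid A B) (idm C)))
}.
Arguments invm {s A B} f.
Arguments tens {s} A B.
Arguments tensm {s A B C D} f g.
Arguments tunit {s}.
Arguments tassoc {s} A B C.
Arguments tunitl {s} A.
Arguments tunitr {s} A.
Arguments tbraid {s} A B.

(* Quillen's category S^{-1}S: a morphism (A, B) -> (C, D) is a class of triples
   (s, s + A -> C, s + B -> D) modulo isomorphism in s. *)
Section SinvS.
Variable S : sym_mon_groupoid.

Definition sis_triple (P Q : S * S) : Type :=
  {classic {s : S & (hom (tens s P.1) Q.1 * hom (tens s P.2) Q.2)%type}}.

Definition mk_triple (P Q : S * S) (s : S) (f : hom (tens s P.1) Q.1)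
    (g : hom (tens s P.2) Q.2) : sis_triple P Q :=
  existT (fun s : S => (hom (tens s P.1) Q.1 * hom (tens s P.2) Q.2)%type)
    s (f, g).

Definition sis_eq (P Q : S * S) (x y : sis_triple P Q) : Prop :=
  exists u : hom (tag x) (tag y),
    (tagged x).1 = comp (tagged y).1 (tensm u (idm P.1)) /\
    (tagged x).2 = comp (tagged y).2 (tensm u (idm P.2)).

Lemma sis_eq_equiv (P Q : S * S) : equivalence _ (@sis_eq P Q).
Proof.
split.
- move=> [s [f g]]; exists (idm s) => /=.
  by rewrite !tensm1 !compm1.
- move=> [s [f g]] [s' [f' g']] [s'' [f'' g'']] [u /= [-> ->]] [v /= [-> ->]].
  exists (comp v u) => /=; rewrite -!compA -!tensmM.
  by rewrite !comp1m.
- move=> [s [f g]] [s' [f' g']] [u /= [-> ->]]; exists (invm u) => /=.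
  by rewrite -!compA -!tensmM !invm_r !comp1m !tensm1 !compm1.
Qed.

Definition sis_hom (P Q : S * S) : Type := gen_quot (@sis_eq P Q).

Definition sis_class (P Q : S * S) (x : sis_triple P Q) : sis_hom P Q :=
  gen_pi (@sis_eq P Q) x.

Lemma sis_classP (P Q : S * S) (x y : sis_triple P Q) :
  sis_class x = sis_class y <-> sis_eq x y.
Proof. exact: equiv_piP (sis_eq_equiv P Q) _ _. Qed.

Definition sis_id_triple (P : S * S) : sis_triple P P :=
  @mk_triple P P tunit (tunitl P.1) (tunitl P.2).

Definition sis_comp_triple (P Q T : S * S) (y : sis_triple Q T)
    (x : sis_triple P Q) : sis_triple P T :=
  @mk_triple P T (tens (tag y) (tag x))
    (comp (tagged y).1
      (comp (tensm (idm (tag y)) (tagged x).1) (tassoc (tag y) (tag x) P.1)))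
    (comp (tagged y).2
      (comp (tensm (idm (tag y)) (tagged x).2) (tassoc (tag y) (tag x) P.2))).

Lemma sis_comp_eq_aux (A B C s s' t t' : S) (h' : hom (tens t' B) C)
    (f' : hom (tens s' A) B) (v : hom t t') (u : hom s s') :
  comp (comp h' (tensm v (idm B)))
    (comp (tensm (idm t) (comp f' (tensm u (idm A)))) (tassoc t s A)) =
  comp (comp h' (comp (tensm (idm t') f') (tassoc t' s' A)))
    (tensm (tensm v u) (idm A)).
Proof.
rewrite -!compA; congr comp; rewrite tassoc_nat !compA; congr comp.
by rewrite -!tensmM compm1 !comp1m.
Qed.

Lemma sis_comp_eq (P Q T : S * S) (y y' : sis_triple Q T) (x x' : sis_triple P Q) :
  sis_eq y y' -> sis_eq x x' ->
  sis_eq (sis_comp_triple y x) (sis_comp_triple y' x').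
Proof.
move: y y' x x' => [t [h k]] [t' [h' k']] [s [f g]] [s' [f' g']].
move=> [v /= [-> ->]] [u /= [-> ->]]; exists (tensm v u) => /=.
by rewrite !sis_comp_eq_aux.
Qed.

Definition sis_id (P : S * S) : sis_hom P P := sis_class (sis_id_triple P).

Definition sis_comp (P Q T : S * S) (y : sis_hom Q T) (x : sis_hom P Q) :
    sis_hom P T :=
  sis_class (sis_comp_triple (repr y) (repr x)).

Lemma sis_compE (P Q T : S * S) (y : sis_triple Q T) (x : sis_triple P Q) :
  sis_comp (sis_class y) (sis_class x) = sis_class (sis_comp_triple y x).
Proof.
by apply/sis_classP; apply: sis_comp_eq; exact: equiv_repr (sis_eq_equiv _ _) _.
Qed.

Lemma sis_ind (P Q : S * S) (F : sis_hom P Q -> Prop) :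
  (forall x, F (sis_class x)) -> forall x, F x.
Proof. by move=> H x; have [y ->] := gen_quotP x; exact: H. Qed.

Lemma sis_comp1m (P Q : S * S) (x : sis_hom P Q) : sis_comp (sis_id Q) x = x.
Proof.
elim/sis_ind: x => -[s [f g]]; rewrite sis_compE; apply/sis_classP.
exists (tunitl s) => /=.
by rewrite !compA !tunitl_nat -!compA !tunitlA.
Qed.

Lemma sis_compm1 (P Q : S * S) (x : sis_hom P Q) : sis_comp x (sis_id P) = x.
Proof.
elim/sis_ind: x => -[s [f g]]; rewrite sis_compE; apply/sis_classP.
by exists (tunitr s) => /=; rewrite !ttriangle.
Qed.

Lemma sis_compA_aux (A B C D s t r : S) (h : hom (tens r C) D)
    (g : hom (tens t B) C) (f : hom (tens s A) B) :
  comp h (comp (tensm (idm r) (comp g (comp (tensm (idm t) f) (tassoc t s A))))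
    (tassoc r (tens t s) A)) =
  comp (comp (comp h (comp (tensm (idm r) g) (tassoc r t B)))
    (comp (tensm (idm (tens r t)) f) (tassoc (tens r t) s A)))
    (tensm (invm (tassoc r t s)) (idm A)).
Proof.
have E1 (A1 B1 C1 : S) (p : hom B1 C1) (q : hom A1 B1) :
    tensm (idm r) (comp p q) = comp (tensm (idm r) p) (tensm (idm r) q).
  by rewrite -tensmM comp1m.
rewrite !E1 -!compA; congr (comp h (comp _ _)).
rewrite -(tensm1 r t) [in RHS]compA tassoc_nat -!compA; congr comp.
rewrite [in RHS]compA tpentagon -!compA -tensmM invm_r comp1m tensm1.
by rewrite compm1.
Qed.

Lemma sis_compA (P Q T V : S * S) (z : sis_hom T V) (y : sis_hom Q T)
    (x : sis_hom P Q) :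
  sis_comp z (sis_comp y x) = sis_comp (sis_comp z y) x.
Proof.
elim/sis_ind: z => -[r [h h']]; elim/sis_ind: y => -[t [g g']].
elim/sis_ind: x => -[s [f f']]; rewrite !sis_compE; apply/sis_classP.
by exists (invm (tassoc r t s)); split=> /=; rewrite sis_compA_aux.
Qed.

Definition SinvS : category := Category sis_comp1m sis_compm1 sis_compA.

End SinvS.

Definition K1 (K : realType) (S : sym_mon_groupoid) : groupType :=
  pi1 K (base_vertex K ((tunit, tunit) : SinvS S)).

(* First-order formulas of the language of R-modules, with parameters from M.
   R is commutative, so a right R-module is given as an [lmodType R], with
   m.r = r *: m. Variables are de Bruijn indices: a formula in [mformula n.+1]
   under [MEx] has the bound variable as its variable 0. *)
Section ModuleLanguage.
Local Open Scope ring_scope.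
Variables (R : comNzRingType) (M : lmodType R).

Inductive mterm (n : nat) : Type :=
| MVar of 'I_n
| MPar of M
| MZero
| MAdd of mterm n & mterm n
| MOpp of mterm n
| MScale of R & mterm n.

Inductive mformula : nat -> Type :=
| MEq n of mterm n & mterm n : mformula n
| MNot n of mformula n : mformula n
| MAnd n of mformula n & mformula n : mformula n
| MEx n of mformula n.+1 : mformula n.

Fixpoint mterm_eval n (e : 'I_n -> M) (t : mterm n) : M :=
  match t with
  | MVar i => e i
  | MPar m => m
  | MZero => 0
  | MAdd t u => mterm_eval e t + mterm_eval e u
  | MOpp t => - mterm_eval e t
  | MScale r t => r *: mterm_eval e t
  end.

Definition env_cons n (x : M) (e : 'I_n -> M) (i : 'I_n.+1) : M :=
  if unlift ord0 i is Some j then e j else x.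

Fixpoint mformula_sat n (f : mformula n) : ('I_n -> M) -> Prop :=
  match f with
  | MEq _ t u => fun e => mterm_eval e t = mterm_eval e u
  | MNot _ f => fun e => ~ mformula_sat f e
  | MAnd _ f g => fun e => mformula_sat f e /\ mformula_sat g e
  | MEx _ f => fun e => exists x : M, mformula_sat f (env_cons x e)
  end.

Definition definable n (A : set (n.-tuple M)) : Prop :=
  exists f : mformula n, A = [set v | mformula_sat f (tnth v)].

Definition dpred n (P : ('I_n -> M) -> Prop) : Prop :=
  exists f : mformula n, forall e, mformula_sat f e <-> P e.

Lemma dpred_ext n (P Q : ('I_n -> M) -> Prop) :
  (forall e, P e <-> Q e) -> dpred P -> dpred Q.
Proof. by move=> PQ [f fP]; exists f => e; rewrite fP PQ. Qed.

Lemma dpred_definable n (A : set (n.-tuple M)) (P : ('I_n -> M) -> Prop) :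
  dpred P -> (forall v, A v <-> P (tnth v)) -> definable A.
Proof.
move=> [f fP] AP; exists f; apply/seteqP.
by split=> v /=; rewrite fP AP.
Qed.

Lemma definable_dpred n (A : set (n.-tuple M)) : definable A ->
  dpred (fun e => A (mktuple e)).
Proof.
move=> [f ->]; exists f => e /=; rewrite (_ : tnth _ = e)//.
by apply/funext => i; rewrite tnth_mktuple.
Qed.

Lemma dpred_eq n (t u : mterm n) :
  dpred (fun e => mterm_eval e t = mterm_eval e u).
Proof. by exists (MEq t u). Qed.

Lemma dpred_not n (P : ('I_n -> M) -> Prop) : dpred P -> dpred (fun e => ~ P e).
Proof. by move=> [f fP]; exists (MNot f) => e /=; rewrite fP. Qed.

Lemma dpred_and n (P Q : ('I_n -> M) -> Prop) :
  dpred P -> dpred Q -> dpred (fun e => P e /\ Q e).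
Proof. by move=> [f fP] [g gQ]; exists (MAnd f g) => e /=; rewrite fP gQ. Qed.

Lemma dpred_or n (P Q : ('I_n -> M) -> Prop) :
  dpred P -> dpred Q -> dpred (fun e => P e \/ Q e).
Proof.
move=> dP dQ; have := dpred_not (dpred_and (dpred_not dP) (dpred_not dQ)).
by apply: dpred_ext => e; split=> [H|[?|?] []//]; apply: contrapT => /not_orP.
Qed.

Lemma dpred_ex n (P : ('I_n.+1 -> M) -> Prop) : dpred P ->
  dpred (fun e => exists x, P (env_cons x e)).
Proof.
move=> [f fP]; exists (MEx f) => e /=.
by split=> -[x Px]; exists x; apply/fP.
Qed.

Lemma dpred_true n : dpred (fun _ : 'I_n -> M => True).
Proof. by exists (MEq (MZero n) (MZero n)). Qed.

Lemma dpred_false n : dpred (fun _ : 'I_n -> M => False).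
Proof. by apply: dpred_ext (dpred_not (dpred_true n)) => e; rewrite not_True. Qed.

Lemma dpred_all n (I : finType) (P : I -> ('I_n -> M) -> Prop) :
  (forall i, dpred (P i)) -> dpred (fun e => forall i, P i e).
Proof.
move=> dP.
suff: dpred (fun e => forall i, i \in enum I -> P i e).
  apply: dpred_ext => e; split=> H i; last by move=> _; exact: H.
  by apply: H; rewrite mem_enum.
elim: (enum I) => [|i s IHs]; first exact: dpred_ext (dpred_true n).
apply: dpred_ext (dpred_and (dP i) IHs) => e; split=> [[Pi Ps] j|H].
  by rewrite inE => /predU1P[->//|]; exact: Ps.
by split=> [|j js]; apply: H; rewrite inE ?eqxx ?js ?orbT.
Qed.

Fixpoint mterm_subst m n (s : 'I_m -> mterm n) (t : mterm m) : mterm n :=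
  match t with
  | MVar i => s i
  | MPar x => MPar n x
  | MZero => MZero n
  | MAdd t u => MAdd (mterm_subst s t) (mterm_subst s u)
  | MOpp t => MOpp (mterm_subst s t)
  | MScale r t => MScale r (mterm_subst s t)
  end.

Lemma mterm_substE m n (s : 'I_m -> mterm n) (t : mterm m) e :
  mterm_eval e (mterm_subst s t) = mterm_eval (fun i => mterm_eval e (s i)) t.
Proof. by elim: t => //= [t -> u ->|t ->|r t ->]. Qed.

Definition subst_up m n (s : 'I_m -> mterm n) (i : 'I_m.+1) : mterm n.+1 :=
  if unlift ord0 i is Some j then
    mterm_subst (fun k => MVar (lift ord0 k)) (s j)
  else MVar ord0.

Lemma subst_upE m n (s : 'I_m -> mterm n) (x : M) e :
  (fun i => mterm_eval (env_cons x e) (subst_up s i)) =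
  env_cons x (fun i => mterm_eval e (s i)).
Proof.
apply/funext => i; rewrite /subst_up [RHS]/env_cons.
case: unliftP => [j _|_] /=; last by rewrite /env_cons unlift_none.
rewrite mterm_substE; congr mterm_eval; apply/funext => k /=.
by rewrite /env_cons liftK.
Qed.

Lemma dpred_subst m n (P : ('I_m -> M) -> Prop) (s : 'I_m -> mterm n) :
  dpred P -> dpred (fun e => P (fun i => mterm_eval e (s i))).
Proof.
move=> [f fP].
suff [g gf] : exists g : mformula n,
    forall e, mformula_sat g e <-> mformula_sat f (fun i => mterm_eval e (s i)).
  by exists g => e; rewrite gf fP.
elim: f n s {P fP} => {m}[m t u|m f IHf|m f IHf g IHg|m f IHf] n s.
- by exists (MEq (mterm_subst s t) (mterm_subst s u)) => e /=; rewrite !mterm_substE.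
- by have [g gf] := IHf n s; exists (MNot g) => e /=; rewrite gf.
- have [f' ff'] := IHf n s; have [g' gg'] := IHg n s.
  by exists (MAnd f' g') => e /=; rewrite ff' gg'.
- have [g gf] := IHf _ (subst_up s); exists (MEx g) => e /=.
  by split=> -[x hx]; exists x; move: hx; rewrite gf subst_upE.
Qed.

Lemma dpred_rename m n (P : ('I_m -> M) -> Prop) (s : 'I_m -> 'I_n) :
  dpred P -> dpred (fun e => P (fun i => e (s i))).
Proof. by move=> /(dpred_subst (fun i => MVar (s i))). Qed.

Definition env_cat k n (w : 'I_k -> M) (e : 'I_n -> M) (i : 'I_(k + n)) : M :=
  match fintype.split i with inl j => w j | inr j => e j end.

Lemma env_catl k n (w : 'I_k -> M) (e : 'I_n -> M) i :
  env_cat w e (lshift n i) = w i.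
Proof.
rewrite /env_cat; case: splitP => [j /= /val_inj->//|j /= E].
by have := ltn_ord i; rewrite E ltnNge leq_addr.
Qed.

Lemma env_catr k n (w : 'I_k -> M) (e : 'I_n -> M) i :
  env_cat w e (rshift k i) = e i.
Proof.
rewrite /env_cat; case: splitP => [j /= E|j /= /addnI/val_inj->//].
by have := ltn_ord j; rewrite -E ltnNge leq_addr.
Qed.

Lemma dpred_exs k n (P : ('I_(k + n) -> M) -> Prop) : dpred P ->
  dpred (fun e => exists w : 'I_k -> M, P (env_cat w e)).
Proof.
elim: k P => [|k IHk] P dP.
  apply: dpred_ext dP => e.
  have E w : env_cat w e = e :> ('I_(0 + n) -> M).
    apply/funext => i; rewrite -(env_catr w e i); congr env_cat.
    exact: val_inj.
  split=> [Pe|[w]]; last by rewrite E.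
  by exists (fun=> 0); rewrite E.
have dP' := IHk (fun e => exists x, P (env_cons x e)) (dpred_ex dP).
apply: dpred_ext dP' => e.
have E (x : M) (w : 'I_k -> M) :
    env_cons x (env_cat w e) = env_cat (env_cons x w) e :> ('I_(k.+1 + n) -> M).
  apply/funext => i; rewrite {1}/env_cons; case: unliftP => [j|] ->.
    rewrite -[j]splitK; case: (fintype.split j) => a /=.
      rewrite env_catl (_ : lift ord0 _ = lshift n (lift ord0 a)); last exact: val_inj.
      by rewrite env_catl /env_cons liftK.
    rewrite env_catr (_ : lift ord0 _ = rshift k.+1 a); last exact: val_inj.
    by rewrite env_catr.
  rewrite (_ : ord0 = lshift n ord0); last exact: val_inj.
  by rewrite env_catl /env_cons unlift_none.
split=> [[w [x]]|[w Pw]]; first by rewrite E; exists (env_cons x w).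
exists (fun i => w (lift ord0 i)), (w ord0); rewrite E.
rewrite (_ : env_cons _ _ = w)//; apply/funext => i.
by rewrite /env_cons; case: unliftP => [j|] ->.
Qed.


Definition graph m n (A : set (m.-tuple M)) (B : set (n.-tuple M)) (f : A -> B) :
    set ((m + n).-tuple M) :=
  [set z | exists x : A, z = [tuple of val x ++ val (f x)]].

Definition graph_env m n (A : set (m.-tuple M)) (B : set (n.-tuple M))
    (f : A -> B) (e : 'I_m -> M) (e' : 'I_n -> M) : Prop :=
  exists x : A, e = tnth (val x) /\ e' = tnth (val (f x)).

Section Graphs.
Variables (m n : nat) (A : set (m.-tuple M)) (B : set (n.-tuple M)).

Lemma graphE (f : A -> B) z : graph f z <->
  graph_env f (fun i => tnth z (lshift n i)) (fun j => tnth z (rshift m j)).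
Proof.
split=> [[x ->]|[x [E E']]]; exists x.
  by split; apply/funext => i; rewrite ?tnth_lshift ?tnth_rshift.
apply: eq_from_tnth => i; rewrite -[i]splitK.
case: (fintype.split i) => j /=.
  by rewrite tnth_lshift -E.
by rewrite tnth_rshift -E'.
Qed.

Lemma graph_definable (f : A -> B) :
  definable (graph f) <->
  dpred (fun e => graph_env f (fun i => e (lshift n i)) (fun j => e (rshift m j))).
Proof.
split=> [/definable_dpred|dP].
  apply: dpred_ext => e; rewrite graphE.
  by under eq_fun do rewrite tnth_mktuple; under [X in graph_env _ _ X]eq_fun do rewrite tnth_mktuple.
by apply: dpred_definable dP _ => v; exact: graphE.
Qed.

Lemma dpred_graph (f : A -> B) p (s : 'I_m -> 'I_p) (t : 'I_n -> 'I_p) :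
  definable (graph f) ->
  dpred (fun e => graph_env f (fun i => e (s i)) (fun j => e (t j))).
Proof.
move=> df; have dP := (graph_definable f).1 df.
have := dpred_rename (fun i : 'I_(m + n) =>
  match fintype.split i with inl j => s j | inr j => t j end) dP.
apply: dpred_ext => e.
have El i : fintype.split (lshift n i) = inl i by exact: (unsplitK (inl i)).
have Er i : fintype.split (rshift m i) = inr i by exact: (unsplitK (inr i)).
by under eq_fun do rewrite El; under [X in graph_env _ _ X]eq_fun do rewrite Er.
Qed.

End Graphs.

Lemma graph_inv_definable m n (A : set (m.-tuple M)) (B : set (n.-tuple M))
    (f : A -> B) (g : B -> A) :
  cancel f g -> cancel g f -> definable (graph f) -> definable (graph g).
Proof.
move=> fK gK df; apply/graph_definable.
apply: dpred_ext (dpred_graph (@rshift n m) (@lshift n m) df) => e.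
by split=> -[x [E E']]; [exists (f x)|exists (g x)]; rewrite ?fK ?gK.
Qed.

Lemma graph_id_definable m (A : set (m.-tuple M)) :
  definable A -> definable (graph (@id A)).
Proof.
move=> dA; apply/graph_definable.
have d1 := dpred_rename (@lshift m m) (definable_dpred dA).
have d2 : dpred (fun e => forall i : 'I_m, e (lshift m i) = e (rshift m i)).
  by apply: dpred_all => i; exact: dpred_eq (MVar _) (MVar _).
apply: dpred_ext (dpred_and d1 d2) => e; split=> [[Ae E]|[x [E E']]].
  exists (exist (fun v => v \in A) _ (mem_set Ae)) => /=.
  by split; apply/funext => i; rewrite tnth_mktuple ?E.
split=> [|i]; last by rewrite (congr1 (@^~ i) E) (congr1 (@^~ i) E').
rewrite (_ : mktuple _ = val x); first exact: set_mem (valP x).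
by apply: eq_from_tnth => i; rewrite tnth_mktuple (congr1 (@^~ i) E).
Qed.

Lemma graph_comp_definable m n p (A : set (m.-tuple M)) (B : set (n.-tuple M))
    (C : set (p.-tuple M)) (g : B -> C) (f : A -> B) :
  definable (graph g) -> definable (graph f) -> definable (graph (g \o f)).
Proof.
move=> dg df; apply/graph_definable.
have d1 := dpred_graph (fun i => rshift n (lshift p i)) (@lshift n (m + p)) df.
have d2 := dpred_graph (@lshift n (m + p)) (fun i => rshift n (rshift m i)) dg.
apply: dpred_ext (dpred_exs (dpred_and d1 d2)) => e.
have Er w : (fun i => env_cat w e (rshift n (lshift p i))) =
    (fun i => e (lshift p i)).
  by apply/funext => i; rewrite env_catr.
have El w : (fun i => env_cat w e (lshift (m + p) i)) = w :> ('I_n -> M).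
  by apply/funext => i; rewrite env_catl.
have Err w : (fun i => env_cat w e (rshift n (rshift m i))) =
    (fun i => e (rshift m i)).
  by apply/funext => i; rewrite env_catr.
split=> [[w]|[x [E E']]].
  rewrite Er El Err => -[[x [E1 E2]] [y [E3 E4]]].
  exists x; split=> //=; rewrite E4; congr (tnth (val (g _))).
  by apply/val_inj/eq_from_tnth => i; rewrite -E3 E2.
exists (tnth (val (f x))); rewrite Er El Err.
by split; [exists x|exists (f x)].
Qed.

(* The objects of the groupoid S(M). *)
Record defset := DefSet {
  ddim : nat;
  ddim_gt0 : (0 < ddim)%N;
  dcar :> set (ddim.-tuple M);
  dcar_def : definable dcar
}.
Arguments dcar d : clear implicits.

(* The morphisms of the groupoid S(M). *)
Record defbij (A B : defset) := DefBij {
  dfun :> A -> B;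
  dinv : B -> A;
  dfunK : cancel dfun dinv;
  dinvK : cancel dinv dfun;
  dfun_def : definable (graph dfun)
}.

Lemma defbij_eq (A B : defset) (f g : defbij A B) : f =1 g -> f = g.
Proof.
case: f g => [f f' fK f'K df] [g g' gK g'K dg] /= /funext fg.
move: fK f'K df; rewrite {}fg => fK f'K df.
have E : f' = g' by apply/funext => b; rewrite -{1}(g'K b) fK.
by move: fK f'K; rewrite {}E => fK f'K; congr DefBij; exact: Prop_irrelevance.
Qed.

Definition defbij_id (A : defset) : defbij A A :=
  @DefBij A A id id (fun _ => erefl) (fun _ => erefl)
    (graph_id_definable (dcar_def A)).

Definition defbij_comp (A B C : defset) (g : defbij B C) (f : defbij A B) :
    defbij A C :=
  @DefBij A C (g \o f) (dinv f \o dinv g)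
    (can_comp (dfunK g) (dfunK f)) (can_comp (dinvK f) (dinvK g))
    (graph_comp_definable (dfun_def g) (dfun_def f)).

Definition defbij_inv (A B : defset) (f : defbij A B) : defbij B A :=
  @DefBij B A (dinv f) f (dinvK f) (dfunK f)
    (graph_inv_definable (dfunK f) (dinvK f) (dfun_def f)).

Lemma defbij_comp1m (A B : defset) (f : defbij A B) :
  defbij_comp (defbij_id B) f = f.
Proof. exact: defbij_eq. Qed.

Lemma defbij_compm1 (A B : defset) (f : defbij A B) :
  defbij_comp f (defbij_id A) = f.
Proof. exact: defbij_eq. Qed.

Lemma defbij_compA (A B C D : defset) (h : defbij C D) (g : defbij B C)
    (f : defbij A B) :
  defbij_comp h (defbij_comp g f) = defbij_comp (defbij_comp h g) f.
Proof. exact: defbij_eq. Qed.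

Definition defset_cat : category :=
  Category defbij_comp1m defbij_compm1 defbij_compA.

Section DisjointUnion.
Variable c : M.
Hypothesis c_neq0 : c != 0.

Section Carrier.
Variables (m n : nat).

Definition inlt (a : m.-tuple M) : (m + n).+1.-tuple M :=
  [tuple of 0 :: [tuple of a ++ [tuple of nseq n 0]]].

Definition inrt (b : n.-tuple M) : (m + n).+1.-tuple M :=
  [tuple of c :: [tuple of [tuple of nseq m 0] ++ b]].

Definition inl_rel (w : 'I_m -> M) (e : 'I_(m + n).+1 -> M) : Prop :=
  [/\ e ord0 = 0, forall i, e (lift ord0 (lshift n i)) = w i &
      forall j, e (lift ord0 (rshift m j)) = 0].

Definition inr_rel (w : 'I_n -> M) (e : 'I_(m + n).+1 -> M) : Prop :=
  [/\ e ord0 = c, forall i, e (lift ord0 (lshift n i)) = 0 &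
      forall j, e (lift ord0 (rshift m j)) = w j].

Lemma env_du_eq (T : Type) (e e' : 'I_(m + n).+1 -> T) :
  e ord0 = e' ord0 ->
  (forall i, e (lift ord0 (lshift n i)) = e' (lift ord0 (lshift n i))) ->
  (forall j, e (lift ord0 (rshift m j)) = e' (lift ord0 (rshift m j))) ->
  e = e'.
Proof.
move=> E0 El Er; apply/funext => i; case: (unliftP ord0 i) => [j ->|->//].
by rewrite -[j]splitK; case: (fintype.split j) => a; [exact: El|exact: Er].
Qed.

Lemma inl_relP (a : m.-tuple M) e : inl_rel (tnth a) e <-> e = tnth (inlt a).
Proof.
split=> [[E0 El Er]|->].
  apply: env_du_eq; rewrite ?tnth0// => i; rewrite tnthS.
    by rewrite tnth_lshift.
  by rewrite tnth_rshift tnth_nseq.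
by split=> [|i|i]; rewrite ?tnth0 ?tnthS ?tnth_lshift ?tnth_rshift ?tnth_nseq.
Qed.

Lemma inr_relP (b : n.-tuple M) e : inr_rel (tnth b) e <-> e = tnth (inrt b).
Proof.
split=> [[E0 El Er]|->].
  apply: env_du_eq; rewrite ?tnth0// => i; rewrite tnthS.
    by rewrite tnth_lshift tnth_nseq.
  by rewrite tnth_rshift.
by split=> [|i|i]; rewrite ?tnth0 ?tnthS ?tnth_lshift ?tnth_rshift ?tnth_nseq.
Qed.

Lemma tnth_inj p (u v : p.-tuple M) : tnth u = tnth v -> u = v.
Proof. by move=> uv; apply: eq_from_tnth => i; rewrite uv. Qed.

Lemma inlt_inj : injective inlt.
Proof.
move=> a b /(congr1 (fun v => tnth v)) E; apply: eq_from_tnth => i.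
have := congr1 (@^~ (lift ord0 (lshift n i))) E.
by rewrite !tnthS !tnth_lshift.
Qed.

Lemma inrt_inj : injective inrt.
Proof.
move=> a b /(congr1 (fun v => tnth v)) E; apply: eq_from_tnth => i.
have := congr1 (@^~ (lift ord0 (rshift m i))) E.
by rewrite !tnthS !tnth_rshift.
Qed.

Lemma inlt_neq_inrt a b : inlt a <> inrt b.
Proof.
move=> /(congr1 (fun v => tnth v ord0)); rewrite !tnth0 => /eqP.
by rewrite eq_sym (negbTE c_neq0).
Qed.

Lemma dpred_and3 p (P Q T : ('I_p -> M) -> Prop) :
  dpred P -> dpred Q -> dpred T -> dpred (fun e => [/\ P e, Q e & T e]).
Proof.
move=> dP dQ dT; apply: dpred_ext (dpred_and dP (dpred_and dQ dT)) => e.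
by split=> [[? []]|[]].
Qed.

Lemma dpred_inl_rel p (s : 'I_m -> 'I_p) (t : 'I_(m + n).+1 -> 'I_p) :
  dpred (fun e => inl_rel (fun i => e (s i)) (fun i => e (t i))).
Proof.
apply: dpred_and3; first exact: dpred_eq (MVar _) (MZero _).
  by apply: dpred_all => i; exact: dpred_eq (MVar _) (MVar _).
by apply: dpred_all => i; exact: dpred_eq (MVar _) (MZero _).
Qed.

Lemma dpred_inr_rel p (s : 'I_n -> 'I_p) (t : 'I_(m + n).+1 -> 'I_p) :
  dpred (fun e => inr_rel (fun i => e (s i)) (fun i => e (t i))).
Proof.
apply: dpred_and3; first exact: dpred_eq (MVar _) (MPar _ _).
  by apply: dpred_all => i; exact: dpred_eq (MVar _) (MZero _).
by apply: dpred_all => i; exact: dpred_eq (MVar _) (MVar _).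
Qed.

Lemma mktuple_tnth p (v : p.-tuple M) : mktuple (tnth v) = v.
Proof. by apply: eq_from_tnth => i; rewrite tnth_mktuple. Qed.

Lemma tnth_mktupleE p (e : 'I_p -> M) : tnth (mktuple e) = e.
Proof. by apply/funext => i; rewrite tnth_mktuple. Qed.

End Carrier.

Section Sum.
Variables A B : defset.
Let m := ddim A.
Let n := ddim B.

Definition sum_car : set ((m + n).+1.-tuple M) :=
  (@inlt m n @` A) `|` (@inrt m n @` B).

Lemma sum_car_def : definable sum_car.
Proof.
have dl : dpred (fun e : 'I_(m + (m + n).+1) -> M =>
    dcar A (mktuple (fun i => e (lshift (m + n).+1 i))) /\
    inl_rel (fun i => e (lshift (m + n).+1 i)) (fun j => e (rshift m j))).
  apply: dpred_and; last exact: dpred_inl_rel.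
  exact: dpred_rename (@lshift m (m + n).+1) (definable_dpred (dcar_def A)).
have dr : dpred (fun e : 'I_(n + (m + n).+1) -> M =>
    dcar B (mktuple (fun i => e (lshift (m + n).+1 i))) /\
    inr_rel (fun i => e (lshift (m + n).+1 i)) (fun j => e (rshift n j))).
  apply: dpred_and; last exact: dpred_inr_rel.
  exact: dpred_rename (@lshift n (m + n).+1) (definable_dpred (dcar_def B)).
apply: dpred_definable (dpred_or (dpred_exs dl) (dpred_exs dr)) _ => v.
have El k (w : 'I_k -> M) (u : (m + n).+1.-tuple M) :
    (fun i => env_cat w (tnth u) (lshift _ i)) = w.
  by apply/funext => i; rewrite env_catl.
have Er k (w : 'I_k -> M) (u : (m + n).+1.-tuple M) :
    (fun i => env_cat w (tnth u) (rshift _ i)) = tnth u.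
  by apply/funext => i; rewrite env_catr.
split=> [[[a Aa <-]|[b Bb <-]]|[[w]|[w]]].
- left; exists (tnth a); rewrite El Er mktuple_tnth.
  by split=> //; apply/inl_relP.
- right; exists (tnth b); rewrite El Er mktuple_tnth.
  by split=> //; apply/inr_relP.
- rewrite El Er => -[Aw]; rewrite -{1}(tnth_mktupleE w) => /inl_relP/tnth_inj ->.
  by left; exists (mktuple w).
- rewrite El Er => -[Bw]; rewrite -{1}(tnth_mktupleE w) => /inr_relP/tnth_inj ->.
  by right; exists (mktuple w).
Qed.

(* The disjoint union of A and B, realized as
   {(0, a, 0) | a in A} + {(c, 0, b) | b in B}. *)
Definition defsum : defset := @DefSet (m + n).+1 isT sum_car sum_car_def.

Lemma sum_inl_proof (a : A) : @inlt m n (val a) \in sum_car.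
Proof. by rewrite inE; left; exists (val a) => //; exact: set_mem (valP a). Qed.

Lemma sum_inr_proof (b : B) : @inrt m n (val b) \in sum_car.
Proof. by rewrite inE; right; exists (val b) => //; exact: set_mem (valP b). Qed.

Definition join (x : (A + B)%type) : defsum :=
  match x with
  | inl a => exist (fun v => v \in sum_car) _ (sum_inl_proof a)
  | inr b => exist (fun v => v \in sum_car) _ (sum_inr_proof b)
  end.

Lemma join_surj (z : defsum) : exists x, join x = z.
Proof.
have := set_mem (valP z) => -[[a Aa az]|[b Bb bz]].
  by exists (inl (exist (fun v => v \in dcar A) a (mem_set Aa))); apply: val_inj.
by exists (inr (exist (fun v => v \in dcar B) b (mem_set Bb))); apply: val_inj.
Qed.

Lemma join_inj : injective join.
Proof.
move=> [a|b] [a'|b'] /(congr1 val) /=.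
- by move=> /inlt_inj/val_inj ->.
- by move=> /inlt_neq_inrt.
- by move=> /esym/inlt_neq_inrt.
- by move=> /inrt_inj/val_inj ->.
Qed.

Definition dsplit (z : defsum) : (A + B)%type := sval (cid (join_surj z)).

Lemma dsplitK : cancel dsplit join.
Proof. by move=> z; exact: svalP (cid (join_surj z)). Qed.

Lemma joinK : cancel join dsplit.
Proof. by move=> x; apply: join_inj; rewrite dsplitK. Qed.

Lemma graph_inl : definable (graph (join \o inl)).
Proof.
apply/graph_definable.
have d := dpred_and (dpred_rename (@lshift m (m + n).+1) (definable_dpred (dcar_def A)))
  (@dpred_inl_rel m n _ (lshift (m + n).+1) (@rshift m (m + n).+1)).
apply: dpred_ext d => e; split=> [[Ae]|[x [E E']]].
  rewrite -{1}(tnth_mktupleE (fun i => e (lshift _ i))) => /inl_relP E.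
  by exists (exist (fun v => v \in dcar A) _ (mem_set Ae)) => /=; rewrite tnth_mktupleE.
rewrite E mktuple_tnth; split; first exact: set_mem (valP x).
by apply/inl_relP; rewrite E'.
Qed.

Lemma graph_inr : definable (graph (join \o inr)).
Proof.
apply/graph_definable.
have d := dpred_and (dpred_rename (@lshift n (m + n).+1) (definable_dpred (dcar_def B)))
  (@dpred_inr_rel m n _ (lshift (m + n).+1) (@rshift n (m + n).+1)).
apply: dpred_ext d => e; split=> [[Ae]|[x [E E']]].
  rewrite -{1}(tnth_mktupleE (fun i => e (lshift _ i))) => /inr_relP E.
  by exists (exist (fun v => v \in dcar B) _ (mem_set Ae)) => /=; rewrite tnth_mktupleE.
rewrite E mktuple_tnth; split; first exact: set_mem (valP x).
by apply/inr_relP; rewrite E'.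
Qed.

Lemma graph_copair p (C : set (p.-tuple M)) (h : defsum -> C) :
  definable (graph (h \o (join \o inl))) ->
  definable (graph (h \o (join \o inr))) ->
  definable (graph h).
Proof.
move=> dl dr; apply/graph_definable.
have L := dpred_exs (dpred_and
  (dpred_graph (@lshift m ((m + n).+1 + p)) (fun i => rshift m (lshift p i)) graph_inl)
  (dpred_graph (@lshift m ((m + n).+1 + p)) (fun i => rshift m (rshift _ i)) dl)).
have R' := dpred_exs (dpred_and
  (dpred_graph (@lshift n ((m + n).+1 + p)) (fun i => rshift n (lshift p i)) graph_inr)
  (dpred_graph (@lshift n ((m + n).+1 + p)) (fun i => rshift n (rshift _ i)) dr)).
apply: dpred_ext (dpred_or L R') => e.
have E1 k (w : 'I_k -> M) : (fun i => env_cat w e (lshift _ i)) = w.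
  by apply/funext => i; rewrite env_catl.
have E2 k (w : 'I_k -> M) : (fun i => env_cat w e (rshift k (lshift p i))) =
    (fun i => e (lshift p i)).
  by apply/funext => i; rewrite env_catr.
have E3 k (w : 'I_k -> M) : (fun i => env_cat w e (rshift k (rshift (m + n).+1 i))) =
    (fun i => e (rshift (m + n).+1 i)).
  by apply/funext => i; rewrite env_catr.
split=> [[[w]|[w]]|[z [Ez Ez']]].
- rewrite E1 E2 E3 => -[[a [wa ea]] [a' [wa' ea']]].
  exists (join (inl a)); split=> //; rewrite ea'.
  by congr (tnth (val (h (join (inl _))))); apply/val_inj/tnth_inj; rewrite -wa.
- rewrite E1 E2 E3 => -[[a [wa ea]] [a' [wa' ea']]].
  exists (join (inr a)); split=> //; rewrite ea'.
  by congr (tnth (val (h (join (inr _))))); apply/val_inj/tnth_inj; rewrite -wa.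
- rewrite -(dsplitK z) in Ez Ez'; case: (dsplit z) Ez Ez' => [a|b] Ez Ez'.
    by left; exists (tnth (val a)); rewrite E1 E2 E3; split; exists a.
  by right; exists (tnth (val b)); rewrite E1 E2 E3; split; exists b.
Qed.

End Sum.

Definition dinl (A B : defset) (a : A) : defsum A B := join (inl a).
Definition dinr (A B : defset) (b : B) : defsum A B := join (inr b).
Arguments dinl {A B} a.
Arguments dinr {A B} b.

Definition copair (A B : defset) p (C : set (p.-tuple M)) (l : A -> C)
    (r : B -> C) (z : defsum A B) : C :=
  match dsplit z with inl a => l a | inr b => r b end.

Lemma copair_inl (A B : defset) p (C : set (p.-tuple M)) (l : A -> C)
    (r : B -> C) a : copair l r (dinl a) = l a.
Proof. by rewrite /copair joinK. Qed.

Lemma copair_inr (A B : defset) p (C : set (p.-tuple M)) (l : A -> C)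
    (r : B -> C) b : copair l r (dinr b) = r b.
Proof. by rewrite /copair joinK. Qed.

Lemma defsum_ind (A B : defset) (P : defsum A B -> Prop) :
  (forall a, P (dinl a)) -> (forall b, P (dinr b)) -> forall z, P z.
Proof. by move=> Pl Pr z; rewrite -(dsplitK z); case: (dsplit z). Qed.

Lemma copair_definable (A B : defset) p (C : set (p.-tuple M)) (l : A -> C)
    (r : B -> C) :
  definable (graph l) -> definable (graph r) -> definable (graph (copair l r)).
Proof.
move=> dl dr; apply: graph_copair.
  rewrite (_ : _ \o _ = l)//; apply/funext => a; exact: copair_inl.
rewrite (_ : _ \o _ = r)//; apply/funext => b; exact: copair_inr.
Qed.

Lemma dinl_definable (A B : defset) : definable (graph (@dinl A B)).
Proof. exact: graph_inl. Qed.

Lemma dinr_definable (A B : defset) : definable (graph (@dinr A B)).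
Proof. exact: graph_inr. Qed.

Lemma definable0 n : definable (set0 : set (n.-tuple M)).
Proof. exact: dpred_definable (dpred_false n) (fun=> iff_refl _). Qed.

Definition defempty : defset := @DefSet 1 isT set0 (definable0 1).

Definition dabsurd p (C : set (p.-tuple M)) (x : defempty) : C :=
  False_rect C (set_mem (valP x)).

Lemma dabsurd_definable p (C : set (p.-tuple M)) : definable (graph (@dabsurd p C)).
Proof.
rewrite (_ : graph _ = set0); first exact: definable0.
by apply/seteqP; split=> // z [x]; have := set_mem (valP x).
Qed.

Section Tensor.
Variables (A B C D : defset) (f : defbij A B) (g : defbij C D).

Definition dsum_fun : defsum A C -> defsum B D :=
  copair (dinl \o f) (dinr \o g).
Definition dsum_inv : defsum B D -> defsum A C :=
  copair (dinl \o dinv f) (dinr \o dinv g).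

Lemma dsum_funK : cancel dsum_fun dsum_inv.
Proof.
by elim/defsum_ind=> z; rewrite /dsum_fun /dsum_inv
  ?(copair_inl, copair_inr) /= ?(copair_inl, copair_inr) /= dfunK.
Qed.

Lemma dsum_invK : cancel dsum_inv dsum_fun.
Proof.
by elim/defsum_ind=> z; rewrite /dsum_fun /dsum_inv
  ?(copair_inl, copair_inr) /= ?(copair_inl, copair_inr) /= dinvK.
Qed.

Lemma dsum_fun_def : definable (graph dsum_fun).
Proof.
apply: copair_definable; apply: graph_comp_definable; try exact: dfun_def.
  exact: dinl_definable.
exact: dinr_definable.
Qed.

Definition defbij_sum : defbij (defsum A C) (defsum B D) :=
  DefBij dsum_funK dsum_invK dsum_fun_def.

Lemma defbij_sum_inl a : defbij_sum (dinl a) = dinl (f a).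
Proof. exact: copair_inl. Qed.

Lemma defbij_sum_inr a : defbij_sum (dinr a) = dinr (g a).
Proof. exact: copair_inr. Qed.

End Tensor.

Section Assoc.
Variables A B C : defset.

Definition dassoc_fun : defsum (defsum A B) C -> defsum A (defsum B C) :=
  copair (copair dinl (dinr \o dinl)) (dinr \o dinr).
Definition dassoc_inv : defsum A (defsum B C) -> defsum (defsum A B) C :=
  copair (dinl \o dinl) (copair (dinl \o dinr) dinr).

Lemma dassoc_funK : cancel dassoc_fun dassoc_inv.
Proof.
rewrite /dassoc_fun /dassoc_inv; elim/defsum_ind; first elim/defsum_ind.
- by move=> a; rewrite !copair_inl.
- by move=> b; rewrite copair_inl copair_inr /= copair_inr copair_inl.
- by move=> c'; rewrite copair_inr /= !copair_inr.
Qed.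

Lemma dassoc_invK : cancel dassoc_inv dassoc_fun.
Proof.
rewrite /dassoc_fun /dassoc_inv; elim/defsum_ind; last elim/defsum_ind.
- by move=> a; rewrite copair_inl /= !copair_inl.
- by move=> b; rewrite copair_inr copair_inl /= copair_inl copair_inr.
- by move=> c'; rewrite !copair_inr.
Qed.

Lemma dassoc_def : definable (graph dassoc_fun).
Proof.
apply: copair_definable; first apply: copair_definable.
- exact: dinl_definable.
- by apply: graph_comp_definable; [exact: dinr_definable|exact: dinl_definable].
- by apply: graph_comp_definable; exact: dinr_definable.
Qed.

Definition defassoc : defbij (defsum (defsum A B) C) (defsum A (defsum B C)) :=
  DefBij dassoc_funK dassoc_invK dassoc_def.

Lemma defassoc_ll a : defassoc (dinl (dinl a)) = dinl a.
Proof. by rewrite /= /dassoc_fun !copair_inl. Qed.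

Lemma defassoc_lr b : defassoc (dinl (dinr b)) = dinr (dinl b).
Proof. by rewrite /= /dassoc_fun copair_inl copair_inr. Qed.

Lemma defassoc_r x : defassoc (dinr x) = dinr (dinr x).
Proof. by rewrite /= /dassoc_fun copair_inr. Qed.

End Assoc.

Section Unit.
Variable A : defset.

Definition dunitl_fun : defsum defempty A -> A := copair (@dabsurd _ A) id.
Definition dunitr_fun : defsum A defempty -> A := copair id (@dabsurd _ A).

Lemma dunitl_funK : cancel dunitl_fun dinr.
Proof.
elim/defsum_ind=> z; first by have := set_mem (valP z).
by rewrite /dunitl_fun copair_inr.
Qed.

Lemma dunitl_invK : cancel dinr dunitl_fun.
Proof. by move=> z; rewrite /dunitl_fun copair_inr. Qed.

Lemma dunitr_funK : cancel dunitr_fun dinl.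
Proof.
elim/defsum_ind=> z; last by have := set_mem (valP z).
by rewrite /dunitr_fun copair_inl.
Qed.

Lemma dunitr_invK : cancel dinl dunitr_fun.
Proof. by move=> z; rewrite /dunitr_fun copair_inl. Qed.

Lemma dunitl_def : definable (graph dunitl_fun).
Proof.
apply: copair_definable; first exact: dabsurd_definable.
exact: graph_id_definable (dcar_def A).
Qed.

Lemma dunitr_def : definable (graph dunitr_fun).
Proof.
apply: copair_definable; last exact: dabsurd_definable.
exact: graph_id_definable (dcar_def A).
Qed.

Definition defunitl : defbij (defsum defempty A) A :=
  DefBij dunitl_funK dunitl_invK dunitl_def.

Definition defunitr : defbij (defsum A defempty) A :=
  DefBij dunitr_funK dunitr_invK dunitr_def.

Lemma defunitl_r a : defunitl (dinr a) = a.
Proof. exact: copair_inr. Qed.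

Lemma defunitr_l a : defunitr (dinl a) = a.
Proof. exact: copair_inl. Qed.

End Unit.

Section Braid.

Definition dbraid_fun (A B : defset) : defsum A B -> defsum B A :=
  copair dinr dinl.

Lemma dbraid_funK (A B : defset) : cancel (@dbraid_fun A B) (@dbraid_fun B A).
Proof.
by rewrite /dbraid_fun; elim/defsum_ind=> z;
  rewrite ?(copair_inl, copair_inr) ?(copair_inl, copair_inr).
Qed.

Lemma dbraid_def (A B : defset) : definable (graph (@dbraid_fun A B)).
Proof.
by apply: copair_definable; [exact: dinr_definable|exact: dinl_definable].
Qed.

Definition defbraid (A B : defset) : defbij (defsum A B) (defsum B A) :=
  DefBij (@dbraid_funK A B) (@dbraid_funK B A) (@dbraid_def A B).

Lemma defbraid_l (A B : defset) a : defbraid A B (dinl a) = dinr a.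
Proof. exact: copair_inl. Qed.

Lemma defbraid_r (A B : defset) b : defbraid A B (dinr b) = dinl b.
Proof. exact: copair_inr. Qed.

End Braid.

Lemma defbij_compE (A B C : defset) (g : defbij B C) (f : defbij A B) a :
  defbij_comp g f a = g (f a).
Proof. by []. Qed.

Lemma defbij_idE (A : defset) a : defbij_id A a = a.
Proof. by []. Qed.

Lemma defempty_false (x : defempty) : False.
Proof. exact: set_mem (valP x). Qed.

Let dE := (defbij_compE, defbij_idE, defbij_sum_inl, defbij_sum_inr, defassoc_ll,
  defassoc_lr, defassoc_r, defunitl_r, defunitr_l, defbraid_l, defbraid_r).

Lemma defbij_invl (A B : defset) (f : defbij A B) :
  defbij_comp (defbij_inv f) f = defbij_id A.
Proof. by apply: defbij_eq => a; exact: dfunK. Qed.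

Lemma defbij_invr (A B : defset) (f : defbij A B) :
  defbij_comp f (defbij_inv f) = defbij_id B.
Proof. by apply: defbij_eq => a; exact: dinvK. Qed.

Lemma defbij_sum1 (A B : defset) :
  defbij_sum (defbij_id A) (defbij_id B) = defbij_id (defsum A B).
Proof. by apply: defbij_eq; elim/defsum_ind=> z; rewrite !dE. Qed.

Lemma defbij_sumM (A B C A' B' C' : defset) (g : defbij B C) (f : defbij A B)
    (g' : defbij B' C') (f' : defbij A' B') :
  defbij_sum (defbij_comp g f) (defbij_comp g' f') =
  defbij_comp (defbij_sum g g') (defbij_sum f f').
Proof. by apply: defbij_eq; elim/defsum_ind=> z; rewrite !dE. Qed.

Lemma defassoc_nat (A B C A' B' C' : defset)
    (f : defbij A A') (g : defbij B B') (h : defbij C C') :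
  defbij_comp (defassoc A' B' C') (defbij_sum (defbij_sum f g) h) =
  defbij_comp (defbij_sum f (defbij_sum g h)) (defassoc A B C).
Proof.
by apply: defbij_eq; elim/defsum_ind; [elim/defsum_ind|]=> z; rewrite !dE.
Qed.

Lemma defunitl_nat (A B : defset) (f : defbij A B) :
  defbij_comp (defunitl B) (defbij_sum (defbij_id defempty) f) =
  defbij_comp f (defunitl A).
Proof.
by apply: defbij_eq; elim/defsum_ind=> z; [case: (defempty_false z)|rewrite !dE].
Qed.

Lemma defunitr_nat (A B : defset) (f : defbij A B) :
  defbij_comp (defunitr B) (defbij_sum f (defbij_id defempty)) =
  defbij_comp f (defunitr A).
Proof.
by apply: defbij_eq; elim/defsum_ind=> z; [rewrite !dE|case: (defempty_false z)].
Qed.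

Lemma defbraid_nat (A B A' B' : defset) (f : defbij A A') (g : defbij B B') :
  defbij_comp (defbraid A' B') (defbij_sum f g) =
  defbij_comp (defbij_sum g f) (defbraid A B).
Proof. by apply: defbij_eq; elim/defsum_ind=> z; rewrite !dE. Qed.

Lemma defpentagon (A B C D : defset) :
  defbij_comp (defassoc A B (defsum C D)) (defassoc (defsum A B) C D) =
  defbij_comp (defbij_sum (defbij_id A) (defassoc B C D))
    (defbij_comp (defassoc A (defsum B C) D)
      (defbij_sum (defassoc A B C) (defbij_id D))).
Proof.
by apply: defbij_eq; elim/defsum_ind;
  [elim/defsum_ind; [elim/defsum_ind|]|]=> z; rewrite !dE.
Qed.

Lemma deftriangle (A B : defset) :
  defbij_comp (defbij_sum (defbij_id A) (defunitl B)) (defassoc A defempty B) =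
  defbij_sum (defunitr A) (defbij_id B).
Proof.
apply: defbij_eq; elim/defsum_ind; first elim/defsum_ind.
- by move=> z; rewrite !dE.
- by move=> z; case: (defempty_false z).
- by move=> z; rewrite !dE.
Qed.

Lemma defunitlA (A B : defset) :
  defbij_comp (defunitl (defsum A B)) (defassoc defempty A B) =
  defbij_sum (defunitl A) (defbij_id B).
Proof.
apply: defbij_eq; elim/defsum_ind; first elim/defsum_ind.
- by move=> z; case: (defempty_false z).
- by move=> z; rewrite !dE.
- by move=> z; rewrite !dE.
Qed.

Lemma defbraidK (A B : defset) :
  defbij_comp (defbraid B A) (defbraid A B) = defbij_id (defsum A B).
Proof. by apply: defbij_eq; elim/defsum_ind=> z; rewrite !dE. Qed.

Lemma defhexagon (A B C : defset) :
  defbij_comp (defassoc B C A)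
    (defbij_comp (defbraid A (defsum B C)) (defassoc A B C)) =
  defbij_comp (defbij_sum (defbij_id B) (defbraid A C))
    (defbij_comp (defassoc B A C) (defbij_sum (defbraid A B) (defbij_id C))).
Proof.
by apply: defbij_eq; elim/defsum_ind; [elim/defsum_ind|]=> z; rewrite !dE.
Qed.

Definition defset_smg : sym_mon_groupoid :=
  @SymMonGroupoid defset_cat defbij_inv defbij_invl defbij_invr defsum defbij_sum
    defbij_sum1 defbij_sumM defempty defassoc defunitl defunitr defbraid
    defassoc_nat defunitl_nat defunitr_nat defbraid_nat defpentagon deftriangle
    defunitlA defbraidK defhexagon.

End DisjointUnion.

Definition graphT n (f : n.-tuple M -> n.-tuple M) : set ((n + n).-tuple M) :=
  [set z | exists v : n.-tuple M, z = [tuple of v ++ f v]].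

Record Omega (n : nat) := MkOmega {
  ofun :> n.-tuple M -> n.-tuple M;
  oinv : n.-tuple M -> n.-tuple M;
  ofunK : cancel ofun oinv;
  oinvK : cancel oinv ofun;
  ofun_def : definable (graphT ofun)
}.

Section OmegaGroup.
Variable n : nat.
Implicit Types f g h : Omega n.

Lemma Omega_eq f g : f =1 g -> f = g.
Proof.
case: f g => [f f' fK f'K df] [g g' gK g'K dg] /= /funext fg.
move: fK f'K df; rewrite {}fg => fK f'K df.
have E : f' = g' by apply/funext => b; rewrite -{1}(g'K b) fK.
by move: fK f'K; rewrite {}E => fK f'K; congr MkOmega; exact: Prop_irrelevance.
Qed.

Definition toT (v : n.-tuple M) : [set: n.-tuple M] :=
  exist (fun v => v \in [set: n.-tuple M]) v (in_setT v).

Lemma toTK : cancel toT val. Proof. by []. Qed.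

Lemma graphTE (f : n.-tuple M -> n.-tuple M) :
  graphT f = graph (toT \o (f \o val) : [set: n.-tuple M] -> [set: n.-tuple M]).
Proof.
apply/seteqP; split=> z [v ->]; first by exists (toT v).
by exists (val v).
Qed.

Lemma definableT : definable [set: n.-tuple M].
Proof. by apply: dpred_definable (dpred_true n) _ => v. Qed.

Lemma graphT_id : definable (graphT (@id (n.-tuple M))).
Proof.
rewrite graphTE (_ : _ \o _ = id); first exact: graph_id_definable definableT.
by apply/funext => v; exact: val_inj.
Qed.

Lemma graphT_comp (f g : n.-tuple M -> n.-tuple M) :
  definable (graphT g) -> definable (graphT f) -> definable (graphT (g \o f)).
Proof. by rewrite !graphTE; exact: graph_comp_definable. Qed.

Lemma graphT_inv (f g : n.-tuple M -> n.-tuple M) :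
  cancel f g -> cancel g f -> definable (graphT f) -> definable (graphT g).
Proof.
move=> fK gK; rewrite !graphTE; apply: graph_inv_definable => v;
  by apply: val_inj; rewrite /= ?fK ?gK.
Qed.

Definition Omega_one : Omega n :=
  @MkOmega n id id (fun=> erefl) (fun=> erefl) graphT_id.

Definition Omega_mul g f : Omega n :=
  @MkOmega n (g \o f) (oinv f \o oinv g)
    (can_comp (ofunK g) (ofunK f)) (can_comp (oinvK f) (oinvK g))
    (graphT_comp (ofun_def g) (ofun_def f)).

Definition Omega_inv f : Omega n :=
  @MkOmega n (oinv f) f (oinvK f) (ofunK f)
    (graphT_inv (ofunK f) (oinvK f) (ofun_def f)).

Lemma Omega_mulA : associative Omega_mul.
Proof. by move=> h g f; exact: Omega_eq. Qed.

Lemma Omega_mul1 : left_id Omega_one Omega_mul.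
Proof. by move=> f; exact: Omega_eq. Qed.

Lemma Omega_mul1r : right_id Omega_one Omega_mul.
Proof. by move=> f; exact: Omega_eq. Qed.

Lemma Omega_mulV : left_inverse Omega_one Omega_inv Omega_mul.
Proof. by move=> f; apply: Omega_eq => v; exact: ofunK. Qed.

Lemma Omega_mulVr : right_inverse Omega_one Omega_inv Omega_mul.
Proof. by move=> f; apply: Omega_eq => v; exact: oinvK. Qed.

HB.instance Definition _ := gen_eqMixin (Omega n).
HB.instance Definition _ := gen_choiceMixin (Omega n).
HB.instance Definition _ := isGroup.Build (Omega n)
  Omega_mulA Omega_mul1 Omega_mul1r Omega_mulV Omega_mulVr.

End OmegaGroup.

Section OmegaExt.
Variable n : nat.

Definition tinit (v : n.+1.-tuple M) : n.-tuple M :=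
  [tuple tnth v (widen_ord (leqnSn n) i) | i < n].

Definition ext_fun (f : n.-tuple M -> n.-tuple M) (v : n.+1.-tuple M) :
    n.+1.-tuple M :=
  if tnth v ord_max == 0 then [tuple of rcons (f (tinit v)) 0] else v.

Lemma tnth_rcons_last (w : n.-tuple M) (x : M) :
  tnth [tuple of rcons w x] ord_max = x.
Proof. by rewrite (tnth_nth 0) /= nth_rcons size_tuple ltnn eqxx. Qed.

Lemma tnth_rcons_widen (w : n.-tuple M) (x : M) i :
  tnth [tuple of rcons w x] (widen_ord (leqnSn n) i) = tnth w i.
Proof. by rewrite !(tnth_nth 0) /= nth_rcons size_tuple ltn_ord. Qed.

Lemma tinit_rcons (w : n.-tuple M) (x : M) : tinit [tuple of rcons w x] = w.
Proof. by apply: eq_from_tnth => i; rewrite tnth_mktuple tnth_rcons_widen. Qed.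

Lemma eq_tuple_last (u v : n.+1.-tuple M) :
  tinit u = tinit v -> tnth u ord_max = tnth v ord_max -> u = v.
Proof.
move=> E El; apply: eq_from_tnth => i.
have [i_n|n_i] := ltnP i n.
  have := congr1 (fun w => tnth w (Ordinal i_n)) E; rewrite !tnth_mktuple.
  by rewrite (_ : widen_ord _ _ = i)//; exact: val_inj.
by rewrite (_ : i = ord_max)//; apply/val_inj/eqP; rewrite eqn_leq n_i -ltnS ltn_ord.
Qed.

Lemma rcons_tinit (v : n.+1.-tuple M) :
  [tuple of rcons (tinit v) (tnth v ord_max)] = v.
Proof. by apply: eq_tuple_last; rewrite ?tinit_rcons ?tnth_rcons_last. Qed.

Lemma ext_funK (f g : n.-tuple M -> n.-tuple M) :
  cancel f g -> cancel (ext_fun f) (ext_fun g).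
Proof.
move=> fK v; rewrite {2}/ext_fun; case: ifPn => [/eqP v0|v0].
  by rewrite /ext_fun tnth_rcons_last eqxx tinit_rcons fK -v0 rcons_tinit.
by rewrite /ext_fun (negbTE v0).
Qed.

Lemma ext_fun_def (f : n.-tuple M -> n.-tuple M) :
  definable (graphT f) -> definable (graphT (ext_fun f)).
Proof.
rewrite graphTE => df.
pose wd (i : 'I_n) := widen_ord (leqnSn n) i.
have d1 := dpred_and (dpred_eq (MVar (lshift n.+1 (@ord_max n))) (MZero _))
  (dpred_and (dpred_eq (MVar (rshift n.+1 (@ord_max n))) (MZero _))
    (dpred_graph (fun i => lshift n.+1 (wd i)) (fun i => rshift n.+1 (wd i)) df)).
have d2 : dpred (fun e : 'I_(n.+1 + n.+1) -> M =>
    e (lshift n.+1 ord_max) <> 0 /\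
    forall i : 'I_n.+1, e (lshift n.+1 i) = e (rshift n.+1 i)).
  apply: dpred_and; first by apply: dpred_not; exact: dpred_eq (MVar _) (MZero _).
  by apply: dpred_all => i; exact: dpred_eq (MVar _) (MVar _).
apply: dpred_definable (dpred_or d1 d2) _ => z /=; split=> [[v ->]|].
  rewrite !tnth_lshift !tnth_rshift /ext_fun; case: eqP => v0; last first.
    by right; split=> // i; rewrite tnth_lshift tnth_rshift.
  left; split=> //; split; first exact: tnth_rcons_last.
  exists (toT (tinit v)); split; apply/funext => i /=.
    by rewrite tnth_lshift tnth_mktuple.
  by rewrite tnth_rshift tnth_rcons_widen.
pose u : n.+1.-tuple M := [tuple tnth z (lshift n.+1 i) | i < n.+1].
have zE (w : n.+1.-tuple M) : (forall i, tnth w i = tnth z (rshift n.+1 i)) ->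
    z = [tuple of u ++ w].
  move=> wE; apply: eq_from_tnth => i; rewrite -[i]splitK.
  case: (fintype.split i) => j /=.
    by rewrite tnth_lshift tnth_mktuple.
  by rewrite tnth_rshift wE.
move=> [[z0 [z0' [v [E E']]]]|[z0 E]]; exists u; apply: zE => i; last first.
  by rewrite /ext_fun tnth_mktuple (negbTE (introN eqP z0)) tnth_mktuple.
rewrite /ext_fun tnth_mktuple z0 eqxx.
have uE : tinit u = val v.
  apply: eq_from_tnth => j; rewrite !tnth_mktuple.
  exact: (congr1 (fun e => e j) E).
rewrite uE; have [i_n|n_i] := ltnP i n.
  have -> : i = wd (Ordinal i_n) by exact: val_inj.
  by rewrite tnth_rcons_widen; have := congr1 (fun e => e (Ordinal i_n)) E'.
have -> : i = ord_max.
  by apply/val_inj/eqP; rewrite eqn_leq n_i -ltnS ltn_ord.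
by rewrite tnth_rcons_last z0'.
Qed.

Definition Omega_ext (f : Omega n) : Omega n.+1 :=
  MkOmega (ext_funK (ofunK f)) (ext_funK (oinvK f)) (ext_fun_def (ofun_def f)).

Lemma Omega_extM : {morph Omega_ext : f g / (f * g)%g}.
Proof.
move=> f g; apply: Omega_eq => v /=; rewrite {3}/ext_fun.
case: ifPn => [v0|v0]; rewrite /ext_fun ?(negbTE v0) ?v0//.
by rewrite tnth_rcons_last eqxx tinit_rcons.
Qed.

HB.instance Definition _ :=
  isMultiplicative.Build (Omega n) (Omega n.+1) Omega_ext Omega_extM.

End OmegaExt.

(* The disjoint union in M^(m+n+1) is formed with a nonzero tag c. *)
Lemma infinite_neq0 : infinite_set [set: M] -> exists c : M, c != 0.
Proof.
move=> infM; apply: contrapT => noc; apply: infM.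
rewrite (_ : setT = [set 0]); first exact: finite_set1.
apply/seteqP; split=> // x _ /=; apply/eqP; apply: contrapT => x0.
by apply: noc; exists x; apply/negP.
Qed.

Definition module_smg (infM : infinite_set [set: M]) : sym_mon_groupoid :=
  defset_smg (xchooseP (infinite_neq0 infM)).

Definition module_K1 (K : realType) (infM : infinite_set [set: M]) : groupType :=
  K1 K (module_smg infM).

Definition is_basis (B : set M) : Prop :=
  (forall (s : seq M) (a : M -> R), uniq s -> (forall b, b \in s -> B b) ->
     \sum_(b <- s) a b *: b = 0 -> forall b, b \in s -> a b = 0) /\
  (forall x : M, exists (s : seq M) (a : M -> R),
     (forall b, b \in s -> B b) /\ x = \sum_(b <- s) a b *: b).

Definition is_free_module : Prop := exists B : set M, is_basis B.

End ModuleLanguage.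

Arguments Omega {R} M n.
Arguments Omega_ext {R M n} f.
Arguments is_free_module {R} M.

Definition is_PID (R : idomainType) : Prop :=
  forall I : set R,
    I 0%R -> (forall x y, I x -> I y -> I (x + y)%R) ->
    (forall a x, I x -> I (a * x)%R) ->
    exists g : R, I = [set (a * g)%R | a in [set: R]].

(* Main.v *)
Require Import Defs.
From HB Require Import structures.
From mathcomp Require Import all_boot all_order all_algebra.
From mathcomp Require Import all_classical all_reals topology normedtype.
From mathcomp Require Import homotopy ring lra.
From Stdlib Require Import Relations.
Import Defs.

(** The fundamental group of the realization of a nerve is computed by two facts. First, a
    functor to a group extends to a holonomy defined on classes of paths between
    vertices [functor_holonomy]. Secondly, every path between vertices is homotopic to a
    zigzag of edges [all_zigzag]. Both rest on the same picture: a point of a simplex is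
    a subdivision of the unit interval into pieces labelled by the vertices, and the
    gluing relations merge adjacent pieces or drop empty ones. For a subinterval [J],
    consider the points where one class of vertices, up to identity edges, occupies more
    than half of [J]. These sets are open and cover the realization. Over such a set the
    covering space attached to a functor is trivial, with transition elements given by
    the edges between the selected vertices; and the set contracts onto vertices along
    straight segments, so that a path inside it goes to a vertex and comes back.

    In the category of pairs of objects of [S] two morphisms with the same source can be
    completed to a square. Hence a zigzag from the base object is a fraction, and every
    element of [K_1] is the class [aut_class th] of an automorphism [th] of an object of
    [S] [aut_class_surj]. This class is invariant under conjugation and under the addition
    of a summand, and thus such classes over one object commute.

    Now let [S] consist of the definable sets. The complement of the image of a definable
    embedding is definable, so that extending a bijection by the identity along an
    embedding amounts to adding a summand and conjugating. As each definable set lies in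
    a power [M^N], the maps from the groups of bijections of the powers to [K_1] are
    compatible and jointly surjective.

    For the universal property, let [vn] be a compatible family of morphisms from these
    groups to a group [H]. Extending a definable bijection to a power and applying [vn]
    gives its [value]. The choice of the embedding does not matter: a nonzero element [c]
    of the module provides room to move one embedding off the other, and the involution
    that exchanges two disjoint copies conjugates one extension into the other. A pair
    [(A, B)] in the component of the base object has a stable isomorphism of [A] with [B];
    choose one for each pair. A morphism of pairs transports the stable isomorphism of its
    source, and comparing the result with the one of its target gives a bijection, whose
    value is the determinant [det] of the morphism. The determinant is multiplicative
    [detM], because bijections that act on different summands have commuting values. Its
    holonomy is the required morphism on [K_1], and it is unique by joint surjectivity. *)

Set Implicit Arguments.
Unset Strict Implicit.
Unset Printing Implicit Defensive.
Import Order.TTheory GRing.Theory Num.Theory.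
Import numFieldNormedType.Exports.
Local Open Scope classical_set_scope.
Local Open Scope ring_scope.

(** * The fundamental groupoid *)

Section Equiconnected.
Variable K : realType.
Notation I := (unitI K).

(** The convex combinations of a convex space, without a linear structure: this covers
    intervals, squares and simplices at once. *)
Definition equiconnected (Z : topologicalType) : Prop :=
  exists cb : (Z * Z) * I -> Z,
    [/\ continuous cb, forall z z', cb (z, z', zero) = z,
        forall z z', cb (z, z', one) = z' & forall z t, cb (z, z, t) = z].

Lemma pair_continuous (Y Z W : topologicalType) (f : Y -> Z) (g : Y -> W) :
  continuous f -> continuous g -> continuous (fun y => (f y, g y)).
Proof. by move=> cf cg y; apply: cvg_pair; [exact: cf|exact: cg]. Qed.

(** Nearly all homotopies below have this form: the two paths are images of paths in a
    convex space, where straight lines deform one into the other. *)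
Lemma equiconnected_homotopic (Z Y : topologicalType) (sigma : Z -> Y)
    (phi psi : I -> Z) (x y : Y) (p q : {path I from x to y in Y}) :
  equiconnected Z -> continuous sigma -> continuous phi -> continuous psi ->
  p =1 sigma \o phi -> q =1 sigma \o psi ->
  phi zero = psi zero -> phi one = psi one -> path_homotopic p q.
Proof.
move=> [cb [ccb cb0 cb1 cbd]] csigma cphi cpsi pE qE e0 e1.
exists (sigma \o (cb \o (fun st : I * I => ((phi st.1, psi st.1), st.2)))); split.
- apply: compc => //; apply: compc => //.
  apply: pair_continuous; last exact: snd_continuous.
  by apply: pair_continuous; apply: (compc (@fst_continuous _ _)).
- by move=> s /=; rewrite cb0 pE.
- by move=> s /=; rewrite cb1 qE.
- by move=> t /=; rewrite -e0 cbd -[LHS]/((sigma \o phi) zero) -pE path_zero.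
- by move=> t /=; rewrite -e1 cbd -[LHS]/((sigma \o phi) one) -pE path_one.
Qed.

Lemma val_comp_continuous (Z : topologicalType) (f : Z -> I) :
  continuous f -> continuous (fun z => \val (f z) : K).
Proof. by move=> cf; apply: (compc cf); exact: val_unitI_continuous. Qed.

Lemma lin_continuous (Z : topologicalType) (f g h : Z -> K) :
  continuous f -> continuous g -> continuous h ->
  continuous (fun z => (1 - h z) * f z + h z * g z).
Proof.
move=> cf cg ch z.
suff : {for z, continuous (fun z => (1 - h z) * f z + h z * g z)} by [].
apply: continuousD; apply: continuousM; try exact: cf; try exact: cg; try exact: ch.
by apply: continuousB; [exact: cst_continuous|exact: ch].
Qed.

Lemma unitI_equiconnected : equiconnected I.
Proof.
exists (fun w => clamp ((1 - \val w.2) * \val w.1.1 + \val w.2 * \val w.1.2)).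
split.
- apply: (compc _ (@clamp_continuous K)); apply: lin_continuous.
  + apply: (@val_comp_continuous _ (fun w : I * I * I => w.1.1)).
    by apply: (compc (@fst_continuous _ _)); exact: fst_continuous.
  + apply: (@val_comp_continuous _ (fun w : I * I * I => w.1.2)).
    by apply: (compc (@fst_continuous _ _)); exact: snd_continuous.
  + by apply: (@val_comp_continuous _ (fun w : I * I * I => w.2)); exact: snd_continuous.
- by move=> z z'; rewrite -[RHS]clampK; congr clamp; rewrite Defs.val0 subr0 mul1r mul0r addr0.
- by move=> z z'; rewrite -[RHS]clampK; congr clamp; rewrite Defs.val1 subrr mul1r mul0r add0r.
- by move=> z t /=; rewrite -[RHS]clampK; congr clamp; rewrite -mulrDl subrK mul1r.
Qed.

Lemma prod_equiconnected (Z W : topologicalType) :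
  equiconnected Z -> equiconnected W -> equiconnected (Z * W)%type.
Proof.
move=> [f [cf f0 f1 fd]] [g [cg g0 g1 gd]].
pose A := ((Z * W) * (Z * W) * I)%type.
have c11 : continuous (fun w : A => w.1.1).
  by apply: (compc (@fst_continuous _ _)); exact: fst_continuous.
have c12 : continuous (fun w : A => w.1.2).
  by apply: (compc (@fst_continuous _ _)); exact: snd_continuous.
have c2 : continuous (fun w : A => w.2) by exact: snd_continuous.
exists (fun w => (f ((w.1.1.1, w.1.2.1), w.2), g ((w.1.1.2, w.1.2.2), w.2))).
split=> [|[z w] [z' w']|[z w] [z' w']|[z w] t] /=.
- apply: pair_continuous; apply: compc => //.
    apply: pair_continuous => //; apply: pair_continuous.
      by apply: (compc c11); exact: fst_continuous.
    by apply: (compc c12); exact: fst_continuous.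
  apply: pair_continuous => //; apply: pair_continuous.
    by apply: (compc c11); exact: snd_continuous.
  by apply: (compc c12); exact: snd_continuous.
- by rewrite f0 g0.
- by rewrite f1 g1.
- by rewrite fd gd.
Qed.

End Equiconnected.

Section Groupoid.
Variables (K : realType) (X : topologicalType).
Notation I := (unitI K).
Notation path x y := {path I from x to y in X}.

Lemma concat_left (x y z : X) (a : path x y) (b : path y z) (s : I) :
  \val s <= 2^-1 -> concat a b s = a (affI 2 0 s).
Proof. by rewrite concatE => ->. Qed.

Lemma concat_right (x y z : X) (a : path x y) (b : path y z) (s : I) :
  2^-1 <= \val s -> concat a b s = b (affI 2 (-1) s).
Proof.
move=> h; rewrite concatE; case: ifPn => // h'.
by rewrite affI1 ?affI0 ?path_zero ?path_one//; lra.
Qed.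

Lemma id_continuous (Z : topologicalType) : continuous (@id Z).
Proof. by move=> z; exact: cvg_id. Qed.

(** The left side is the right side run at a different speed. The change of parameter
    [phi] is concave and piecewise affine, hence a minimum of affine functions. *)
Lemma concat_assoc (x y z w : X) (a : path x y) (b : path y z) (c : path z w) :
  path_homotopic (concat (concat a b) c) (concat a (concat b c)).
Proof.
pose phi (s : I) : I := clamp (Num.min (2 * \val s + 0)
  (Num.min (1 * \val s + 4^-1) (2^-1 * \val s + 2^-1))).
have vphi s : \val (phi s) = Num.min (2 * \val s + 0)
    (Num.min (1 * \val s + 4^-1) (2^-1 * \val s + 2^-1)).
  apply: clampE; have := unitI_bounds s; move: (\val s) => r /andP[r0 r1].
  by rewrite !le_min !ge_min; lra.
have phi1 (s : I) : \val s <= 4^-1 -> \val (phi s) = 2 * \val s.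
  have := unitI_bounds s; rewrite vphi; move: (\val s) => r /andP[r0 r1] h.
  by rewrite min_l ?addr0// le_min; lra.
have phi2 (s : I) : 4^-1 <= \val s <= 2^-1 -> \val (phi s) = \val s + 4^-1.
  have := unitI_bounds s; rewrite vphi; move: (\val s) => r /andP[r0 r1] h.
  by rewrite [Num.min (_ * _ + 4^-1) _]min_l ?min_r ?mul1r//; lra.
have phi3 (s : I) : 2^-1 <= \val s -> \val (phi s) = 2^-1 * \val s + 2^-1.
  have := unitI_bounds s; rewrite vphi; move: (\val s) => r /andP[r0 r1] h.
  by rewrite [Num.min (_ * _ + 4^-1) _]min_r ?min_r//; lra.
apply: (equiconnected_homotopic (unitI_equiconnected K)
  (@path_cts K X x w (concat a (concat b c))) _ (@id_continuous (unitI K)) (phi := phi)) => //.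
- apply: (compc _ (@clamp_continuous K)); apply: minI_continuous.
    exact: aff_continuous.
  by apply: minI_continuous; exact: aff_continuous.
- move=> s /=; have bs := unitI_bounds s.
  have [s2|s2] := leP (\val s) 2^-1; last first.
    have p3 := phi3 _ (ltW s2).
    rewrite concat_right ?(ltW s2)// concat_right; last by rewrite p3; lra.
    rewrite concat_right; last by rewrite Defs.valR p3; lra.
    by congr (c _); apply: val_inj; rewrite !Defs.valR ?p3 ?Defs.valR ?p3; lra.
  rewrite concat_left//; have [s4|s4] := leP (\val s) 4^-1.
    have p1 := phi1 _ s4.
    rewrite concat_left; last by rewrite Defs.valL; lra.
    rewrite concat_left; last by rewrite p1; lra.
    by congr (a _); apply: val_inj; rewrite !Defs.valL ?p1 ?Defs.valL//; lra.
  have p2 : \val (phi s) = \val s + 4^-1 by apply: phi2; lra.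
  rewrite concat_right; last by rewrite Defs.valL; lra.
  rewrite concat_right; last by rewrite p2; lra.
  rewrite concat_left; last by rewrite Defs.valR p2; lra.
  by congr (b _); apply: val_inj; rewrite Defs.valR Defs.valL ?Defs.valL ?Defs.valR ?p2//; lra.
- by apply: val_inj; rewrite phi1 Defs.val0; lra.
- by apply: val_inj; rewrite phi3 Defs.val1; lra.
Qed.

Lemma concat_const_left (x y : X) (a : path x y) :
  path_homotopic (concat (const_path K x) a) a.
Proof.
apply: (equiconnected_homotopic (unitI_equiconnected K) (@path_cts K X _ _ a)
  (@affI_continuous K 2 (-1)) (@id_continuous (unitI K))) => //.
- move=> s /=; have [h|/ltW h] := leP (\val s) 2^-1; last by rewrite concat_right.
  by rewrite concat_left// [affI 2 (-1) s]affI0 ?path_zero//; lra.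
- by rewrite affI0// Defs.val0; lra.
- by rewrite affI1// Defs.val1; lra.
Qed.

Lemma concat_const_right (x y : X) (a : path x y) :
  path_homotopic (concat a (const_path K y)) a.
Proof.
apply: (equiconnected_homotopic (unitI_equiconnected K) (@path_cts K X _ _ a)
  (@affI_continuous K 2 0) (@id_continuous (unitI K))) => //.
- move=> s /=; have [h|/ltW h] := leP (\val s) 2^-1; first by rewrite concat_left.
  by rewrite concat_right// [affI 2 0 s]affI1 ?path_one//; lra.
- by rewrite affI0// Defs.val0; lra.
- by rewrite affI1// Defs.val1; lra.
Qed.

Lemma concat_reverse (x y : X) (a : path x y) :
  path_homotopic (concat a (reverse a)) (const_path K x).
Proof.
pose phi (s : I) : I := clamp (Num.min (2 * \val s + 0) ((-2) * \val s + 2)).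
have vphi s : \val (phi s) = Num.min (2 * \val s + 0) ((-2) * \val s + 2).
  apply: clampE; have := unitI_bounds s; move: (\val s) => r /andP[r0 r1].
  by rewrite le_min ge_min; lra.
apply: (equiconnected_homotopic (unitI_equiconnected K) (@path_cts K X _ _ a) (phi := phi)
  (psi := cst zero)).
- apply: (compc _ (@clamp_continuous K)); apply: minI_continuous; exact: aff_continuous.
- exact: cst_continuous.
- move=> s /=; have bs := unitI_bounds s.
  have [h|/ltW h] := leP (\val s) 2^-1.
    rewrite concat_left//; congr (a _); apply: val_inj.
    by rewrite Defs.valL// vphi min_l; lra.
  rewrite concat_right// reverseE; congr (a _); apply: val_inj.
  by rewrite val_affI Defs.valR// ?vphi ?min_r; lra.
- by move=> s /=; rewrite path_zero.
- by apply: val_inj; rewrite vphi Defs.val0 min_l; lra.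
- by apply: val_inj; rewrite vphi Defs.val0 Defs.val1 min_r; lra.
Qed.

Lemma reverseK (x y : X) (a : path x y) : reverse (reverse a) = a.
Proof.
apply/path_eqP => s; rewrite !reverseE; congr (a _); apply: val_inj.
by have bs := unitI_bounds s; rewrite !val_affI; lra.
Qed.

Definition pclass (x y : X) : Type := gen_quot (@path_homotopic K X x y).
Definition pc (x y : X) (a : path x y) : pclass x y := gen_pi (@path_homotopic K X x y) a.

Lemma pcP (x y : X) (a b : path x y) : pc a = pc b <-> path_homotopic a b.
Proof. exact: equiv_piP (@path_homotopic_equiv K X x y) _ _. Qed.

Lemma pc_surj (x y : X) (c : pclass x y) : exists a, c = pc a.
Proof. exact: gen_quotP. Qed.

Definition pcmp (x y z : X) (a : pclass x y) (b : pclass y z) : pclass x z :=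
  pc (concat (repr a) (repr b)).
Definition pinv (x y : X) (a : pclass x y) : pclass y x := pc (reverse (repr a)).
Definition pone (x : X) : pclass x x := pc (const_path K x).

Lemma pcmpE (x y z : X) (a : path x y) (b : path y z) :
  pcmp (pc a) (pc b) = pc (concat a b).
Proof.
apply/pcP; apply: concat_homotopic; exact: equiv_repr (@path_homotopic_equiv K X _ _) _.
Qed.

Lemma pinvE (x y : X) (a : path x y) : pinv (pc a) = pc (reverse a).
Proof.
by apply/pcP; apply: reverse_homotopic; exact: equiv_repr (@path_homotopic_equiv K X _ _) _.
Qed.

Lemma pcmpA (x y z w : X) (a : pclass x y) (b : pclass y z) (c : pclass z w) :
  pcmp a (pcmp b c) = pcmp (pcmp a b) c.
Proof.
have [[[a' ->] [b' ->]] [c' ->]] := (pc_surj a, pc_surj b, pc_surj c).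
by rewrite !pcmpE; apply/esym/pcP; exact: concat_assoc.
Qed.

Lemma pcmp1 (x y : X) (a : pclass x y) : pcmp (pone x) a = a.
Proof.
by have [a' ->] := pc_surj a; rewrite pcmpE; apply/pcP; exact: concat_const_left.
Qed.

Lemma pcmp1r (x y : X) (a : pclass x y) : pcmp a (pone y) = a.
Proof.
by have [a' ->] := pc_surj a; rewrite pcmpE; apply/pcP; exact: concat_const_right.
Qed.

Lemma pcmpV (x y : X) (a : pclass x y) : pcmp a (pinv a) = pone x.
Proof.
by have [a' ->] := pc_surj a; rewrite pinvE pcmpE; apply/pcP; exact: concat_reverse.
Qed.

Lemma pinvK (x y : X) (a : pclass x y) : pinv (pinv a) = a.
Proof. by have [a' ->] := pc_surj a; rewrite !pinvE reverseK. Qed.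

Lemma pcmpVl (x y : X) (a : pclass x y) : pcmp (pinv a) a = pone y.
Proof. by rewrite -[X in pcmp _ X]pinvK pcmpV. Qed.

Lemma pcmpK (x y z : X) (a : pclass x y) (b : pclass y z) : pcmp (pcmp a b) (pinv b) = a.
Proof. by rewrite -pcmpA pcmpV pcmp1r. Qed.

Lemma pcmpVK (x y z : X) (a : pclass x y) (b : pclass z y) : pcmp (pcmp a (pinv b)) b = a.
Proof. by rewrite -pcmpA pcmpVl pcmp1r. Qed.

Lemma pcmpI (x y z : X) (b : pclass y z) (a a' : pclass x y) :
  pcmp a b = pcmp a' b -> a = a'.
Proof. by move=> /(congr1 (fun c => pcmp c (pinv b))); rewrite !pcmpK. Qed.

Lemma pinvM (x y z : X) (a : pclass x y) (b : pclass y z) :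
  pinv (pcmp a b) = pcmp (pinv b) (pinv a).
Proof. by apply: (@pcmpI _ _ _ (pcmp a b)); rewrite pcmpVl pcmpA pcmpVK pcmpVl. Qed.

(** The class of a continuous map on the unit interval; the endpoints are kept as
    separate arguments so that they can be changed along an equation. *)
Definition pmap (f : I -> X) (cf : continuous f) x y (fx : f zero = x) (fy : f one = y) :
  pclass x y := pc (mk_path cf fx fy).

End Groupoid.

(** * Covering spaces given by a discrete cocycle *)

Section LocallyConstant.

Lemma locally_constant (Z : topologicalType) (T : Type) (d : Z -> T) :
  connected [set: Z] -> (forall z, \forall z' \near z, d z' = d z) ->
  forall z z', d z = d z'.
Proof.
move=> cZ ld z z'; pose A := [set w | d w = d z].
have oA : open A.
  by rewrite openE => w Aw; rewrite /interior; apply: filterS (ld w) => w' E; rewrite /A /= E.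
have oAC : open (~` A).
  rewrite openE => w Aw; rewrite /interior; apply: filterS (ld w) => w' E.
  by rewrite /A /= E.
have : A = setT.
  apply: cZ; first by exists z.
    by exists A => //; rewrite setTI.
  by exists A; rewrite ?setTI// -[A]setCK; apply: open_closedC.
by move=> AT; have : A z' by rewrite AT.
Qed.

Lemma unitI_connected (K : realType) : connected [set: unitI K].
Proof.
have -> : [set: unitI K] = @clamp K @` `[0, 1].
  apply/seteqP; split=> // s _; exists (\val s); last by rewrite clampK.
  by rewrite /= in_itv /= unitI_bounds.
apply: connected_continuous_connected; first exact: segment_connected.
by apply: continuous_subspaceT; exact: clamp_continuous.
Qed.

Lemma unitI_compact (K : realType) : compact [set: unitI K].
Proof.
have -> : [set: unitI K] = @clamp K @` `[0, 1].
  apply/seteqP; split=> // s _; exists (\val s); last by rewrite clampK.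
  by rewrite /= in_itv /= unitI_bounds.
apply: continuous_compact; last exact: segment_compact.
by apply: continuous_subspaceT; exact: clamp_continuous.
Qed.

Lemma lebesgue_number (K : realType) (E : normedModType K) (B : set E) (J : Type)
    (P : J -> E -> Prop) :
  compact B -> (forall z, B z -> exists i, \forall z' \near z, P i z') ->
  exists2 d : K, 0 < d &
    forall z, B z -> exists i, forall z', `|z - z'| < d -> P i z'.
Proof.
move=> /compact_near_coveringP cB cov.
pose Q (d : K) (z : E) := exists i, forall z', `|z - z'| < d -> P i z'.
have : \forall d \near 0^'+, B `<=` Q d.
  apply: cB => z Bz; have [i /nbhs_ballP[r /= r0 Pi]] := cov z Bz.
  exists (ball z (r / 2), [set d | d < r / 2]).
    split=> /=; first by apply: nbhsx_ballx; rewrite divr_gt0.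
    by apply: nbhs_right_lt; rewrite divr_gt0.
  move=> [w d] /= [zw dr]; exists i => z' wz'; apply: Pi.
  apply: (@ball_split _ _ w) => //.
  by rewrite -ball_normE /=; exact: lt_trans wz' dr.
move=> H; have [d [d0 BQ]] : exists d : K, 0 < d /\ B `<=` Q d.
  have : \forall d \near (0:K)^'+, 0 < d /\ B `<=` Q d.
    by near=> d; split; [near: d; exact: nbhs_right_gt|near: d].
  by move=> /filter_ex.
by exists d.
Unshelve. all: by end_near.
Qed.

End LocallyConstant.

(** A Cech 1-cocycle with values in a discrete group: [tr i j y g] says that [y]
    lies in the [i]-th and the [j]-th member of an open cover and that [g] is the
    transition element there. *)
Record cocycle (Y : topologicalType) (G : groupType) (J : Type) := Cocycle {
  tr :> J -> J -> Y -> G -> Prop;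
  tr_fun : forall i j y g g', tr i j y g -> tr i j y g' -> g = g';
  tr_comp : forall i j k y g h, tr i j y g -> tr j k y h -> tr i k y (g * h)%g;
  tr_inv : forall i j y g, tr i j y g -> tr j i y (g^-1)%g;
  tr_total : forall i j y, tr i i y 1%g -> tr j j y 1%g -> exists g, tr i j y g;
  tr_open : forall i j g, open [set y | tr i j y g];
  tr_cover : forall y, exists i, tr i i y 1%g
}.

Section Lifts.
Variables (Y : topologicalType) (G : groupType) (J : Type) (c : cocycle Y G J).

Definition cdom (i : J) (y : Y) : Prop := c i i y 1%g.

Lemma tr_doml i j y g : c i j y g -> cdom i y.
Proof. by move=> h; have := tr_comp h (tr_inv h); rewrite mulgV. Qed.

Lemma tr_domr i j y g : c i j y g -> cdom j y.
Proof. by move=> h; have := tr_comp (tr_inv h) h; rewrite mulVg. Qed.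

Definition transition (i j : J) (y : Y) : G := xget 1%g [set g | c i j y g].

Lemma transitionP i j y : cdom i y -> cdom j y -> c i j y (transition i j y).
Proof. by move=> di dj; have [g cg] := tr_total di dj; exact: (xgetI _ cg). Qed.

Lemma transitionE i j y g : c i j y g -> transition i j y = g.
Proof. by move=> h; apply: (tr_fun (transitionP (tr_doml h) (tr_domr h)) h). Qed.

Lemma transitionM i j k y : cdom i y -> cdom j y -> cdom k y ->
  (transition i j y * transition j k y)%g = transition i k y.
Proof.
move=> di dj dk; apply/esym/transitionE.
exact: tr_comp (transitionP di dj) (transitionP dj dk).
Qed.

Lemma transition_near i j y : cdom i y -> cdom j y ->
  \forall y' \near y, c i j y' (transition i j y).
Proof. by move=> di dj; apply: open_nbhs_nbhs; split; [exact: tr_open|exact: transitionP]. Qed.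

Lemma cdom_near i y : cdom i y -> \forall y' \near y, cdom i y'.
Proof. by move=> di; apply: open_nbhs_nbhs; split => //; exact: tr_open. Qed.

(** The coordinates, in the members of the cover that contain [y], of a point above
    [y] in the covering space given by the cocycle. *)
Definition cfiber (y : Y) (x : J -> G) : Prop :=
  forall i j, cdom i y -> cdom j y -> x j = (x i * transition i j y)%g.

(** The group is discrete, so a section is continuous when its coordinates are locally
    constant. *)
Definition lift (Z : topologicalType) (sigma : Z -> Y) (b : Z -> J -> G) : Prop :=
  (forall z, cfiber (sigma z) (b z)) /\
  (forall i z, cdom i (sigma z) -> \forall z' \near z, b z' i = b z i).

Lemma lift_comp (Z W : topologicalType) (sigma : Z -> Y) (b : Z -> J -> G) (f : W -> Z) :
  continuous f -> lift sigma b -> lift (sigma \o f) (b \o f).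
Proof.
move=> cf [bf bl]; split=> [w|i w iw]; first exact: bf.
exact: (cf w _ (bl i (f w) iw)).
Qed.

Lemma eq_lift (Z : topologicalType) (sigma sigma' : Z -> Y) (b : Z -> J -> G) :
  sigma =1 sigma' -> lift sigma b -> lift sigma' b.
Proof. by move=> /funext <-. Qed.

Lemma cfiber_ratio y x x' i j : cfiber y x -> cfiber y x' -> cdom i y -> cdom j y ->
  (x i * (x' i)^-1 = x j * (x' j)^-1)%g.
Proof.
by move=> fx fx' di dj; rewrite (fx i j)// (fx' i j)// invgM mulgA mulgK.
Qed.

(** Two lifts differ by left multiplication by an element of the group, which does not
    depend on the coordinate and is locally constant. *)
Lemma lift_unique (Z : topologicalType) (sigma : Z -> Y) (b b' : Z -> J -> G) z0 z1 i0 i1 :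
  connected [set: Z] -> continuous sigma -> lift sigma b -> lift sigma b' ->
  cdom i0 (sigma z0) -> cdom i1 (sigma z1) ->
  (b z0 i0 * (b' z0 i0)^-1 = b z1 i1 * (b' z1 i1)^-1)%g.
Proof.
move=> cZ cs [bf bl] [bf' bl'] d0 d1.
have /choice[ix ixP] := fun z => tr_cover c (sigma z).
have E z i : cdom i (sigma z) ->
    (b z i * (b' z i)^-1 = b z (ix z) * (b' z (ix z))^-1)%g.
  by move=> di; apply: (cfiber_ratio (bf z) (bf' z) di (ixP z)).
rewrite E// [RHS]E//.
apply: (@locally_constant _ _ (fun z => (b z (ix z) * (b' z (ix z))^-1)%g)) => // z.
have n1 := bl _ _ (ixP z); have n2 := bl' _ _ (ixP z).
have n3 := cs z _ (cdom_near (ixP z)).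
apply: filterS3 n1 n2 n3 => z' e e' dz'.
by rewrite -(E z' (ix z) dz') e e'.
Qed.

Section Existence.
Variables (K : realType) (E : normedModType K) (sigma : E -> Y) (B : set E).
Hypotheses (csigma : continuous sigma) (cB : compact B)
  (starB : forall z (u : K), B z -> 0 <= u <= 1 -> B (u *: z)).

(** Transition elements are locally constant where they are defined, hence constant along
    a segment. *)
Lemma transition_segment (w w' : E) i j :
  (forall u : K, 0 <= u <= 1 -> cdom i (sigma (w + u *: (w' - w))) /\
     cdom j (sigma (w + u *: (w' - w)))) ->
  transition i j (sigma w) = transition i j (sigma w').
Proof.
move=> H.
pose d (u : unitI K) := transition i j (sigma (w + (\val u : K) *: (w' - w))).
have cl : continuous (fun u : unitI K => sigma (w + (\val u : K) *: (w' - w))).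
  move=> u; apply: continuous_comp; last exact: csigma.
  apply: (@continuousD _ _ _ (cst w)); first exact: cst_continuous.
  apply: (@continuousZr_tmp _ _ _ (fun u : unitI K => (\val u : K))).
  exact: val_unitI_continuous.
have : d zero = d one.
  apply: (@locally_constant _ _ d (@unitI_connected K)) => u.
  have [di dj] := H _ (unitI_bounds u).
  have n : \forall u' \near u,
      c i j (sigma (w + (\val u' : K) *: (w' - w))) (d u) := cl u _ (transition_near di dj).
  move: n; apply: filterS => u1 h; exact: (transitionE h).
by rewrite /d Defs.val0 Defs.val1 scale0r scale1r addr0 addrC subrK.
Qed.

(** The lift at [z] is obtained by transport along the segment from the origin to [z], cut
    into [N.+1] steps that are short enough for each of them to lie in a single member
    of the cover; [idx] picks that member from the starting point of the step. *)
Section Rays.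
Variables (N : nat) (d : K) (idx : E -> J).
Hypotheses (d0 : 0 < d) (Nd : N.+1%:R^-1 < d / 4) (bB : forall z, B z -> `|z| <= 1)
  (idxP : forall z, B z -> forall z', `|z - z'| < d -> cdom (idx z) (sigma z')).

Let pt (z : E) (k : nat) : E := (k%:R / N.+1%:R) *: z.

Fixpoint ray (z : E) (k : nat) : J -> G :=
  if k is l.+1 then
    fun j => (ray z l (idx (pt z l)) * transition (idx (pt z l)) j (sigma (pt z l.+1)))%g
  else fun j => transition (idx 0) j (sigma 0).

Lemma pt_in z k : B z -> (k <= N.+1)%N -> B (pt z k).
Proof.
move=> Bz kN; apply: starB => //; apply/andP; split; first by rewrite divr_ge0.
by rewrite ler_pdivrMr ?ltr0n// mul1r ler_nat.
Qed.

Lemma pt_step z k : B z -> `|pt z k - pt z k.+1| < d / 4.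
Proof.
move=> Bz; rewrite /pt -scalerBl normrZ -mulrBl -[k.+1%:R]natr1 opprD addNKr.
rewrite mulN1r normrN ger0_norm ?invr_ge0//.
by apply: le_lt_trans Nd; rewrite ler_piMr ?invr_ge0//; exact: bB.
Qed.

Lemma pt_dist z z' k : (k <= N.+1)%N -> `|pt z k - pt z' k| <= `|z - z'|.
Proof.
move=> kN; rewrite /pt -scalerBr normrZ ger0_norm ?divr_ge0//.
by rewrite ler_piMl// ler_pdivrMr ?ltr0n// mul1r ler_nat.
Qed.

Lemma ray_fiber z k : B z -> (k <= N.+1)%N -> cfiber (sigma (pt z k)) (ray z k).
Proof.
case: k => [|k] Bz kN i j di dj /=.
  have B0 : B 0 by rewrite -(scale0r z); apply: starB => //; rewrite lexx ler01.
  move: di dj; rewrite /pt mul0r scale0r => di dj.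
  by rewrite transitionM//; apply: idxP; rewrite // subrr normr0.
rewrite -mulgA transitionM//; apply: idxP; first by apply: pt_in => //; exact: ltnW.
by have s1 := pt_step k Bz; have dd := d0; lra.
Qed.

Lemma segment_near (w a b : E) (u : K) : `|w - a| < d -> `|w - b| < d -> 0 <= u <= 1 ->
  `|w - (a + u *: (b - a))| < d.
Proof.
move=> wa wb /andP[u0 u1].
have -> : w - (a + u *: (b - a)) = (1 - u) *: (w - a) + u *: (w - b).
  rewrite scalerBl scale1r -addrA [- _ + _]addrC -scalerBr.
  have -> : w - b - (w - a) = a - b by rewrite opprB addrC addrA subrK.
  by rewrite opprD addrA -scalerN opprB.
apply: le_lt_trans (ler_normD _ _) _; rewrite !normrZ (ger0_norm u0) ger0_norm ?subr_ge0//.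
have : u * `|w - b| <= u * Num.max `|w - a| `|w - b| by rewrite ler_wpM2l// le_max lexx orbT.
have : (1 - u) * `|w - a| <= (1 - u) * Num.max `|w - a| `|w - b|.
  by rewrite ler_wpM2l ?subr_ge0// le_max lexx.
have : Num.max `|w - a| `|w - b| < d by rewrite gt_max wa wb.
move: (Num.max _ _) (_ * _) (_ * `|w - b|) => m p q; nra.
Qed.

(** Transport along two nearby rays is compared rung by rung: the two rungs and the two
    steps between them lie in a ball on which the coordinates [p] and [p'] make sense,
    so that the transition elements do not change along their sides. *)
Lemma ray_near z z' k i : B z -> B z' -> `|z - z'| < d / 4 -> (k <= N.+1)%N ->
  (forall w, `|pt z k - w| < d / 2 -> cdom i (sigma w)) -> ray z' k i = ray z k i.
Proof.
move=> Bz Bz' zz'; elim: k i => [//|k IH] i kN di.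
have kN' := ltnW kN; have Bk := pt_in Bz kN'; have Bk' := pt_in Bz' kN'.
have dd := d0; set p := idx (pt z k); set p' := idx (pt z' k).
have pP w : `|pt z k - w| < d -> cdom p (sigma w) := idxP Bk (z' := w).
have pP' w : `|pt z' k - w| < d -> cdom p' (sigma w) := idxP Bk' (z' := w).
have s1 := pt_step k Bz; have s1' := pt_step k Bz'.
have dk := le_lt_trans (pt_dist z z' kN') zz'.
have dk1 := le_lt_trans (pt_dist z z' kN) zz'.
have zz0 (w : E) : `|w - w| < d by rewrite subrr normr0.
have dkk : `|pt z k - pt z' k.+1| < d / 2.
  by have := ler_distD (pt z' k) (pt z k) (pt z' k.+1); lra.
have hd : d / 2 < d by lra.
have hd4 : d / 4 < d by lra.
have hd4' : d / 4 < d / 2 by lra.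
have IHp : ray z' k p = ray z k p.
  by apply: IH => // w wd; apply: pP; lra.
rewrite /= -/p -/p'.
have -> : ray z' k p' = (ray z' k p * transition p p' (sigma (pt z' k)))%g.
  by apply: (ray_fiber Bz' kN'); [apply: pP|apply: pP' => //]; lra.
have -> : transition p p' (sigma (pt z' k)) = transition p p' (sigma (pt z' k.+1)).
  apply: transition_segment => u u01; split; [apply: pP|apply: pP']; apply: segment_near => //; lra.
rewrite -mulgA transitionM; first last.
- by apply: di; lra.
- by apply: pP'; lra.
- by apply: pP; lra.
rewrite IHp; congr (_ * _)%g.
apply: transition_segment => u u01; split.
  by apply: pP; apply: segment_near => //; lra.
apply: di.
have -> : pt z k.+1 - (pt z' k.+1 + u *: (pt z k.+1 - pt z' k.+1)) =
    (1 - u) *: (pt z k.+1 - pt z' k.+1).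
  by rewrite scalerBl scale1r opprD addrA.
rewrite normrZ ger0_norm; last by lra.
have := normr_ge0 (pt z k.+1 - pt z' k.+1); nra.
Qed.

End Rays.

Lemma lift_exists_star : (forall z, B z -> `|z| <= 1) ->
  exists b : E -> J -> G, forall z, B z ->
    cfiber (sigma z) (b z) /\
    (forall i, cdom i (sigma z) -> \forall z' \near z, B z' -> b z' i = b z i).
Proof.
move=> bB.
have [|d d0 H] := @lebesgue_number K E B J (fun i z => cdom i (sigma z)) cB.
  move=> z _; have [i di] := tr_cover c (sigma z); exists i.
  exact: (csigma (cdom_near di)).
have [i0 _] := tr_cover c (sigma 0).
have /choice[idx idxP] : forall z, exists i, B z ->
    forall z', `|z - z'| < d -> cdom i (sigma z').
  move=> z; have [Bz|nBz] := pselect (B z); last by exists i0.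
  by have [i iP] := H z Bz; exists i.
have [N Nd] : exists N, N.+1%:R^-1 < d / 4.
  have d4 : 0 < d / 4 by rewrite divr_gt0.
  exists (Num.truncn (d / 4)^-1); rewrite invf_plt ?posrE ?ltr0n//.
  exact: truncnS_gt.
exists (fun z => ray N idx z N.+1) => z Bz.
have ptN (w : E) : (N.+1%:R / N.+1%:R : K) *: w = w.
  by rewrite mulfV ?scale1r ?pnatr_eq0.
have fib w : B w -> cfiber (sigma w) (ray N idx w N.+1).
  by move=> Bw; have := @ray_fiber N d idx d0 Nd bB idxP w N.+1 Bw (leqnn _); rewrite ptN.
split=> [|i di]; first exact: fib.
have zz0 : `|z - z| < d by rewrite subrr normr0.
have dp := idxP z Bz z zz0.
have n1 : \forall z' \near z, `|z - z'| < d / 4.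
  by apply/nbhs_normP; exists (d / 4) => //=; rewrite divr_gt0.
have n2 := csigma (transition_near dp di).
apply: filterS2 n1 n2 => z' zz' cz' Bz'.
have dp' : cdom (idx z) (sigma z') by exact: tr_doml cz'.
rewrite [LHS](fib z' Bz' (idx z) i dp' (tr_domr cz')) [RHS](fib z Bz (idx z) i dp di).
rewrite (transitionE cz'); congr (_ * _)%g.
apply: (@ray_near N d idx d0 Nd bB idxP) => // w; rewrite ptN => zw.
by apply: idxP => //; lra.
Qed.

End Existence.

Lemma lift_exists_square (K : realType) (H : unitI K * unitI K -> Y) :
  continuous H -> exists b, lift H b.
Proof.
move=> cH; pose E := (K^o * K^o)%type.
pose sigma (z : E) := H (clamp z.1, clamp z.2).
pose B : set E := (`[0, 1] `*` `[0, 1]).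
pose e (w : unitI K * unitI K) : E := (\val w.1, \val w.2).
have eB w : B (e w) by split; rewrite /= in_itv /= unitI_bounds.
have ce : continuous e.
  apply: pair_continuous; apply: val_comp_continuous.
    exact: fst_continuous.
  exact: snd_continuous.
have [||z u [] |z []|b bP] := @lift_exists_star K E sigma B.
- apply: (compc _ cH); apply: pair_continuous; apply: (compc _ (@clamp_continuous K)).
    exact: fst_continuous.
  exact: snd_continuous.
- by apply: compact_setX; exact: segment_compact.
- rewrite /= !in_itv /= => /andP[a0 a1] /andP[b0 b1] /andP[u0 u1].
  split; rewrite /= in_itv /= /GRing.scale /= mulr_ge0//=.
    by rewrite mulr_ile1.
  by rewrite mulr_ile1.
- rewrite /= !in_itv /= => /andP[a0 a1] /andP[b0 b1].
  by rewrite prod_normE ge_max !ger0_norm// a1 b1.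
have sE w : sigma (e w) = H w by rewrite /sigma /= !clampK; case: w.
exists (b \o e); split=> [w|i w].
  by rewrite -sE; exact: (bP _ (eB w)).1.
rewrite -sE => di; have n := ce w _ ((bP _ (eB w)).2 i di).
have {}n : \forall w' \near w, B (e w') -> b (e w') i = b (e w) i := n.
by move: n; apply: filterS => w' /(_ (eB w')).
Qed.

Lemma lift_exists (K : realType) (p : unitI K -> Y) :
  continuous p -> exists b, lift p b.
Proof.
move=> cp; have [|b bP] := @lift_exists_square K (p \o fst).
  by apply: (compc _ cp); exact: fst_continuous.
exists (b \o (fun s => (s, zero))).
apply: (@eq_lift _ ((p \o fst) \o (fun s => (s, zero)))) => //.
apply: lift_comp => //; apply: pair_continuous; last exact: cst_continuous.
exact: id_continuous.
Qed.

Section Holonomy.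
Variable K : realType.
Notation I := (unitI K).
Notation path x y := {path I from x to y in Y}.

(** At such a point all the coordinates of a point of the covering space agree, so
    that its fiber is the group itself. *)
Definition neutral (y : Y) : Prop := forall i j g, c i j y g -> g = 1%g.

Lemma neutral_fiber y x i j : neutral y -> cfiber y x -> cdom i y -> cdom j y -> x i = x j.
Proof.
by move=> ny fx di dj; rewrite (fx i j)// (ny _ _ _ (transitionP di dj)) mulg1.
Qed.

Definition is_hol (x y : Y) (p : path x y) (g : G) : Prop :=
  exists b, lift p b /\ forall i j, cdom i x -> cdom j y -> g = ((b zero i)^-1 * b one j)%g.

Section Neutral.
Variables x y : Y.
Hypotheses (nx : neutral x) (ny : neutral y).

Lemma is_hol_lift (p : path x y) b i j : lift p b -> cdom i x -> cdom j y ->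
  is_hol p ((b zero i)^-1 * b one j)%g.
Proof.
move=> bP di dj; exists b; split=> // i' j' di' dj'.
have := bP.1 zero; rewrite path_zero => f0; have := bP.1 one; rewrite path_one => f1.
by rewrite (neutral_fiber nx f0 di di') (neutral_fiber ny f1 dj dj').
Qed.

Lemma is_hol_exists (p : path x y) : exists g, is_hol p g.
Proof.
have [b bP] := lift_exists (@path_cts K Y x y p).
have [[i di] [j dj]] := (tr_cover c x, tr_cover c y).
by exists ((b zero i)^-1 * b one j)%g; exact: is_hol_lift.
Qed.

(** A lift over the square of a homotopy restricts to lifts of the two paths, and it is
    constant on the two sides on which the homotopy is constant. *)
Lemma is_hol_homotopic (p q : path x y) g h :
  path_homotopic p q -> is_hol p g -> is_hol q h -> g = h.
Proof.
move=> [H [cH Hp Hq H0 H1]] [b [bP gE]] [b' [bP' hE]].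
have [d dP] := lift_exists_square cH.
have [[i di] [j dj]] := (tr_cover c x, tr_cover c y).
have bot : lift p (d \o (fun s => (s, zero))).
  apply: (@eq_lift _ (H \o (fun s => (s, zero)))) => //.
  apply: lift_comp => //; apply: pair_continuous; last exact: cst_continuous.
  exact: id_continuous.
have top : lift q (d \o (fun s => (s, one))).
  apply: (@eq_lift _ (H \o (fun s => (s, one)))) => //.
  apply: lift_comp => //; apply: pair_continuous; last exact: cst_continuous.
  exact: id_continuous.
have side (s : I) (z : Y) k : (forall t, H (s, t) = z) -> cdom k z ->
    d (s, zero) k = d (s, one) k.
  move=> Hz dk; have cs : continuous (fun t : I => (s, t)).
    by apply: pair_continuous; [exact: cst_continuous|exact: id_continuous].
  have [_ l] := lift_comp cs dP.
  apply: (@locally_constant _ _ (fun t => d (s, t) k) (@unitI_connected K)) => t.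
  by apply: l; rewrite /= Hz.
have E (r : path x y) a a' : lift r a -> lift r a' ->
    ((a zero i)^-1 * a one j = (a' zero i)^-1 * a' one j)%g.
  move=> la la'; have := @lift_unique I r a a' zero one i j (@unitI_connected K)
    (@path_cts K Y x y r) la la'.
  rewrite path_zero path_one => /(_ di dj) e.
  apply: (mulgI (a zero i)); rewrite mulVKg.
  by rewrite mulgA e -mulgA mulVg mulg1.
rewrite (gE i j)// (hE i j)// (E _ _ _ bP bot) (E _ _ _ bP' top) /=.
by rewrite (side zero x i)// (side one y j).
Qed.

Lemma is_hol_fun (p : path x y) g h : is_hol p g -> is_hol p h -> g = h.
Proof. exact: is_hol_homotopic (homotopic_refl p). Qed.

End Neutral.

Lemma is_hol_concat (x y z : Y) (p : path x y) (q : path y z) g h :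
  neutral x -> neutral y -> neutral z ->
  is_hol p g -> is_hol q h -> is_hol (concat p q) (g * h)%g.
Proof.
move=> nx ny nz hp hq; have [b bP] := lift_exists (@path_cts K Y x z (concat p q)).
have [[i di] [k dk]] := (tr_cover c x, tr_cover c z); have [j dj] := tr_cover c y.
have lp : lift p (b \o affI 2^-1 0).
  apply: (@eq_lift _ (concat p q \o affI 2^-1 0)); last first.
    by apply: lift_comp => //; exact: affI_continuous.
  move=> s; have bs := unitI_bounds s.
  have vs : \val (affI 2^-1 0 s) = 2^-1 * \val s + 0 by apply: val_affI; lra.
  rewrite /= concat_left; last by rewrite vs; lra.
  by congr (p _); apply: val_inj; rewrite val_affI vs; lra.
have lq : lift q (b \o affI 2^-1 2^-1).
  apply: (@eq_lift _ (concat p q \o affI 2^-1 2^-1)); last first.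
    by apply: lift_comp => //; exact: affI_continuous.
  move=> s; have bs := unitI_bounds s.
  have vs : \val (affI 2^-1 2^-1 s) = 2^-1 * \val s + 2^-1 by apply: val_affI; lra.
  rewrite /= concat_right; last by rewrite vs; lra.
  by congr (q _); apply: val_inj; rewrite val_affI vs; lra.
have E0 : affI 2^-1 0 zero = zero :> I by apply: affI0; rewrite Defs.val0; lra.
have E1 : affI 2^-1 2^-1 one = one :> I by apply: affI1; rewrite Defs.val1; lra.
have E2 : affI 2^-1 0 one = affI 2^-1 2^-1 zero :> I.
  by congr clamp; rewrite Defs.val0 Defs.val1; lra.
rewrite (is_hol_fun hp (is_hol_lift nx ny lp di dj)).
rewrite (is_hol_fun hq (is_hol_lift ny nz lq dj dk)) /= E0 E1 E2.
by rewrite mulgA mulgK; exact: is_hol_lift.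
Qed.

End Holonomy.
End Lifts.

(** * Points of a geometric realization as subdivisions of the unit interval *)

Section Realization.
Variables (K : realType) (X : simplicial_set).
Notation rX := (realization K X).

Definition pt n (s : X n) (t : stdsimp K n) : rX :=
  gen_pi (@Defs.glue K X) (presimp_pair s t).

Lemma pt_surj (p : rX) : exists n (s : X n) (t : stdsimp K n), p = pt s t.
Proof. by have [[[n s] t] ->] := gen_quotP p; exists n, s, t. Qed.

Lemma pt_glue m n (f : monomap m n) (s : X n) (t : stdsimp K m) :
  pt (sact f s) t = pt s (push f t).
Proof. by apply: gen_pi_eq; exists m, n, f, s, t. Qed.

Lemma pt_continuous n (s : X n) : continuous (@pt n s).
Proof.
move=> t; apply: (@continuous_comp _ _ _ (@presimp_pair K X n s)
  (gen_pi (@Defs.glue K X) : presimp K X -> rX)); last exact: pi_continuous.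
exact: (@existT_continuous {classic {n : nat & X n}}
  (fun s => stdsimp K (tag s)) (existT (fun n => X n) n s)).
Qed.

Lemma open_pt (U : set rX) :
  (forall n (s : X n), open [set t : stdsimp K n | U (pt s t)]) -> open U.
Proof.
move=> H; rewrite /open /= /quotient_open.
apply/(@sigT_openP {classic {n : nat & X n}} (fun s => stdsimp K (tag s))).
by move=> [n s]; exact: H.
Qed.

Section Invariant.
Variable P : forall n, X n -> stdsimp K n -> Prop.
Hypothesis P_glue : forall m n (f : monomap m n) (s : X n) (t : stdsimp K m),
  P (sact f s) t <-> P s (push f t).

(** A property of representatives that is invariant under gluing, as a property of the
    points of the realization. *)
Definition on_pt (p : rX) : Prop := exists n (s : X n) (t : stdsimp K n), p = pt s t /\ P s t.

Lemma on_ptE n (s : X n) (t : stdsimp K n) : on_pt (pt s t) <-> P s t.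
Proof.
split=> [[m [s' [t' [/gen_piP E P']]]]|h]; last by exists n, s, t.
pose Q (x : presimp K X) := P (tagged (tag x)) (tagged x).
suff : Q (presimp_pair s t) <-> Q (presimp_pair s' t') by move=> [_]; exact.
elim: E => // [x y [k [l [f [u [v [-> ->]]]]]]|x y _ ->//|x y z _ -> _ ->//].
exact: P_glue.
Qed.

Lemma open_on_pt : (forall n (s : X n), open [set t : stdsimp K n | P s t]) ->
  open [set p | on_pt p].
Proof.
move=> H; apply: open_pt => n s; rewrite (_ : [set t | _] = [set t | P s t])//.
by apply/seteqP; split=> t /= /on_ptE.
Qed.

End Invariant.
End Realization.

Section Weights.
Variable K : realType.

Lemma coord_cont n (i : 'I_n.+1) : continuous (fun t : stdsimp K n => \val t 0 i : K).
Proof.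
move=> t; apply: (@continuous_comp _ _ _ (\val : stdsimp K n -> 'rV[K]_n.+1) (fun v => v 0 i)).
  exact: initial_continuous.
exact: coord_continuous.
Qed.

Lemma sum_cont (Z : topologicalType) (I : Type) (r : seq I) (P : pred I) (f : I -> Z -> K) :
  (forall i, continuous (f i)) -> continuous (fun z => \sum_(i <- r | P i) f i z).
Proof.
move=> cf; elim: r => [|i r IH].
  by under eq_fun do rewrite big_nil; exact: cst_continuous.
under eq_fun do rewrite big_cons; case: (P i) => // z.
by apply: (@continuousD _ _ _ (f i)); [exact: cf|exact: IH].
Qed.

Lemma simp_ge0 n (t : stdsimp K n) i : 0 <= \val t 0 i.
Proof. exact: (set_mem (valP t)).1. Qed.

Lemma simp_sum n (t : stdsimp K n) : \sum_i \val t 0 i = 1.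
Proof. exact: (set_mem (valP t)).2. Qed.

Definition psum n (t : stdsimp K n) (k : nat) : K :=
  \sum_(i < n.+1 | (i < k)%N) \val t 0 i.

Lemma psum0 n (t : stdsimp K n) : psum t 0 = 0.
Proof. by rewrite /psum big1. Qed.

Lemma psumS n (t : stdsimp K n) (i : 'I_n.+1) : psum t i.+1 = psum t i + \val t 0 i.
Proof.
rewrite /psum (bigD1 i)//= addrC; congr (_ + _); apply: eq_bigl => j.
by rewrite ltnS andbC -val_eqE /= ltn_neqAle.
Qed.

Lemma psum_full n (t : stdsimp K n) : psum t n.+1 = 1.
Proof. by rewrite -(simp_sum t); apply: eq_bigl => i; rewrite ltn_ord. Qed.

Lemma psum_cont n k : continuous (fun t : stdsimp K n => psum t k).
Proof. by apply: sum_cont => i; exact: coord_cont. Qed.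

Definition clip (a b x : K) : K := Num.max a (Num.min b x).

Lemma clip_homo a b x y : x <= y -> clip a b x <= clip a b y.
Proof.
by move=> xy; rewrite /clip ge_max le_max lexx /= le_max le_min !ge_min xy lexx orbT /= orbT.
Qed.

(** The length of the part of the [i]-th of the consecutive intervals of lengths
    [t_0, ..., t_n] that lies between [a] and [b]. *)
Definition clip_weight a b n (t : stdsimp K n) (i : 'I_n.+1) : K :=
  clip a b (psum t i.+1) - clip a b (psum t i).

Lemma clip_weight_ge0 a b n (t : stdsimp K n) i : 0 <= clip_weight a b t i.
Proof. by rewrite subr_ge0 clip_homo// psumS lerDl simp_ge0. Qed.

Lemma clip_weight_gt0 a b n (t : stdsimp K n) i : 0 < clip_weight a b t i -> 0 < \val t 0 i.
Proof.
rewrite lt_neqAle => /andP[h _]; rewrite lt_neqAle simp_ge0 andbT eq_sym.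
by apply: contra h => /eqP t0; rewrite /clip_weight psumS t0 addr0 subrr.
Qed.

Lemma clip_weight_cont a b n i : continuous (fun t : stdsimp K n => clip_weight a b t i).
Proof.
have cl k : continuous (fun t : stdsimp K n => clip a b (psum t k)).
  have c0 (x : K) : continuous (fun _ : stdsimp K n => x) by exact: cst_continuous.
  have cmin : continuous (fun t : stdsimp K n => Num.min b (psum t k)).
    by move=> t; exact: (@continuous_min _ _ _ _ t (c0 b t) (@psum_cont n k t)).
  by move=> t; exact: (@continuous_max _ _ _ _ t (c0 a t) (cmin t)).
by move=> t; apply: (@continuousB _ _ _ (fun t : stdsimp K n => clip a b (psum t i.+1))); exact: cl.
Qed.

Lemma clip_weight_psum a b n (t : stdsimp K n) k : (k <= n.+1)%N ->
  \sum_(i < n.+1 | (i < k)%N) clip_weight a b t i = clip a b (psum t k) - clip a b 0.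
Proof.
elim: k => [|k IH] kn; first by rewrite psum0 subrr big1.
rewrite (bigD1 (Ordinal kn))//= addrC.
rewrite (eq_bigl (fun i : 'I_n.+1 => (i < k)%N)) => [|i]; last first.
  by rewrite ltnS andbC -val_eqE /= ltn_neqAle.
by rewrite IH 1?ltnW// /clip_weight /= addrC addrA subrK.
Qed.

Lemma clip_weight_total a b n (t : stdsimp K n) : 0 <= a -> a < b -> b <= 1 ->
  \sum_i clip_weight a b t i = b - a.
Proof.
move=> a0 ab b1; have := clip_weight_psum a b t (leqnn n.+1).
rewrite (eq_bigl xpredT) => [->|i]; last by rewrite ltn_ord.
by rewrite psum_full /clip (min_l b1) (max_r (ltW ab)) min_r ?max_l//; lra.
Qed.

Lemma mono_initial m n (f : monomap m n) (j : nat) :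
  exists2 k, (k <= m.+1)%N & forall i, (f i < j)%N = (i < k)%N.
Proof.
have ex : exists k, [forall i : 'I_m.+1, (f i < j)%N ==> (i < k)%N].
  by exists m.+1; apply/forallP => i; apply/implyP.
case: (ex_minnP ex) => k /forallP Pk mink.
have km : (k <= m.+1)%N by apply: mink; apply/forallP => i; apply/implyP.
exists k => // i; apply/idP/idP => [fi|ik]; first by have /implyP := Pk i; exact.
rewrite ltnNge; apply/negP => jf; have : (k <= i)%N; last by rewrite leqNgt ik.
apply: mink; apply/forallP => i'; apply/implyP => fi'; rewrite ltnNge; apply/negP => ii'.
by have := mono_homo f ii'; rewrite leqNgt (leq_trans fi' jf).
Qed.

Lemma psum_push m n (f : monomap m n) (t : stdsimp K m) j k :
  (forall i, (f i < j)%N = (i < k)%N) -> psum (push f t) j = psum t k.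
Proof.
move=> E; rewrite /psum (eq_bigr (fun l => \sum_(i | f i == l) \val t 0 i)); last first.
  by move=> l _; rewrite mxE.
rewrite [RHS](partition_big f (fun l : 'I_n.+1 => (l < j)%N)) => [|i]; last by rewrite E.
apply: eq_bigr => l lj; apply: eq_bigl => i.
by case: eqP => [e|]; rewrite ?andbF// -E e lj.
Qed.

(** An order-preserving map merges consecutive pieces of the subdivision, so that their
    clipped lengths add up. *)
Lemma clip_weight_push a b m n (f : monomap m n) (t : stdsimp K m) (j : 'I_n.+1) :
  clip_weight a b (push f t) j = \sum_(i | f i == j) clip_weight a b t i.
Proof.
have [k km kE] := mono_initial f j; have [k' km' kE'] := mono_initial f j.+1.
rewrite /clip_weight -/(clip_weight a b (push f t) j) {1}/clip_weight.
rewrite (psum_push _ kE') (psum_push _ kE).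
have -> : clip a b (psum t k') - clip a b (psum t k) =
    (clip a b (psum t k') - clip a b 0) - (clip a b (psum t k) - clip a b 0).
  by ring.
rewrite -!clip_weight_psum//; apply/eqP; rewrite subr_eq; apply/eqP.
rewrite (bigID (fun i : 'I_m.+1 => (i < k)%N)) /= addrC; congr (_ + _).
  apply: eq_bigl => i; rewrite -kE' -kE ltnS -leqNgt.
  by rewrite -val_eqE /= eqn_leq andbC.
apply: eq_bigl => i; rewrite -kE' -kE ltnS.
by apply/andP/idP => [[]//|h]; rewrite h (ltnW h).
Qed.

End Weights.

(** * The covering space of a nerve given by a functor to a group *)

Section Identities.
Variable C : category.

(** The target of [f] is only known to be equal to its source after the fact, hence an
    equality of dependent pairs. *)
Definition isid (A B : C) (f : hom A B) : Prop :=
  existT (fun B => hom A B) B f = existT (fun B => hom A B) A (idm A).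

Lemma isid_ind (A : C) (P : forall B, hom A B -> Prop) (B : C) (f : hom A B) :
  isid f -> P A (idm A) -> P B f.
Proof.
move=> e PA; pose Q (x : {B : C & hom A B}) := P (projT1 x) (projT2 x).
by rewrite -[P B f]/(Q (existT _ B f)) e.
Qed.

Lemma isid_eq (A : C) (f : hom A A) : isid f -> f = idm A.
Proof.
move=> e; have := projT2_eq e; rewrite /=.
by rewrite (Prop_irrelevance (projT1_eq e) erefl).
Qed.

Lemma isid_comp (A B D : C) (f : hom A B) (g : hom B D) : isid f ->
  isid (comp g f) <-> isid g.
Proof.
move=> fi; move: g; refine (@isid_ind A (fun B f => forall g : hom B D,
  isid (comp g f) <-> isid g) B f fi _) => g.
by rewrite compm1.
Qed.

Lemma isid_compr (A B D : C) (f : hom A B) (g : hom B D) : isid g ->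
  isid (comp g f) <-> isid f.
Proof.
move=> gi; refine (@isid_ind B (fun D g => isid (comp g f) <-> isid f) D g gi _).
by rewrite comp1m.
Qed.

Variables (n : nat) (s : nerve C n).

(** Two vertices of a simplex that a path may join without leaving a point: the edge
    between them is degenerate. *)
Definition same (i j : 'I_n.+1) : Prop :=
  (exists h : (i <= j)%N, isid (edge s h)) \/ (exists h : (j <= i)%N, isid (edge s h)).

Lemma edge_irr (i j : 'I_n.+1) (h h' : (i <= j)%N) : edge s h = edge s h'.
Proof. by rewrite (eq_irrelevance h h'). Qed.

Lemma same_le (i j : 'I_n.+1) (h : (i <= j)%N) : same i j <-> isid (edge s h).
Proof.
split=> [[[h' e]|[h' _]]|e]; last by left; exists h.
  by rewrite (edge_irr h h').
have ij : i = j by apply/val_inj/eqP; rewrite eqn_leq h h'.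
by case: _ / ij h h' => h h'; rewrite edge_id.
Qed.

Lemma same_sym i j : same i j -> same j i.
Proof. by case=> [[h e]|[h e]]; [right|left]; exists h. Qed.

Lemma same_refl i : same i i.
Proof. by left; exists (leqnn i); rewrite edge_id. Qed.

(** If two of the three edges of a triangle are identities, then so is the third. *)
Lemma same_trans i j k : same i j -> same j k -> same i k.
Proof.
case=> [[ij a]|[ji a]] [[jk b]|[kj b]].
- have ik := leq_trans ij jk; apply/(same_le ik); rewrite (edge_comp s ij jk).
  by apply/isid_comp.
- have [ik|ki] := leqP i k.
    apply/(same_le ik); apply/(isid_compr (edge s ik) b).
    by rewrite -(edge_comp s ik kj ij).
  apply: same_sym; apply/(same_le (ltnW ki)); apply/(isid_compr (edge s (ltnW ki)) a).
  by rewrite -(edge_comp s (ltnW ki) ij kj).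
- have [ik|ki] := leqP i k.
    by apply/(same_le ik); apply/(isid_comp _ a); rewrite -(edge_comp s ji ik jk).
  apply: same_sym; apply/(same_le (ltnW ki)); apply/(isid_comp _ b).
  by rewrite -(edge_comp s jk (ltnW ki) ji).
- have ki := leq_trans kj ji; apply: same_sym; apply/(same_le ki).
  by rewrite (edge_comp s kj ji); apply/isid_comp.
Qed.

End Identities.

Lemma same_act (C : category) m n (f : monomap m n) (s : nerve C n) (i j : 'I_m.+1) :
  same (sact f s) i j <-> same s (f i) (f j).
Proof.
wlog ij : i j / (i <= j)%N => [H|].
  have [|ji] := leqP i j; first exact: H.
  by split=> /same_sym h; apply: same_sym; apply/H => //; exact: ltnW.
have [a b] := same_le (nsimplex_act f s : nerve C m) ij.
have [a' b'] := same_le s (mono_homo f ij).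
by split=> h; [exact: b' (a h)|exact: b (a' h)].
Qed.

Section Selection.
Variables (K : realType) (C : category).
Implicit Types J : K * K.

Definition subinterval J : Prop := [/\ 0 <= J.1, J.1 < J.2 & J.2 <= 1].

Definition classw J n (s : nerve C n) (t : stdsimp K n) (i : 'I_n.+1) : K :=
  \sum_(j | `[< same s i j >]) clip_weight J.1 J.2 t j.

(** If the point of coordinates [t] of the simplex [s] is drawn as a subdivision of the
    unit interval into pieces labelled by the vertices, then the vertices equivalent
    to [i] occupy more than half of the interval [J]. *)
Definition sel J n (s : nerve C n) (t : stdsimp K n) (i : 'I_n.+1) : Prop :=
  subinterval J /\ (J.2 - J.1) / 2 < classw J s t i.

Lemma sel_same J n (s : nerve C n) (t : stdsimp K n) i j :
  sel J s t i -> same s i j -> sel J s t j.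
Proof.
move=> [sJ h] ij; split=> //; rewrite /classw (eq_bigl (fun k => `[< same s i k >]))// => k.
by apply/asboolP/asboolP; [exact: same_trans|apply: same_trans; exact: same_sym].
Qed.

(** Disjoint classes cannot both occupy more than half of [J]. *)
Lemma sel_unique J n (s : nerve C n) (t : stdsimp K n) i j :
  sel J s t i -> sel J s t j -> same s i j.
Proof.
move=> [[a0 ab b1] hi] [_ hj]; apply: contrapT => nij.
have := clip_weight_total t a0 ab b1; rewrite (bigID (fun k => `[< same s i k >])) /=.
have : \sum_(k | ~~ `[< same s i k >]) clip_weight J.1 J.2 t k >= classw J s t j.
  rewrite /classw [leRHS](bigID (fun k => `[< same s j k >])) /=.
  rewrite [X in _ <= X + _](eq_bigl (fun k => `[< same s j k >])) => [|k].
    by rewrite lerDl; apply: sumr_ge0 => k _; exact: clip_weight_ge0.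
  case: (asboolP (same s j k)) => jk; rewrite ?andbF// andbT.
  apply/negP => /asboolP ik.
  by apply: nij; apply: same_trans ik (same_sym jk).
rewrite -/(classw J s t i); move: hi hj.
move: (classw _ _ _ i) (classw _ _ _ j) (\sum_(_ | _) _) => x y z; lra.
Qed.

Lemma sel_pos J n (s : nerve C n) (t : stdsimp K n) i :
  sel J s t i -> exists2 j, same s i j & 0 < clip_weight J.1 J.2 t j.
Proof.
move=> [[a0 ab b1] h]; apply: contrapT => H.
suff E : classw J s t i = 0 by move: h; rewrite E; lra.
apply: big1 => j /asboolP ij; apply/eqP; rewrite eq_le clip_weight_ge0 andbT leNgt.
by apply/negP => c0; apply: H; exists j.
Qed.

Lemma classw_act J m n (f : monomap m n) (s : nerve C n) (t : stdsimp K m) i :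
  classw J (sact f s) t i = classw J s (push f t) (f i).
Proof.
rewrite /classw (partition_big f (fun j => `[< same s (f i) j >])) => [|j /asboolP h].
  apply: eq_bigr => j /asboolP ij; rewrite clip_weight_push; apply: eq_bigl => k.
  case: eqP => [e|]; rewrite ?andbF// andbT; apply/asboolP.
  by apply/same_act; rewrite e.
by apply/asboolP/same_act.
Qed.

Lemma sel_act J m n (f : monomap m n) (s : nerve C n) (t : stdsimp K m) i :
  sel J (sact f s) t i <-> sel J s (push f t) (f i).
Proof. by rewrite /sel classw_act. Qed.

Lemma sel_act_inv J m n (f : monomap m n) (s : nerve C n) (t : stdsimp K m) j :
  sel J s (push f t) j -> exists2 i, sel J (sact f s) t i & same s j (f i).
Proof.
move=> h; have [k jk] := sel_pos h; rewrite clip_weight_push => k0.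
have [i /eqP e] : exists i, f i == k.
  apply: contrapT => H; move: k0; rewrite big_pred0 ?ltxx// => i.
  by apply/negP => e; apply: H; exists i.
exists i; last by rewrite e.
by apply/sel_act; rewrite e; exact: sel_same h jk.
Qed.

(** One of the pieces of the subdivision has positive length, and it is a majority of
    itself. *)
Lemma sel_cover n (s : nerve C n) (t : stdsimp K n) : exists J i, sel J s t i.
Proof.
have [i ti] : exists i, 0 < \val t 0 i.
  apply: contrapT => H; have := simp_sum t; rewrite big1 => [/eqP|i _].
    by rewrite eq_sym oner_eq0.
  apply/eqP; rewrite eq_le simp_ge0 andbT leNgt.
  by apply/negP => c0; apply: H; exists i.
have p0 k : 0 <= psum t k by apply: sumr_ge0 => j _; exact: simp_ge0.
have p1 : psum t i.+1 <= 1.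
  rewrite -(simp_sum t) /psum [leRHS](bigID (fun j : 'I_n.+1 => (j < i.+1)%N)) /= lerDl.
  by apply: sumr_ge0 => j _; exact: simp_ge0.
have pp : psum t i < psum t i.+1 by rewrite psumS ltrDl.
exists (psum t i, psum t i.+1), i; split; first by split=> //=; exact: p0.
rewrite /classw (bigD1 i) /=; last by apply/asboolP; exact: same_refl.
apply: (@lt_le_trans _ _ (psum t i.+1 - psum t i)); first by lra.
rewrite {1}/clip_weight /clip minxx (max_r (ltW pp)) (min_r (ltW pp)) maxxx lerDl.
by apply: sumr_ge0 => j _; exact: clip_weight_ge0.
Qed.

Lemma sel_open J n (s : nerve C n) i : open [set t : stdsimp K n | sel J s t i].
Proof.
have [sJ|nJ] := pselect (subinterval J); last first.
  by rewrite (_ : mkset _ = set0); [exact: open0|apply/seteqP; split=> t // -[]].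
rewrite (_ : mkset _ = (fun t => classw J s t i) @^-1` [set x | (J.2 - J.1) / 2 < x]).
  apply: open_comp; last exact: open_gt.
  by move=> t _; apply: sum_cont => j; exact: clip_weight_cont.
by apply/seteqP; split=> t //= [].
Qed.

End Selection.

(** Functors to a group, written so that the composite of a path of morphisms is
    multiplied in the order of the path. *)
Record gfunctor (C : category) (G : groupType) := GFunctor {
  gfun :> forall A B : C, hom A B -> G;
  gfunM : forall (A B D : C) (g : hom B D) (f : hom A B),
    gfun (comp g f) = (gfun f * gfun g)%g
}.
Arguments gfun {C G} _ {A B} f.

Section NerveCocycle.
Variables (K : realType) (C : category) (G : groupType) (lam : gfunctor C G).

Lemma gfun1 (A : C) : gfun lam (idm A) = 1%g.
Proof. by apply: (mulgI (gfun lam (idm A))); rewrite -gfunM comp1m mulg1. Qed.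

(** The value of the edge from [i] to [j], or the inverse of the value of the edge from
    [j] to [i]: passing through the first vertex treats the two orders alike. *)
Definition edge_label n (s : nerve C n) (i j : 'I_n.+1) : G :=
  ((gfun lam (edge s (leq0n i : (ord0 <= i)%N)))^-1 *
   gfun lam (edge s (leq0n j : (ord0 <= j)%N)))%g.

Lemma edge_labelM n (s : nerve C n) i j k :
  (edge_label s i j * edge_label s j k)%g = edge_label s i k.
Proof. by rewrite /edge_label mulgA mulgK. Qed.

Lemma edge_labelV n (s : nerve C n) i j : ((edge_label s i j)^-1)%g = edge_label s j i.
Proof. by rewrite /edge_label invgM invgK. Qed.

Lemma edge_label_le n (s : nerve C n) (i j : 'I_n.+1) (h : (i <= j)%N) :
  edge_label s i j = gfun lam (edge s h).
Proof.
by rewrite /edge_label (edge_comp s (leq0n i : (ord0 <= i)%N) h) gfunM mulKg.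
Qed.

Lemma edge_label_act m n (f : monomap m n) (s : nerve C n) i j :
  edge_label (sact f s) i j = edge_label s (f i) (f j).
Proof.
wlog ij : i j / (i <= j)%N => [H|].
  have [|ji] := leqP i j; first exact: H.
  by rewrite -edge_labelV H ?edge_labelV// ltnW.
by rewrite (edge_label_le _ ij) (edge_label_le s (mono_homo f ij)).
Qed.

Lemma edge_label_same n (s : nerve C n) i j : same s i j -> edge_label s i j = 1%g.
Proof.
have E (k l : 'I_n.+1) (h : (k <= l)%N) : isid (edge s h) -> edge_label s k l = 1%g.
  move=> e; rewrite (edge_label_le s h).
  by apply: (@isid_ind C _ (fun _ f => gfun lam f = 1%g) _ _ e); exact: gfun1.
by case=> -[h e]; [exact: E e|rewrite -edge_labelV (E _ _ h e) invg1].
Qed.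

Definition simplex_tr (J J' : K * K) (g : G) n (s : nerve C n) (t : stdsimp K n) : Prop :=
  exists i j, [/\ sel J s t i, sel J' s t j & g = edge_label s i j].

Lemma simplex_tr_glue J J' g m n (f : monomap m n) (s : nerve C n) (t : stdsimp K m) :
  simplex_tr J J' g (sact f s) t <-> simplex_tr J J' g s (push f t).
Proof.
split=> [[i [j [/sel_act hi /sel_act hj ->]]]|[i [j [hi hj ->]]]].
  by exists (f i), (f j); rewrite edge_label_act.
have [i' hi' ii'] := sel_act_inv hi; have [j' hj' jj'] := sel_act_inv hj.
exists i', j'; split=> //; rewrite edge_label_act.
rewrite -(edge_labelM s (f i') i) -(edge_labelM s i j (f j')).
by rewrite (edge_label_same jj') (edge_label_same (same_sym ii')) mul1g mulg1.
Qed.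

Notation Y := (classifying_space K C).

Definition nerve_tr J J' (y : Y) (g : G) : Prop := on_pt (simplex_tr J J' g) y.

Lemma nerve_trE J J' g n (s : nerve C n) (t : stdsimp K n) :
  nerve_tr J J' (pt s t) g <-> simplex_tr J J' g s t.
Proof. by apply: on_ptE; exact: simplex_tr_glue. Qed.

Lemma nerve_tr_fun J J' y g g' : nerve_tr J J' y g -> nerve_tr J J' y g' -> g = g'.
Proof.
have [n [s [t ->]]] := pt_surj y.
move=> /nerve_trE[i [j [hi hj ->]]] /nerve_trE[i' [j' [hi' hj' ->]]].
rewrite -(edge_labelM s i i' j) -(edge_labelM s i' j' j) (edge_label_same (sel_unique hi hi')).
by rewrite (edge_label_same (sel_unique hj' hj)) mul1g mulg1.
Qed.

Lemma nerve_tr_comp J J' J'' y g h :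
  nerve_tr J J' y g -> nerve_tr J' J'' y h -> nerve_tr J J'' y (g * h)%g.
Proof.
have [n [s [t ->]]] := pt_surj y.
move=> /nerve_trE[i [j [hi hj ->]]] /nerve_trE[j' [k [hj' hk ->]]].
apply/nerve_trE; exists i, k; split=> //.
rewrite -(edge_labelM s i j k) -(edge_labelM s j j' k).
by rewrite (edge_label_same (sel_unique hj hj')) mul1g.
Qed.

Lemma nerve_tr_inv J J' y g : nerve_tr J J' y g -> nerve_tr J' J y (g^-1)%g.
Proof.
have [n [s [t ->]]] := pt_surj y.
move=> /nerve_trE[i [j [hi hj ->]]]; apply/nerve_trE; exists j, i.
by rewrite edge_labelV.
Qed.

Lemma nerve_tr_total J J' y : nerve_tr J J y 1%g -> nerve_tr J' J' y 1%g ->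
  exists g, nerve_tr J J' y g.
Proof.
have [n [s [t ->]]] := pt_surj y.
move=> /nerve_trE H /nerve_trE H'; have [i [i' [hi hi' ei]]] := H.
have [j [j' [hj hj' ej]]] := H'.
by exists (edge_label s i j); apply/nerve_trE; exists i, j.
Qed.

Lemma nerve_tr_open J J' g : open [set y | nerve_tr J J' y g].
Proof.
apply: open_on_pt; first exact: simplex_tr_glue.
move=> n s.
rewrite (_ : mkset _ = \bigcup_(ij in [set ij : 'I_n.+1 * 'I_n.+1 | g = edge_label s ij.1 ij.2])
  ([set t | sel J s t ij.1] `&` [set t | sel J' s t ij.2])).
  by apply: bigcup_open => ij _; apply: openI; exact: sel_open.
apply/seteqP; split=> t [].
  by move=> i [j [hi hj e]]; exists (i, j).
by move=> [i j] /= e [hi hj]; exists i, j.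
Qed.

Lemma nerve_tr_cover y : exists J, nerve_tr J J y 1%g.
Proof.
have [n [s [t ->]]] := pt_surj y; have [J [i h]] := sel_cover s t.
by exists J; apply/nerve_trE; exists i, i; rewrite (edge_label_same (same_refl s i)).
Qed.

(** The open sets of the cover are indexed by the subintervals [J], and the transition
    element from [J] to [J'] is the value of the edge between the vertices that they
    select. Equivalent vertices are joined by identities, which have trivial value; this
    makes the transition elements well defined and locally constant. *)
Definition nerve_cocycle : cocycle Y G (K * K) :=
  Cocycle nerve_tr_fun nerve_tr_comp nerve_tr_inv nerve_tr_total nerve_tr_open
    nerve_tr_cover.

Lemma cdom_pt J n (s : nerve C n) (t : stdsimp K n) :
  cdom nerve_cocycle J (pt s t) <-> exists i, sel J s t i.
Proof.
split=> [/nerve_trE[i [j [h _ _]]]|[i h]]; first by exists i.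
by apply/nerve_trE; exists i, i; rewrite (edge_label_same (same_refl s i)).
Qed.

(** Over a single simplex the covering space is trivial. *)
Lemma simplex_lift n (s : nerve C n) : exists b : stdsimp K n -> K * K -> G,
  lift nerve_cocycle (@pt K _ n s) b /\
  forall t J i, sel J s t i -> b t J = edge_label s ord0 i.
Proof.
have /choice[b0 b0P] : forall tJ : stdsimp K n * (K * K), exists g,
    forall i, sel tJ.2 s tJ.1 i -> g = edge_label s ord0 i.
  move=> [t J] /=; have [[i hi]|H] := pselect (exists i, sel J s t i).
    exists (edge_label s ord0 i) => j hj.
    by rewrite -(edge_labelM s ord0 i j) (edge_label_same (sel_unique hi hj)) mulg1.
  by exists 1%g => i hi; case: H; exists i.
pose b t J := b0 (t, J).
have bP t J i : sel J s t i -> b t J = edge_label s ord0 i by exact: (b0P (t, J) i).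
exists b; split=> //; split=> [t J J' /cdom_pt[i hi] /cdom_pt[j hj]|J t /cdom_pt[i hi]].
  rewrite (bP _ _ _ hi) (bP _ _ _ hj) -(edge_labelM s ord0 i j); congr (_ * _)%g.
  by apply/esym/transitionE/nerve_trE; exists i, j.
have : \forall t' \near t, sel J s t' i.
  by apply: open_nbhs_nbhs; split; [exact: sel_open|].
by apply: filterS => t' hi'; rewrite (bP _ _ _ hi) (bP _ _ _ hi').
Qed.

End NerveCocycle.

(** * Edges of a nerve and the holonomy of a functor *)

Section SimplexPaths.
Variable K : realType.
Notation I := (unitI K).

Section Linear.
Variable n : nat.
Implicit Types t : stdsimp K n.

Lemma lin_proof t t' (u : I) :
  (1 - \val u) *: \val t + \val u *: \val t' \in @std_simplex K n.
Proof.
have bu := unitI_bounds u; rewrite inE; split=> [i|].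
  rewrite !mxE; have := simp_ge0 t i; have := simp_ge0 t' i.
  move: bu => /andP[u0 u1] a b; rewrite addr_ge0// mulr_ge0// subr_ge0//.
under eq_bigr => i _ do rewrite !mxE.
by rewrite big_split /= -!mulr_sumr !simp_sum; ring.
Qed.

Definition lin t t' (u : I) : stdsimp K n :=
  exist (fun v => v \in @std_simplex K n) _ (lin_proof t t' u).

Lemma lin0 t t' : lin t t' zero = t.
Proof.
apply: val_inj.
rewrite [LHS](_ : _ = (1 - \val (zero : I)) *: \val t + \val (zero : I) *: \val t')//.
by rewrite Defs.val0 subr0 scale1r scale0r addr0.
Qed.

Lemma lin1 t t' : lin t t' one = t'.
Proof.
apply: val_inj.
rewrite [LHS](_ : _ = (1 - \val (one : I)) *: \val t + \val (one : I) *: \val t')//.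
by rewrite Defs.val1 subrr scale1r scale0r add0r.
Qed.

Lemma linn t u : lin t t u = t.
Proof. by apply: val_inj; rewrite /= -scalerDl subrK scale1r. Qed.

Lemma into_stdsimp_continuous (Z : topologicalType) (f : Z -> stdsimp K n) :
  continuous (\val \o f : Z -> 'rV[K]_n.+1) -> continuous f.
Proof.
by move=> cf; apply/continuousP => A [B oB <-]; move/continuousP: cf; exact.
Qed.

Lemma val_stdsimp_continuous : continuous (\val : stdsimp K n -> 'rV[K]_n.+1).
Proof. exact: initial_continuous. Qed.

Lemma stdsimp_equiconnected : equiconnected K (stdsimp K n).
Proof.
exists (fun w => lin w.1.1 w.1.2 w.2); split.
- apply: into_stdsimp_continuous.
  pose A := (stdsimp K n * stdsimp K n * I)%type.
  have c2 : continuous (fun w : A => \val w.2 : K).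
    by apply: val_comp_continuous; exact: snd_continuous.
  have c11 : continuous (fun w : A => \val w.1.1 : 'rV[K]_n.+1).
    apply: (@compc _ _ _ (fun w : A => w.1.1) val); last exact: val_stdsimp_continuous.
    by apply: (compc (@fst_continuous _ _)); exact: fst_continuous.
  have c12 : continuous (fun w : A => \val w.1.2 : 'rV[K]_n.+1).
    apply: (@compc _ _ _ (fun w : A => w.1.2) val); last exact: val_stdsimp_continuous.
    by apply: (compc (@fst_continuous _ _)); exact: snd_continuous.
  move=> w; apply: (@continuousD _ _ _ (fun w : A => (1 - \val w.2 : K) *: \val w.1.1)
    (fun w : A => (\val w.2 : K) *: \val w.1.2)).
    apply: (@continuousZ _ _ _ (fun w : A => (1 - \val w.2 : K))); last exact: c11.
    by apply: (@continuousB _ _ _ (cst (1:K))); [exact: cst_continuous|exact: c2].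
  by apply: (@continuousZ _ _ _ (fun w : A => (\val w.2 : K))); [exact: c2|exact: c12].
- exact: lin0.
- exact: lin1.
- exact: linn.
Qed.

Lemma lin_path_continuous t t' : continuous (lin t t').
Proof.
have [cb [ccb cb0 cb1 cbd]] := stdsimp_equiconnected.
apply: into_stdsimp_continuous => u.
apply: (@continuousD _ _ _ (fun u : I => (1 - \val u : K) *: \val t)
  (fun u : I => (\val u : K) *: \val t')); apply: continuousZr_tmp.
  by apply: (@continuousB _ _ _ (cst (1:K))); [exact: cst_continuous|exact: val_unitI_continuous].
exact: val_unitI_continuous.
Qed.

Definition simplex_vertex (i : 'I_n.+1) : stdsimp K n :=
  push (@MonoMap 0 n (fun=> i) (fun _ _ _ => leqnn i))
    (exist (fun v => v \in @std_simplex K 0) _ (vertex_proof K)).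

Lemma simplex_vertexE (i j : 'I_n.+1) : \val (simplex_vertex i) 0 j = (i == j)%:R.
Proof.
rewrite /= mxE; case: (eqVneq i j) => [e|ij].
  by rewrite (eq_bigl xpredT) ?big_ord1 ?mxE// => k; apply/eqP.
by rewrite big_pred0// => k; apply/negbTE.
Qed.

End Linear.

Lemma push_lin m n (f : monomap m n) (t t' : stdsimp K m) u :
  push f (lin t t' u) = lin (push f t) (push f t') u.
Proof.
apply: val_inj; apply/rowP => j; rewrite !mxE.
under eq_bigr => i _ do rewrite !mxE.
by rewrite big_split /= -!mulr_sumr.
Qed.

Lemma push_vertex m n (f : monomap m n) (i : 'I_m.+1) :
  push f (simplex_vertex i) = simplex_vertex (f i).
Proof.
apply: val_inj; apply/rowP => j; rewrite [RHS]simplex_vertexE mxE.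
under eq_bigr => k _ do rewrite simplex_vertexE.
case: eqP => [<-|ij].
  rewrite (bigD1 i) ?eqxx//= big1 ?addr0// => k /andP[_ /negbTE ki].
  by rewrite eq_sym ki.
rewrite big1// => k /eqP fk; case: eqP => // ik; case: ij.
by rewrite ik fk.
Qed.

Section Segments.
Variable X : simplicial_set.
Notation rX := (realization K X).
Notation path x y := {path I from x to y in rX}.

Lemma eq_pmap (f g : I -> rX) cf cg (x y : rX) f0 f1 g0 g1 : f =1 g ->
  @pmap K rX f cf x y f0 f1 = @pmap K rX g cg x y g0 g1.
Proof. by move=> fg; congr pc; apply/path_eqP. Qed.

Section One.
Variables (n : nat) (s : X n).

Definition segf (t t' : stdsimp K n) : I -> rX := pt s \o lin t t'.

Lemma segf_continuous t t' : continuous (segf t t').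
Proof. by apply: compc; [exact: lin_path_continuous|exact: pt_continuous]. Qed.

Lemma segf0 t t' x : pt s t = x -> segf t t' zero = x.
Proof. by rewrite /segf /= lin0. Qed.

Lemma segf1 t t' x : pt s t' = x -> segf t t' one = x.
Proof. by rewrite /segf /= lin1. Qed.

Definition seg t t' x y (tx : pt s t = x) (ty : pt s t' = y) : pclass K x y :=
  pmap (@segf_continuous t t') (segf0 t' tx) (segf1 t ty).

Lemma segM t t' t'' x y z (tx : pt s t = x) (ty : pt s t' = y) (tz : pt s t'' = z) :
  pcmp (seg tx ty) (seg ty tz) = seg tx tz.
Proof.
rewrite pcmpE; apply/pcP.
pose a := mk_path (@lin_path_continuous n t t') (lin0 t t') (lin1 t t').
pose b := mk_path (@lin_path_continuous n t' t'') (lin0 t' t'') (lin1 t' t'').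
apply: (equiconnected_homotopic (stdsimp_equiconnected n) (@pt_continuous K X n s)
  (@path_cts K _ _ _ (concat a b)) (@lin_path_continuous n t t'')).
- by move=> u; rewrite concatE /= concatE; case: ifP.
- by [].
- by rewrite concat_path_zero lin0.
- by rewrite concat_path_one lin1.
Qed.

Lemma seg_const t t' x (tx : pt s t = x) (ty : pt s t' = x) :
  (forall u, pt s (lin t t' u) = x) -> seg tx ty = pone K x.
Proof. by move=> H; congr pc; apply/path_eqP => u; exact: H. Qed.

Lemma seg_inv t t' x y (tx : pt s t = x) (ty : pt s t' = y) :
  pinv (seg tx ty) = seg ty tx.
Proof.
apply: (@pcmpI _ _ _ _ _ (seg tx ty)); rewrite pcmpVl segM; apply/esym/seg_const => u.
by rewrite linn.
Qed.

End One.

Lemma seg_act m n (f : monomap m n) (s : X n) t t' x y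
    (tx : pt (sact f s) t = x) (ty : pt (sact f s) t' = y)
    (tx' : pt s (push f t) = x) (ty' : pt s (push f t') = y) :
  seg tx ty = seg tx' ty'.
Proof. by apply: eq_pmap => u; rewrite /segf /= pt_glue push_lin. Qed.

Lemma seg_act_eq m n (f : monomap m n) (s : X n) t t' r r' x y
    (tx : pt (sact f s) t = x) (ty : pt (sact f s) t' = y)
    (rx : pt s r = x) (ry : pt s r' = y) :
  push f t = r -> push f t' = r' -> seg tx ty = seg rx ry.
Proof. by move=> fr fr'; subst r r'; exact: seg_act. Qed.

End Segments.

Section Edges.
Variable C : category.
Notation Y := (classifying_space K C).
Notation v A := (base_vertex K A : Y).

Lemma pt_vertex n (s : nerve C n) (i : 'I_n.+1) : pt s (simplex_vertex i) = v (vert s i).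
Proof.
rewrite -pt_glue; congr pt; apply: nsimplex_eq => k l h.
by rewrite edge_id.
Qed.

Lemma I2P (i : 'I_2) : i = ord0 \/ i = ord_max.
Proof. by case: i => -[|[|//]] h; [left|right]; exact: val_inj. Qed.

Section E1.
Variables A B : C.

Definition vert1 (k : 'I_2) : C := if nat_of_ord k is 0%N then A else B.

Definition edge1 (f : hom A B) (i j : 'I_2) : (i <= j)%N -> hom (vert1 i) (vert1 j) :=
  match nat_of_ord i as a, nat_of_ord j as b return (a <= b)%N ->
      hom (if a is 0%N then A else B) (if b is 0%N then A else B) with
  | 0%N, 0%N => fun=> idm A
  | 0%N, _.+1 => fun=> f
  | _.+1, 0%N => fun h => False_rect _ (notF h)
  | _.+1, _.+1 => fun=> idm B
  end.

Lemma edge1_id f (i : 'I_2) (h : (i <= i)%N) : edge1 f h = idm (vert1 i).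
Proof. by case: i h => -[|[|//]]. Qed.

Lemma edge1_comp f (i j k : 'I_2) (ij : (i <= j)%N) (jk : (j <= k)%N) (ik : (i <= k)%N) :
  edge1 f ik = comp (edge1 f jk) (edge1 f ij).
Proof.
by case: i j k ij jk ik => -[|[|//]] ? [[|[|//]] ?] [[|[|//]] ?] //= *;
  rewrite ?comp1m ?compm1.
Qed.

Definition simplex1 (f : hom A B) : nerve C 1 :=
  NSimplex (edge1_id f) (edge1_comp f).

Lemma simplex1_eq (s : nerve C 1) : vert s = vert1 ->
  exists2 f : hom A B, s = simplex1 f &
    existT (fun P : C * C => hom P.1 P.2) (vert s ord0, vert s ord_max)
      (edge s (leq0n (@ord_max 1) : (@ord0 1 <= @ord_max 1)%N)) =
    existT (fun P : C * C => hom P.1 P.2) (A, B) f.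
Proof.
case: s => V e e1 e2 /= E; subst V.
exists (e ord0 ord_max (leq0n (@ord_max 1))) => //.
apply: nsimplex_eq => i j; have [->|->] := I2P i; have [->|->] := I2P j => h.
- by rewrite e1 -(edge1_id (e ord0 ord_max (leq0n (@ord_max 1))) h).
- by rewrite (eq_irrelevance h (leq0n (@ord_max 1))).
- by [].
- by rewrite e1 -(edge1_id (e ord0 ord_max (leq0n (@ord_max 1))) h).
Qed.

End E1.

Lemma pair_sigT_inj (A B : C) (f g : hom A B) :
  existT (fun P : C * C => hom P.1 P.2) (A, B) f =
  existT (fun P : C * C => hom P.1 P.2) (A, B) g -> f = g.
Proof.
move=> e; have := projT2_eq e; rewrite /=.
by rewrite (Prop_irrelevance (projT1_eq e) erefl).
Qed.

Lemma simplex1E (s : nerve C 1) :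
  s = simplex1 (edge s (leq0n (@ord_max 1) : (@ord0 1 <= @ord_max 1)%N)).
Proof.
have [|f sE e] := @simplex1_eq (vert s ord0) (vert s ord_max) s.
  by apply/funext => k; have [->|->] := I2P k.
by rewrite {1}sE; congr simplex1; apply/esym/pair_sigT_inj.
Qed.

Definition pedge (A B : C) (f : hom A B) : pclass K (v A) (v B) :=
  seg (pt_vertex (simplex1 f) ord0) (pt_vertex (simplex1 f) ord_max).

Definition mono2 n (i j : 'I_n.+1) (h : (i <= j)%N) : monomap 1 n.
Proof.
exists (fun k => if nat_of_ord k is 0%N then i else j).
by move=> [[|k] ?] [[|l] ?].
Defined.

(** A path along an edge of any simplex only depends on the morphism on that edge. *)
Lemma seg_edge n (s : nerve C n) (i j : 'I_n.+1) (h : (i <= j)%N) :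
  seg (pt_vertex s i) (pt_vertex s j) = pedge (edge s h).
Proof.
pose s1 : nerve C 1 := sact (mono2 h) s.
have -> : pedge (edge s h) =
    seg (pt_vertex s1 ord0 : pt s1 _ = v (vert s i))
      (pt_vertex s1 ord_max : pt s1 _ = v (vert s j)).
  have E := simplex1E s1; rewrite /pedge.
  have -> : edge s h = edge s1 (leq0n (@ord_max 1) : (@ord0 1 <= @ord_max 1)%N).
    by rewrite /s1 /=; congr (edge s); exact: eq_irrelevance.
  by apply: eq_pmap => u; rewrite /segf /= -E.
by apply/esym/seg_act_eq; rewrite push_vertex.
Qed.

Section E2.
Variables (A B D : C) (f : hom A B) (g : hom B D).

Definition vert2 (k : nat) : C :=
  match k with 0%N => A | 1%N => B | _ => D end.

Definition edge2 (i j : nat) : (i <= j)%N -> hom (vert2 i) (vert2 j) :=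
  match i as a, j as b return (a <= b)%N -> hom (vert2 a) (vert2 b) with
  | 0%N, 0%N => fun=> idm A
  | 0%N, 1%N => fun=> f
  | 0%N, _.+2 => fun=> comp g f
  | 1%N, 1%N => fun=> idm B
  | 1%N, _.+2 => fun=> g
  | _.+2, _.+2 => fun=> idm D
  | _.+1, 0%N => fun h => False_rect _ (notF h)
  | _.+2, 1%N => fun h => False_rect _ (notF h)
  end.

Lemma edge2_id (i : 'I_3) (h : (i <= i)%N) : edge2 h = idm (vert2 i).
Proof. by case: i h => -[|[|[|//]]]. Qed.

Lemma edge2_comp (i j k : 'I_3) (ij : (i <= j)%N) (jk : (j <= k)%N) (ik : (i <= k)%N) :
  edge2 ik = comp (edge2 jk) (edge2 ij).
Proof.
by case: i j k ij jk ik => -[|[|[|//]]] ? [[|[|[|//]]] ?] [[|[|[|//]]] ?] //= *;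
  rewrite ?comp1m ?compm1.
Qed.

Definition simplex2 : nerve C 2 :=
  @NSimplex C 2 (fun k => vert2 k) (fun i j h => edge2 h) edge2_id edge2_comp.

Lemma pedgeM : pedge (comp g f) = pcmp (pedge f) (pedge g).
Proof.
have o1 : 'I_3 := Ordinal (isT : (1 < 3)%N).
have := @seg_edge _ simplex2 ord0 (Ordinal (isT : (1 < 3)%N)) isT.
have := @seg_edge _ simplex2 (Ordinal (isT : (1 < 3)%N)) ord_max isT.
have := @seg_edge _ simplex2 ord0 ord_max isT.
by move=> e02 e12 e01; rewrite -[LHS]e02 -[pedge f]e01 -[pedge g]e12 segM.
Qed.

End E2.

Section EdgeHolonomy.
Variables (G : groupType) (lam : gfunctor C G).

Lemma vertex_neutral (A : C) : neutral (nerve_cocycle K lam) (v A).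
Proof.
move=> J J' g /nerve_trE[i [j [_ _ ->]]].
by rewrite (ord1 i) (ord1 j) (edge_label_same lam (same_refl _ _)).
Qed.

Lemma sel_vertex J n (s : nerve C n) (k i : 'I_n.+1) :
  sel J s (simplex_vertex k) i -> same s k i.
Proof.
move=> /sel_pos[j ij /clip_weight_gt0]; rewrite simplex_vertexE.
by case: eqP => [->|_]; [move=> _; exact: same_sym|rewrite ltxx].
Qed.

Lemma pedge_hol (A B : C) (f : hom A B) :
  exists a, pedge f = pc a /\ is_hol (nerve_cocycle K lam) a (gfun lam f).
Proof.
set c := nerve_cocycle K lam.
pose a := mk_path (@segf_continuous _ 1 (simplex1 f) _ _)
  (segf0 (simplex_vertex ord_max) (pt_vertex (simplex1 f) ord0))
  (segf1 (simplex_vertex ord0) (pt_vertex (simplex1 f) ord_max)).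
exists a; split=> //.
have [b [bl bE]] := simplex_lift K lam (simplex1 f).
have [[J dJ] [J' dJ']] := (tr_cover c (v A), tr_cover c (v B)).
have lf : lift c a (b \o lin (simplex_vertex ord0) (simplex_vertex ord_max)).
  apply: (@eq_lift _ _ _ _ _
    (pt (simplex1 f) \o lin (simplex_vertex ord0) (simplex_vertex ord_max))) => //.
  exact: lift_comp (@lin_path_continuous 1 (simplex_vertex ord0) (simplex_vertex ord_max)) bl.
have := is_hol_lift (@vertex_neutral A) (@vertex_neutral B) lf dJ dJ'.
suff -> : ((((b \o lin (simplex_vertex ord0) (simplex_vertex ord_max)) zero J)^-1 *
  (b \o lin (simplex_vertex ord0) (simplex_vertex ord_max)) one J') = gfun lam f)%g by [].
have val_at k A' J0 : pt (simplex1 f) (simplex_vertex k) = v A' -> cdom c J0 (v A') ->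
    b (simplex_vertex k) J0 = edge_label lam (simplex1 f) ord0 k.
  move=> <- /cdom_pt[i hi]; rewrite (bE _ _ _ hi).
  by rewrite -(edge_labelM lam _ ord0 k i) (edge_label_same lam (sel_vertex hi)) mulg1.
rewrite /= lin0 lin1 (val_at ord0 A J (pt_vertex (simplex1 f) ord0) dJ).
rewrite (val_at ord_max B J' (pt_vertex (simplex1 f) ord_max) dJ').
rewrite (edge_label_same lam (same_refl _ _)) invg1 mul1g.
by rewrite (edge_label_le lam (simplex1 f) (leq0n (@ord_max 1) : (@ord0 1 <= @ord_max 1)%N)).
Qed.

(** A functor to a group extends from edges to classes of paths between vertices: it is
    the holonomy of the covering space of [nerve_cocycle]. *)
Theorem functor_holonomy : exists hol : forall A B : C, pclass K (v A) (v B) -> G,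
  (forall A B D (p : pclass K (v A) (v B)) (q : pclass K (v B) (v D)),
     hol _ _ (pcmp p q) = (hol _ _ p * hol _ _ q)%g) /\
  (forall A B (f : hom A B), hol _ _ (pedge f) = gfun lam f).
Proof.
set c := nerve_cocycle K lam.
pose hol A B (p : pclass K (v A) (v B)) : G :=
  xget 1%g [set g | exists a, p = pc a /\ is_hol c a g].
have holE A B (a : {path I from v A to v B in Y}) g : is_hol c a g -> hol A B (pc a) = g.
  move=> ag; have [a' [/pcP aa' ha']] : exists a', pc a = pc a' /\ is_hol c a' (hol A B (pc a)).
    by apply: (@xgetPex _ 1%g [set g | exists a', pc a = pc a' /\ is_hol c a' g]); exists g, a.
  by have := is_hol_homotopic aa' ag ha' => ->.
exists hol; split=> [A B D p q|A B f]; last by have [a [-> /holE]] := pedge_hol f.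
have [[a ->] [b ->]] := (pc_surj p, pc_surj q).
have [[g ag] [h bh]] := (is_hol_exists (@vertex_neutral A) (@vertex_neutral B) a,
  is_hol_exists (@vertex_neutral B) (@vertex_neutral D) b).
rewrite pcmpE (holE _ _ _ _ ag) (holE _ _ _ _ bh); apply: holE.
by apply: is_hol_concat => //; exact: vertex_neutral.
Qed.

End EdgeHolonomy.
End Edges.
End SimplexPaths.

(** * Contraction of open sets of the realization onto vertices *)

Section Collapse.
Variables (K : realType) (C : category).
Notation Y := (classifying_space K C).
Notation v A := (base_vertex K A : Y).

Lemma stdsimp0_eq (t t' : stdsimp K 0) : t = t'.
Proof.
apply: val_inj; apply/rowP => j; rewrite !(ord1 j).
by have := simp_sum t; have := simp_sum t'; rewrite !big_ord1 => -> ->.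
Qed.

Lemma degenerate_simplex n (s : nerve C n) : (forall i j, same s i j) ->
  s = sact (@MonoMap n 0 (fun=> ord0) (fun _ _ _ => isT)) (nerve_vertex (vert s ord0)).
Proof.
move=> H.
have E : vert s = fun=> vert s ord0.
  apply/funext => i.
  by have /(same_le s (leq0n i : (ord0 <= i)%N)) h := H ord0 i; exact: projT1_eq h.
have {}H (i j : 'I_n.+1) (h : (i <= j)%N) : isid (edge s h) by apply/same_le.
move: (vert s ord0) E H => A; case: s => V e e1 e2 /= E; subst V => H.
by apply: nsimplex_eq => i j h; rewrite (isid_eq (H _ _ h)).
Qed.

Lemma pt_degenerate n (s : nerve C n) (t : stdsimp K n) i : (forall i j, same s i j) ->
  pt s t = v (vert s i).
Proof.
move=> H; have -> : vert s i = vert s ord0.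
  by have /(same_le s (leq0n i : (ord0 <= i)%N)) h := H ord0 i; exact: projT1_eq h.
rewrite [in LHS](degenerate_simplex H) pt_glue -(pt_vertex K (nerve_vertex _) ord0).
by congr pt; exact: stdsimp0_eq.
Qed.

Section Retraction.
Variables (n : nat) (P : pred 'I_n.+1) (i0 : 'I_n.+1).
Hypothesis P0 : P i0.

(** The retraction sends [j] to the largest vertex in [P] that is at most [maxn j m],
    where [m] is the smallest vertex in [P]. *)
Lemma retraction : exists2 f : monomap n n, forall j, P (f j) & forall j, P j -> f j = j.
Proof.
pose m := [arg min_(k < i0 | P k) (k : nat)].
have [Pm mmin] : P m /\ forall k, P k -> (m <= k)%N.
  by rewrite /m; case: arg_minnP.
pose Q (j : 'I_n.+1) := [pred b | P b && (b <= maxn j m)%N].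
have Qm j : Q j m by apply/andP; split; [exact: Pm|exact: leq_maxr].
pose f j := [arg max_(k > m | Q j k) (k : nat)].
have fP j : Q j (f j) /\ forall k, Q j k -> (k <= f j)%N.
  by rewrite /f; case: (arg_maxnP (fun k : 'I_n.+1 => k : nat) (Qm j)).
have fm (i j : 'I_n.+1) : (i <= j)%N -> (f i <= f j)%N.
  move=> ij; apply: (fP j).2; have [/andP[Pf fi] _] := fP i.
  by apply/andP; split=> //; apply: (leq_trans fi); rewrite geq_max leq_max ij leq_maxr.
exists (MonoMap fm) => [j|j Pj] /=; first by have [/andP[]] := fP j.
have [/andP[Pf fj] fmax] := fP j; apply/val_inj/eqP; rewrite eqn_leq.
apply/andP; split; first by apply: (leq_trans fj); rewrite geq_max leqnn mmin.
by apply: fmax; apply/andP; split=> //; exact: leq_maxl.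
Qed.

End Retraction.

Lemma push_fixed n (f : monomap n n) (t : stdsimp K n) :
  (forall j, \val t 0 j != 0 -> f j = j) -> push f t = t.
Proof.
move=> H; apply: val_inj; apply/rowP => j; rewrite mxE.
rewrite (eq_bigr (fun i => \val t 0 i * (i == j)%:R)) => [|i /eqP fi]; last first.
  have [->|ti] := eqVneq (\val t 0 i) 0; first by rewrite mul0r.
  by rewrite -(H i ti) fi eqxx mulr1.
rewrite big_mkcond (bigD1 j)//= big1 ?addr0 => [|i ij]; last first.
  by rewrite (negbTE ij) mulr0; case: ifP.
rewrite eqxx mulr1; case: ifPn => // fj.
by apply/esym/eqP; apply: contraNT fj => /H ->.
Qed.

(** The retraction onto the vertices equivalent to [i] fixes [t] and makes [s]
    degenerate. *)
Lemma pt_supported n (s : nerve C n) (t : stdsimp K n) i :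
  (forall j, \val t 0 j != 0 -> same s i j) -> pt s t = v (vert s i).
Proof.
move=> H; have Pi : `[< same s i i >] by apply/asboolP; exact: same_refl.
have [f fP fid] := @retraction n (fun j => `[< same s i j >]) i Pi.
have -> : t = push f t.
  by apply/esym/push_fixed => j tj; apply: fid; apply/asboolP; exact: H.
rewrite -pt_glue (@pt_degenerate _ _ _ i) => [|k l].
  by rewrite /=; congr (v (vert s _)); exact: fid.
apply/same_act; have /asboolP a := fP k; have /asboolP b := fP l.
by apply: same_trans (same_sym a) b.
Qed.

End Collapse.

Section Contraction.
Variables (K : realType) (C : category) (J : K * K).
Notation Y := (classifying_space K C).
Notation I := (unitI K).
Notation v A := (base_vertex K A : Y).

Definition cmass n (s : nerve C n) (t : stdsimp K n) (i : 'I_n.+1) : K :=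
  \sum_(j | `[< same s i j >]) \val t 0 j.

Lemma sel_cmass n (s : nerve C n) (t : stdsimp K n) i : sel J s t i -> 0 < cmass s t i.
Proof.
move=> /sel_pos[j /asboolP ij /clip_weight_gt0 tj]; rewrite /cmass (bigD1 j)//=.
by apply: ltr_wpDr => //; apply: sumr_ge0 => k _; exact: simp_ge0.
Qed.

Definition focus_row n (s : nerve C n) (t : stdsimp K n) (i : 'I_n.+1) : 'rV[K]_n.+1 :=
  \row_j (if `[< same s i j >] then \val t 0 j / cmass s t i else 0).

Lemma focus_proof n (s : nerve C n) (t : stdsimp K n) i : 0 < cmass s t i ->
  focus_row s t i \in @std_simplex K n.
Proof.
move=> c0; rewrite inE; split=> [j|].
  by rewrite mxE; case: ifP => // _; rewrite divr_ge0 ?simp_ge0// ltW.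
under eq_bigr => j _ do rewrite mxE.
by rewrite -big_mkcond /= -mulr_suml divff// gt_eqF.
Qed.

(** The point [t] conditioned on the vertices equivalent to [i]. *)
Definition focus n (s : nerve C n) (t : stdsimp K n) (i : 'I_n.+1) : stdsimp K n :=
  if pselect (0 < cmass s t i) is left h then
    exist (fun v => v \in @std_simplex K n) _ (focus_proof h)
  else t.

Lemma focusE n (s : nerve C n) (t : stdsimp K n) i : 0 < cmass s t i ->
  \val (focus s t i) = focus_row s t i.
Proof. by rewrite /focus; case: pselect. Qed.

Lemma focus_same n (s : nerve C n) (t : stdsimp K n) i j : same s i j ->
  focus s t i = focus s t j.
Proof.
move=> ij; have E k : `[< same s i k >] = `[< same s j k >].
  by apply/asboolP/asboolP; apply: same_trans => //; exact: same_sym.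
have Ec : cmass s t i = cmass s t j by rewrite /cmass; apply: eq_bigl => k; rewrite E.
have [c0|c0] := pselect (0 < cmass s t i).
  apply: val_inj; rewrite !focusE -?Ec//; apply/rowP => k.
  by rewrite !mxE E Ec.
have c0' : ~ 0 < cmass s t j by rewrite -Ec.
by rewrite /focus; case: pselect => // _; case: pselect.
Qed.

Lemma cmass_act m n (f : monomap m n) (s : nerve C n) (t : stdsimp K m) i :
  cmass (sact f s) t i = cmass s (push f t) (f i).
Proof.
rewrite /cmass (partition_big f (fun j => `[< same s (f i) j >])) => [|j /asboolP h].
  apply: eq_bigr => j /asboolP ij; rewrite mxE; apply: eq_bigl => k.
  case: eqP => [e|]; rewrite ?andbF// andbT; apply/asboolP.
  by apply/same_act; rewrite e.
by apply/asboolP/same_act.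
Qed.

Lemma push_focus m n (f : monomap m n) (s : nerve C n) (t : stdsimp K m) i :
  0 < cmass (sact f s) t i ->
  push f (focus (sact f s) t i) = focus s (push f t) (f i).
Proof.
move=> c0; apply: val_inj; rewrite [RHS]focusE -?cmass_act//.
apply/rowP => j; rewrite !mxE -cmass_act focusE//.
under eq_bigr => k _ do rewrite mxE.
case: asboolP => ij; last first.
  rewrite big1// => k /eqP fk; case: asboolP => // /same_act.
  by rewrite fk.
rewrite mulr_suml; apply: eq_bigr => k /eqP fk; rewrite ifT//.
by apply/asboolP/same_act; rewrite fk.
Qed.

Definition contr_at (y' : Y) (u : I) n (s : nerve C n) (t : stdsimp K n) : Prop :=
  exists2 i, sel J s t i & y' = pt s (lin t (focus s t i) u).

Lemma contr_at_glue y' u m n (f : monomap m n) (s : nerve C n) (t : stdsimp K m) :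
  contr_at y' u (sact f s) t <-> contr_at y' u s (push f t).
Proof.
split=> [[i hi ->]|[j hj ->]].
  exists (f i); first exact/sel_act.
  by rewrite pt_glue push_lin push_focus//; exact: sel_cmass.
have [i hi ij] := sel_act_inv hj; exists i => //.
by rewrite pt_glue push_lin push_focus ?(focus_same _ ij)//; exact: sel_cmass.
Qed.

(** The straight motion from a point to its [focus], which does not depend on the
    representative since [focus] commutes with the simplicial operators. *)
Definition contr (y : Y) (u : I) : Y := xget y [set y' | on_pt (contr_at y' u) y].

Lemma contrE n (s : nerve C n) (t : stdsimp K n) i u : sel J s t i ->
  contr (pt s t) u = pt s (lin t (focus s t i) u).
Proof.
move=> hi; have h : on_pt (contr_at (pt s (lin t (focus s t i) u)) u) (pt s t).
  by apply/on_ptE; [exact: contr_at_glue|exists i].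
have /on_ptE : on_pt (contr_at (contr (pt s t) u) u) (pt s t).
  pose A := [set y' : Y | on_pt (contr_at y' u) (pt s t)].
  exact: (@xgetI _ (pt s t : Y) A _ (h : A _)).
move=> /(_ (@contr_at_glue _ _))[j hj ->].
by rewrite (focus_same t (sel_unique hi hj)).
Qed.

Definition selected (y : Y) : Prop := on_pt (fun n s t => exists i, @sel K C J n s t i) y.

Lemma selected_glue m n (f : monomap m n) (s : nerve C n) (t : stdsimp K m) :
  (exists i, sel J (sact f s) t i) <-> exists i, sel J s (push f t) i.
Proof.
by split=> [[i /sel_act hi]|[j /sel_act_inv[i hi _]]]; [exists (f i)|exists i].
Qed.

Lemma selectedE n (s : nerve C n) (t : stdsimp K n) :
  selected (pt s t) <-> exists i, sel J s t i.
Proof. by apply: on_ptE; exact: selected_glue. Qed.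

Lemma selected_open : open [set y | selected y].
Proof.
apply: open_on_pt; first exact: selected_glue.
move=> n s; rewrite (_ : mkset _ = \bigcup_(i in [set: 'I_n.+1]) [set t | sel J s t i]).
  by apply: bigcup_open => i _; exact: sel_open.
by apply/seteqP; split=> t [i]; [exists i|move=> _ ?; exists i].
Qed.

Lemma vert_same n (s : nerve C n) i j : same s i j -> vert s i = vert s j.
Proof. by case=> -[h /projT1_eq]. Qed.

Lemma contr0 y : selected y -> contr y zero = y.
Proof.
have [n [s [t ->]]] := pt_surj y; move=> /selectedE[i hi].
by rewrite (contrE _ hi) lin0.
Qed.

Lemma focus_supported n (s : nerve C n) (t : stdsimp K n) i j : 0 < cmass s t i ->
  \val (focus s t i) 0 j != 0 -> same s i j.
Proof. by move=> c0; rewrite focusE// mxE; case: asboolP; rewrite ?eqxx. Qed.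

Lemma pt_focus n (s : nerve C n) (t : stdsimp K n) i : sel J s t i ->
  pt s (focus s t i) = v (vert s i).
Proof. by move=> hi; apply: pt_supported => j; apply: focus_supported; exact: sel_cmass. Qed.

Lemma stdsimp_continuous_at (Z : topologicalType) n (f : Z -> stdsimp K n) z :
  {for z, continuous (\val \o f : Z -> 'rV[K]_n.+1)} -> {for z, continuous f}.
Proof.
move=> cf A; rewrite nbhsE => -[B [oB Bz] BA].
have [B0 oB0 B0E] := oB; rewrite /= nbhs_filterE.
have : \forall z' \near z, B0 (\val (f z')).
  apply: cf; apply: open_nbhs_nbhs; split=> //.
  by move: Bz; rewrite -B0E.
by apply: filterS => z' Bz'; apply: BA; rewrite -B0E.
Qed.

Lemma vsum_cont (Z : topologicalType) (V : normedModType K) (T : Type) (r : seq T)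
    (P : pred T) (f : T -> Z -> V) :
  (forall i, continuous (f i)) -> continuous (fun z => \sum_(i <- r | P i) f i z).
Proof.
move=> cf; elim: r => [|i r IH].
  by under eq_fun do rewrite big_nil; exact: cst_continuous.
under eq_fun do rewrite big_cons; case: (P i) => // z.
by apply: (@continuousD _ _ _ (f i)); [exact: cf|exact: IH].
Qed.

Lemma focus_continuous_at n (s : nerve C n) (t0 : stdsimp K n) (u0 : I) i :
  sel J s t0 i ->
  {for (t0, u0), continuous (fun w : stdsimp K n * I => lin w.1 (focus s w.1 i) w.2)}.
Proof.
move=> hi; apply: stdsimp_continuous_at.
pose A := (stdsimp K n * I)%type.
pose restr (t : stdsimp K n) : 'rV[K]_n.+1 :=
  \sum_(j | `[< same s i j >]) \val t 0 j *: delta_mx 0 j.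
have restrE t : 0 < cmass s t i -> \val (focus s t i) = (cmass s t i)^-1 *: restr t.
  move=> c0; rewrite focusE//; apply/rowP => j; rewrite !mxE summxE.
  under eq_bigr => k _ do rewrite !mxE eqxx /=.
  case: asboolP => ij.
    rewrite (bigD1 j) /=; last exact/asboolP.
    rewrite big1 ?addr0 => [|k /andP[_ /negbTE kj]]; last first.
      by rewrite eq_sym kj mulr0.
    by rewrite eqxx mulr1 mulrC.
  rewrite big1 ?mulr0// => k /asboolP ik; case: eqP => [jk|]; rewrite ?mulr0//.
  by case: ij; rewrite jk.
pose g (w : A) : 'rV[K]_n.+1 :=
  (1 - \val w.2 : K) *: \val w.1 + (\val w.2 : K) *: ((cmass s w.1 i)^-1 *: restr w.1).
have cm : continuous (fun w : A => cmass s w.1 i).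
  apply: (@compc _ _ _ (@fst (stdsimp K n) I) (fun t : stdsimp K n => cmass s t i)).
    exact: fst_continuous.
  by apply: sum_cont => j; exact: coord_cont.
have cr : continuous (fun w : A => restr w.1).
  apply: (@compc _ _ _ (@fst (stdsimp K n) I) restr); first exact: fst_continuous.
  by apply: vsum_cont => j t; apply: continuousZr_tmp; exact: coord_cont.
have c1 : continuous (fun w : A => \val w.1 : 'rV[K]_n.+1).
  apply: (@compc _ _ _ (@fst (stdsimp K n) I) (\val : stdsimp K n -> 'rV[K]_n.+1)).
    exact: fst_continuous.
  exact: val_stdsimp_continuous.
have c2 : continuous (fun w : A => \val w.2 : K).
  by apply: val_comp_continuous; exact: snd_continuous.
have c0 := sel_cmass hi.
have cg : {for (t0, u0), continuous g}.
  apply: (@continuousD _ _ _ (fun w : A => (1 - \val w.2 : K) *: \val w.1)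
    (fun w : A => (\val w.2 : K) *: ((cmass s w.1 i)^-1 *: restr w.1))).
    apply: (@continuousZ _ _ _ (fun w : A => (1 - \val w.2 : K))); last exact: c1.
    by apply: (@continuousB _ _ _ (cst (1:K))); [exact: cst_continuous|exact: c2].
  apply: (@continuousZ _ _ _ (fun w : A => (\val w.2 : K))); first exact: c2.
  apply: (@continuousZ _ _ _ (fun w : A => (cmass s w.1 i)^-1)); last exact: cr.
  by apply: (@continuousV _ _ (fun w : A => cmass s w.1 i)); [rewrite gt_eqF|exact: cm].
have pos : \forall w \near (t0, u0), 0 < cmass s (w : A).1 i.
  have np : nbhs (cmass s t0 i) [set x | 0 < x].
    by apply: open_nbhs_nbhs; split; [exact: open_gt|].
  exact: (cm (t0, u0) _ np).
have E (w : A) : 0 < cmass s w.1 i -> \val (lin w.1 (focus s w.1 i) w.2) = g w.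
  by move=> /restrE e; rewrite /= e.
move=> B nB; have {}nB : nbhs (g (t0, u0)) B by rewrite -E.
have n1' : \forall w \near (t0, u0), B (g w) := cg B nB.
apply: filterS2 pos n1' => w cw Bw.
have : B (\val (lin w.1 (focus s w.1 i) w.2)) by rewrite E.
exact.
Qed.

(** The contraction is continuous on each simplex times the interval. Since the interval
    is locally compact, this suffices: for a compact neighbourhood [L] of [u], the set
    [V] of the points that stay in [O] at all times in [L] is open, by the tube lemma in
    each simplex. *)
Lemma contr_continuous_at (y : Y) (u : I) : selected y ->
  {for (y, u), continuous (fun w : Y * I => contr w.1 w.2)}.
Proof.
move=> sy B; rewrite nbhsE => -[O [oO Oy] OB].
have loc n (s : nerve C n) (t0 : stdsimp K n) u0 i : sel J s t0 i ->
    O (contr (pt s t0) u0) ->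
    \forall t \near t0 & u' \near u0, O (contr (pt s t) u').
  move=> hi Oc.
  have n1 : \forall w \near (t0, u0), sel J s w.1 i.
    have np : nbhs t0 [set t | sel J s t i].
      by apply: open_nbhs_nbhs; split; [exact: sel_open|].
    exact: (@fst_continuous (stdsimp K n) I (t0, u0) _ np).
  have n2 : \forall w \near (t0, u0), O (pt s (lin w.1 (focus s w.1 i) w.2)).
    have cpl := @continuous_comp _ _ _ (fun w : stdsimp K n * I => lin w.1 (focus s w.1 i) w.2)
      (@pt K _ n s) (t0, u0) (@focus_continuous_at n s t0 u0 i hi) (@pt_continuous K _ n s _).
    apply: cpl; apply: open_nbhs_nbhs; split=> //.
    by move: Oc; rewrite (contrE _ hi).
  apply: filterS2 n1 n2 => w si Ow.
  by rewrite /= (contrE _ si).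
have [n0 [s0 [t0 yE]]] := pt_surj y.
have [i0 hi0] : exists i, sel J s0 t0 i by apply/selectedE; rewrite -yE.
have [L [cL Lu LO]] : exists L : set I, [/\ compact L, (\forall u' \near u, L u') &
    forall u', L u' -> O (contr y u')].
  have := loc _ s0 t0 u i0 hi0; rewrite -yE => /(_ Oy).
  move=> [[P Q] /= [Pt Qu] PQ].
  have [e e0 eQ] : exists2 e : K, 0 < e & forall u' : I, `|\val u - \val u'| < e -> Q u'.
    move: Qu; rewrite nbhsE => -[Q0 [[Q1 oQ1 Q1E] Q0u] Q01].
    have : nbhs (\val u : K) Q1.
      by apply: open_nbhs_nbhs; split=> //; move: Q0u; rewrite -Q1E.
    move=> /nbhs_normP[e /= e0 eQ]; exists e => // u' uu'.
    by apply: Q01; rewrite -Q1E; exact: eQ.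
  exists [set u' : I | `|\val u - \val u'| <= e / 2]; split.
  - apply: (subclosed_compact _ (@unitI_compact K)) => //.
    have cd : continuous (fun u' : I => `|\val u - \val u'| : K).
      move=> u'; apply: (@continuous_comp _ _ _ (fun u' : I => \val u - \val u' : K)).
        apply: (@continuousB _ _ _ (cst (\val u : K))); first exact: cst_continuous.
        exact: val_unitI_continuous.
      exact: norm_continuous.
    rewrite (_ : [set u' : I | _] =
      (fun u' : I => `|\val u - \val u'| : K) @^-1` [set x | x <= e / 2])//.
    by apply: preimage_closed => // u' _; exact: cd.
  - have : nbhs (\val u : K) [set x | `|\val u - x| < e / 2].
      by apply/nbhs_normP; exists (e / 2) => //=; rewrite divr_gt0.
    move=> /(@val_unitI_continuous K u) nu.
    have {}nu : \forall u' \near u, `|\val u - \val u'| < e / 2 := nu.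
    by move: nu; apply: filterS => u' /ltW.
  - move=> u' uu'; have := PQ (t0, u'); rewrite -yE; apply; split=> /=.
      exact: nbhs_singleton.
    by apply: eQ; apply: le_lt_trans uu' _; rewrite ltr_pdivrMr// ltr_pMr// ltr1n.
pose V := [set y' | selected y' /\ forall u', L u' -> O (contr y' u')].
have oV : open V.
  apply: open_pt => n s; rewrite openE => t [/selectedE[i hi] VL].
  have n1 : nbhs t [set t' | sel J s t' i].
    by apply: open_nbhs_nbhs; split; [exact: sel_open|].
  have n2 : \forall t' \near t, L `<=` (fun u' => O (contr (pt s t') u')).
    have cov := (compact_near_coveringP L).1 cL (stdsimp K n) (nbhs t)
      (fun t' u' => O (contr (pt s t') u')) _; apply: cov => u' Lu'.
    have [[P Q] [/= Pt Qu] PQ] := loc n s t u' i hi (VL _ Lu').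
    by exists (Q, P) => // -[a b] [/= Qa Pb]; exact: (PQ (b, a)).
  rewrite /interior; apply: filterS2 n1 n2 => t' si' LO'; split=> //.
  by apply/selectedE; exists i.
exists (V, L); first by split=> //=; apply: open_nbhs_nbhs; split.
by move=> [y' u'] [/= [_ h] Lu']; apply: OB; exact: h.
Qed.

End Contraction.

(** * Every path between vertices is a zigzag of edges *)

Section Square.
Variables (K : realType) (Y : topologicalType).
Notation I := (unitI K).
Notation path x y := {path I from x to y in Y}.

Lemma square_classes (H : I * I -> Y) (x y x' y' : Y)
    (bot : path x y) (right : path y y') (left : path x x') (top : path x' y') :
  continuous H -> (forall u, bot u = H (u, zero)) -> (forall u, top u = H (u, one)) ->
  (forall u, left u = H (zero, u)) -> (forall u, right u = H (one, u)) ->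
  pcmp (pc bot) (pc right) = pcmp (pc left) (pc top).
Proof.
move=> cH hb ht hl hr; rewrite !pcmpE; apply/pcP.
have ci := @id_continuous I; have c0 (z : I) := @cst_continuous I I z.
pose b := mk_path (pair_continuous ci (c0 zero)) erefl erefl.
pose r := mk_path (pair_continuous (c0 one) ci) erefl erefl.
pose l := mk_path (pair_continuous (c0 zero) ci) erefl erefl.
pose t := mk_path (pair_continuous ci (c0 one)) erefl erefl.
apply: (equiconnected_homotopic (prod_equiconnected (unitI_equiconnected K) (unitI_equiconnected K))
  cH (@path_cts K _ _ _ (concat b r)) (@path_cts K _ _ _ (concat l t))).
- by move=> u; rewrite concatE /= concatE; case: ifP => _; rewrite ?hb ?hr.
- by move=> u; rewrite concatE /= concatE; case: ifP => _; rewrite ?hl ?ht.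
- by rewrite !concat_path_zero.
- by rewrite !concat_path_one.
Qed.

Section Subpath.
Variables (x y : Y) (a : path x y).

Definition subf (r r' : K) : I -> Y := a \o affI (r' - r) r.

Lemma subf_continuous r r' : continuous (subf r r').
Proof. by apply: (compc (@affI_continuous K _ _)); exact: path_cts. Qed.

Lemma affI_start (r r' : K) : affI (r' - r) r zero = clamp r.
Proof. by rewrite /affI Defs.val0 mulr0 add0r. Qed.

Lemma affI_end (r r' : K) : affI (r' - r) r one = clamp r'.
Proof. by rewrite /affI Defs.val1 mulr1 subrK. Qed.

Lemma subf0 r r' z : a (clamp r) = z -> subf r r' zero = z.
Proof. by rewrite /subf /= affI_start. Qed.

Lemma subf1 r r' z : a (clamp r') = z -> subf r r' one = z.
Proof. by rewrite /subf /= affI_end. Qed.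

Definition subpath r r' z z' (rz : a (clamp r) = z) (rz' : a (clamp r') = z') :
  pclass K z z' := pmap (@subf_continuous r r') (subf0 r' rz) (subf1 r rz').

Lemma subpathM r r' r'' z z' z'' (e : a (clamp r) = z) (e' : a (clamp r') = z')
    (e'' : a (clamp r'') = z'') :
  pcmp (subpath e e') (subpath e' e'') = subpath e e''.
Proof.
rewrite pcmpE; apply/pcP.
pose p := mk_path (@affI_continuous K (r' - r) r) (affI_start r r') (affI_end r r').
pose q := mk_path (@affI_continuous K (r'' - r') r') (affI_start r' r'') (affI_end r' r'').
apply: (equiconnected_homotopic (unitI_equiconnected K) (@path_cts K Y x y a)
  (@path_cts K _ _ _ (concat p q)) (@affI_continuous K (r'' - r) r)).
- by move=> u; rewrite concatE /= concatE; case: ifP.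
- by [].
- by rewrite concat_path_zero affI_start.
- by rewrite concat_path_one affI_end.
Qed.

End Subpath.
End Square.

Section Zigzags.
Variables (K : realType) (C : category) (A0 : C).
Notation Y := (classifying_space K C).
Notation I := (unitI K).
Notation v A := (base_vertex K A : Y).
Notation path x y := {path I from x to y in Y}.

Inductive zigzag : forall A : C, pclass K (v A0) (v A) -> Prop :=
| zigzag1 : zigzag (pone K (v A0))
| zigzag_fwd A B (w : pclass K (v A0) (v A)) (f : hom A B) :
    zigzag w -> zigzag (pcmp w (pedge K f))
| zigzag_bwd A B (w : pclass K (v A0) (v A)) (f : hom B A) :
    zigzag w -> zigzag (pcmp w (pinv (pedge K f))).

(** The counterpart of [zigzag] for a class that ends at an arbitrary point. *)
Definition ends_in (y : Y) (w : pclass K (v A0) y) n (s : nerve C n) (t : stdsimp K n)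
    (i : 'I_n.+1) : Prop :=
  exists (e : pt s t = y) (w' : pclass K (v A0) (v (vert s i))),
    zigzag w' /\ w = pcmp w' (seg (pt_vertex K s i) e).

Section Representative.
Variables (y : Y) (w : pclass K (v A0) y).

(** The vertex may be changed at the cost of one more edge of the simplex. *)
Lemma ends_in_vertex n (s : nerve C n) t i j : ends_in w s t i -> ends_in w s t j.
Proof.
move=> [e [w' [zw' ->]]]; exists e.
exists (pcmp w' (seg (pt_vertex K s i) (pt_vertex K s j))); split; last first.
  by rewrite -pcmpA segM.
have [ij|ji] := leqP i j; first by rewrite (seg_edge K s ij); exact: zigzag_fwd.
by rewrite -seg_inv (seg_edge K s (ltnW ji)); exact: zigzag_bwd.
Qed.

Lemma ends_in_glue m n (f : monomap m n) (s : nerve C n) (t : stdsimp K m) :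
  (forall i, ends_in w (sact f s) t i) <-> (forall i, ends_in w s (push f t) i).
Proof.
split=> [/(_ ord0)|/(_ (f ord0))] [e [w' [zw' wE]]] i.
  apply: (@ends_in_vertex _ _ _ (f ord0)).
  have e' : pt s (push f t) = y by rewrite -pt_glue.
  exists e', w'; split=> //; rewrite wE; congr pcmp; apply: seg_act_eq => //.
  exact: push_vertex.
apply: (@ends_in_vertex _ _ _ ord0).
have e' : pt (sact f s) t = y by rewrite pt_glue.
exists e', w'; split=> //; rewrite wE; congr pcmp; apply/esym/seg_act_eq => //.
exact: push_vertex.
Qed.

Lemma ends_in_rep n (s : nerve C n) t i n' (s' : nerve C n') t' i' :
  pt s t = y -> pt s' t' = y -> ends_in w s t i -> ends_in w s' t' i'.
Proof.
move=> e e' h; pose P n (s : nerve C n) (t : stdsimp K n) := forall i, ends_in w s t i.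
have : on_pt P (pt s t) by apply/on_ptE; [exact: ends_in_glue|move=> j; exact: ends_in_vertex h].
have ee' : pt s t = pt s' t' by rewrite e.
by rewrite ee' => /on_ptE; apply; exact: ends_in_glue.
Qed.

End Representative.

Definition edge_like (y : Y) (w : pclass K (v A0) y) : Prop :=
  exists n (s : nerve C n) (t : stdsimp K n) i, pt s t = y /\ ends_in w s t i.

Lemma edge_likeP (y : Y) (w : pclass K (v A0) y) n (s : nerve C n) (t : stdsimp K n) i :
  edge_like w -> pt s t = y -> ends_in w s t i.
Proof. by move=> [n' [s' [t' [i' [e' h]]]]] e; exact: ends_in_rep e' e h. Qed.

Lemma edge_like_vertex (A : C) (w : pclass K (v A0) (v A)) : edge_like w -> zigzag w.
Proof.
move=> h; have [e [w' [zw' ->]]] :=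
  edge_likeP ord0 h (pt_vertex K (nerve_vertex A) ord0 : pt _ _ = v A).
rewrite seg_const ?pcmp1r// => u.
by rewrite (stdsimp0_eq (lin _ _ u) (simplex_vertex K ord0)) pt_vertex.
Qed.

Lemma edge_like1 : edge_like (pone K (v A0)).
Proof.
exists 0%N, (nerve_vertex A0), (simplex_vertex K ord0), ord0.
have e := pt_vertex K (nerve_vertex A0) ord0; split; first exact: e.
exists e, (pone K (v A0)); split; first exact: zigzag1.
rewrite seg_const ?pcmp1// => u.
by rewrite (stdsimp0_eq (lin _ _ u) (simplex_vertex K ord0)) pt_vertex.
Qed.

Lemma seg_focus J n (s : nerve C n) (t : stdsimp K n) i z
    (q : pt s (simplex_vertex K i) = z) (e : pt s (focus s t i) = z) :
  sel J s t i -> seg q e = pone K z.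
Proof.
move=> hi; apply: seg_const => u; rewrite -q pt_vertex.
apply: pt_supported => k; apply: contra_neqP => ik.
have -> : \val (lin (simplex_vertex K i) (focus s t i) u) 0 k =
    (1 - \val u) * \val (simplex_vertex K i) 0 k + \val u * \val (focus s t i) 0 k.
  by rewrite /= !mxE.
rewrite simplex_vertexE focusE; last exact: sel_cmass hi.
rewrite mxE; case: asboolP => // _; case: eqP => [E|_]; last by rewrite !mulr0 addr0.
by case: ik; rewrite E; exact: same_refl.
Qed.

Section Piece.
Variables (J : K * K) (x y : Y) (a : path x y).
Hypothesis aJ : forall u, selected J (a u).

(** The vertex onto which a point contracts is locally constant, hence constant along a
    path. *)
Lemma selected_vertex : exists A : C, forall u n (s : nerve C n) (t : stdsimp K n) i,
  pt s t = a u -> sel J s t i -> vert s i = A.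
Proof.
pose P (A : C) n (s : nerve C n) (t : stdsimp K n) := exists2 i, sel J s t i & vert s i = A.
have Pg A m n (f : monomap m n) (s : nerve C n) (t : stdsimp K m) :
    P A m (sact f s) t <-> P A n s (push f t).
  split=> [[i /sel_act hi e]|[j /sel_act_inv[i hi ij] e]]; first by exists (f i).
  by exists i => //=; rewrite -(vert_same ij).
have Pu A A' y' : on_pt (P A) y' -> on_pt (P A') y' -> A = A'.
  have [n [s [t ->]]] := pt_surj y'.
  move=> /(on_ptE (Pg A))[i hi <-] /(on_ptE (Pg A'))[j hj <-].
  exact: vert_same (sel_unique hi hj).
have oP A : open [set y' | on_pt (P A) y'].
  apply: open_on_pt; first exact: Pg.
  move=> n s; rewrite (_ : mkset _ = \bigcup_(i in [set i | vert s i = A]) [set t | sel J s t i]).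
    by apply: bigcup_open => i _; exact: sel_open.
  by apply/seteqP; split=> t [i]; [move=> hi e; exists i|move=> e hi; exists i].
have /choice[d dP] : forall u : I, exists A, on_pt (P A) (a u).
  move=> u; have := aJ u; have [n [s [t ->]]] := pt_surj (a u).
  by move=> /selectedE[i hi]; exists (vert s i); apply/(on_ptE (Pg _)); exists i.
have dc u : d u = d zero.
  apply: (@locally_constant _ _ d (@unitI_connected K)) => u'.
  have np : nbhs (a u') [set y' | on_pt (P (d u')) y'].
    by apply: open_nbhs_nbhs; split; [exact: oP|exact: dP].
  have n1 : \forall z \near u', on_pt (P (d u')) (a z) := @path_cts K Y x y a u' _ np.
  by apply: filterS n1 => z hz; apply: Pu (dP z) hz.
exists (d zero) => u n s t i e hi; rewrite -(dc u).
by apply: (Pu _ _ (pt s t)); [apply/(on_ptE (Pg _)); exists i|rewrite e].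
Qed.

(** The contraction of the path sweeps a square whose last side is constant. Hence the
    path goes straight from its start to a vertex and straight from there to its end. *)
Lemma edge_like_piece (w : pclass K (v A0) x) : edge_like w -> edge_like (pcmp w (pc a)).
Proof.
move=> hw; have [A AP] := selected_vertex.
pose H (z : I * I) : Y := contr J (a z.1) z.2.
have cH : continuous H.
  move=> z; have ca : continuous (fun z : I * I => (a z.1, z.2)).
    by apply: mapl_continuous; exact: path_cts.
  apply: (@continuous_comp _ _ _ (fun z : I * I => (a z.1, z.2))
    (fun w : Y * I => contr J w.1 w.2)); first exact: ca.
  exact: contr_continuous_at.
have ends u z : a u = z -> exists n (s : nerve C n) (t : stdsimp K n) i
    (e : pt s t = z) (e' : pt s (focus s t i) = v A),
    [/\ sel J s t i, vert s i = A & forall b, H (u, b) = segf s t (focus s t i) b].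
  move=> uz; have := aJ u; have [n [s [t e]]] := pt_surj (a u).
  rewrite e => /selectedE[i hi]; exists n, s, t, i.
  have Ai : vert s i = A by apply: (AP u _ s t).
  have e1 : pt s t = z by rewrite -e.
  have e2 : pt s (focus s t i) = v A by rewrite (pt_focus hi) Ai.
  by exists e1, e2; split=> // b; rewrite /H /= e (contrE _ hi).
have a0 : a zero = x by rewrite path_zero.
have a1 : a one = y by rewrite path_one.
have [n [s [t [i [e [e' [hi Ai He]]]]]]] := ends zero x a0.
have [m [s' [t' [j [f [f' [hj Aj Hf]]]]]]] := ends one y a1.
have sq := square_classes (bot := a)
  (right := mk_path (@segf_continuous K _ _ s' t' (focus s' t' j)) (segf0 _ f) (segf1 _ f'))
  (left := mk_path (@segf_continuous K _ _ s t (focus s t i)) (segf0 _ e) (segf1 _ e'))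
  (top := const_path K (v A)) cH.
have {sq} : pcmp (pc a) (seg f f') = pcmp (seg e e') (pone K (v A)).
  apply: sq => //.
  - by move=> u; rewrite /H /= contr0//; exact: aJ.
  - move=> u; rewrite /H /=; have [n1 [s1 [t1 [k [g [g' [hk Ak Hk]]]]]]] := ends u (a u) erefl.
    by have := Hk one; rewrite /H /= => ->; rewrite (segf1 _ g').
rewrite pcmp1r => /(congr1 (fun c => pcmp c (pinv (seg f f')))); rewrite pcmpK => ->.
have [e0 [w' [zw' ->]]] := edge_likeP i hw e.
rewrite (Prop_irrelevance e0 e) pcmpA -(pcmpA w') segM seg_inv.
have ei : pt s (simplex_vertex K i) = v A by rewrite pt_vertex Ai.
have fj : pt s' (simplex_vertex K j) = v A by rewrite pt_vertex Aj.
exists m, s', t', j; split=> //; exists f.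
move: w' zw' (pt_vertex K s i) (pt_vertex K s' j); rewrite Ai Aj => w' zw' qi qj.
exists w'; split=> //.
by rewrite (seg_focus qi e' hi) pcmp1r -(segM qj f') (seg_focus qj f' hj) pcmp1.
Qed.

End Piece.

(** By compactness the path is cut into finitely many pieces, each of which stays in one of
    the open sets that contract onto vertices. *)
Theorem all_zigzag (A : C) (w : pclass K (v A0) (v A)) : zigzag w.
Proof.
apply: edge_like_vertex; have [a ->] := pc_surj w.
have [d d0 H] : exists2 d : K, 0 < d & forall z : K, `[0, 1]%classic z ->
    exists J, forall z', `|z - z'| < d -> selected J (a (clamp z')).
  apply: (@lebesgue_number K K^o `[0, 1] (K * K) (fun J z => selected J (a (clamp z)))).
    exact: segment_compact.
  move=> z _; have [n [s [t e]]] := pt_surj (a (clamp z)).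
  have [J [i hi]] := sel_cover s t; exists J.
  have np : nbhs (a (clamp z)) [set y | selected J y].
    apply: open_nbhs_nbhs; split; first exact: selected_open.
    by rewrite /= e; apply/selectedE; exists i.
  have ca : continuous (a \o @clamp K).
    by apply: (compc (@clamp_continuous K)); exact: path_cts.
  exact: (ca z _ np).
have [N Nd] : exists N, N.+1%:R^-1 < d.
  exists (Num.truncn d^-1); rewrite invf_plt ?posrE ?ltr0n//.
  exact: truncnS_gt.
pose r k : K := k%:R / N.+1%:R.
have a0 : a (clamp 0) = v A0 by rewrite -[RHS](path_zero (s := a)).
have a1 : a (clamp 1) = v A by rewrite -[RHS](path_one (s := a)).
have step k : (k <= N.+1)%N -> forall z (ez : a (clamp (r k)) = z), edge_like (subpath a0 ez).
  elim: k => [_|k IH kN] z ez.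
    have r0 : r 0%N = 0 by rewrite /r mul0r.
    have E : z = v A0 by rewrite -ez r0 a0.
    move: ez; rewrite E => ez; have -> : subpath a0 ez = pone K (v A0); last exact: edge_like1.
    congr pc; apply/path_eqP => u.
    by rewrite -[LHS]/(a (clamp ((r 0%N - 0) * \val u + 0))) r0 subr0 mul0r addr0 a0.
  rewrite -(subpathM a0 (erefl (a (clamp (r k)))) ez).
  have [|J HJ] := H (r k).
    rewrite /= in_itv /= divr_ge0//= ler_pdivrMr ?ltr0n// mul1r ler_nat.
    exact: ltnW.
  apply: (@edge_like_piece J) => [u|]; last by apply: IH; exact: ltnW.
  apply: HJ; rewrite opprD addrCA subrr addr0 normrN.
  have bu := unitI_bounds u.
  have -> : r k.+1 - r k = N.+1%:R^-1 by rewrite /r -[k.+1%:R]natr1 mulrDl mul1r addrAC subrr add0r.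
  rewrite normrM [`|N.+1%:R^-1|]ger0_norm ?invr_ge0//.
  apply: le_lt_trans Nd; rewrite ler_piMr ?invr_ge0// ger0_norm//; by case/andP: bu.
have r1 : r N.+1 = 1 by rewrite /r mulfV ?pnatr_eq0.
have e : a (clamp (r N.+1)) = v A by rewrite r1.
have := step N.+1 (leqnn _) _ e; congr edge_like; congr pc; apply/path_eqP => u.
by rewrite -[LHS]/(a (clamp ((r N.+1 - 0) * \val u + 0))) r1 subr0 mul1r addr0 clampK.
Qed.
End Zigzags.

(** * The fundamental group of the group completion *)

Section GroupCompletion.
Variables (K : realType) (S : sym_mon_groupoid).
Notation C := (SinvS S).
Notation v P := (base_vertex K (P : C) : classifying_space K C).
Notation e f := (pedge K (f : hom (_ : C) (_ : C))).
Implicit Types A B D X Y s t : S.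

Definition sis_mor (P Q : S * S) (s : S) (f : hom (tens s P.1) Q.1) (g : hom (tens s P.2) Q.2) :
  hom (P : C) (Q : C) := sis_class (mk_triple f g).

Lemma sis_morP (P Q : S * S) (x : hom (P : C) (Q : C)) : exists s f g, x = @sis_mor P Q s f g.
Proof. by elim/sis_ind: x => -[s [f g]]; exists s, f, g. Qed.

Lemma sis_mor_eq (P Q : S * S) s t (u : hom s t) (f : hom (tens s P.1) Q.1)
    (g : hom (tens s P.2) Q.2) (f' : hom (tens t P.1) Q.1) (g' : hom (tens t P.2) Q.2) :
  f = comp f' (tensm u (idm _)) -> g = comp g' (tensm u (idm _)) ->
  sis_mor f g = sis_mor f' g'.
Proof. by move=> hf hg; apply/sis_classP; exists u. Qed.

Lemma sis_morM (P Q T : S * S) s t (f : hom (tens s P.1) Q.1) (g : hom (tens s P.2) Q.2)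
    (h : hom (tens t Q.1) T.1) (k : hom (tens t Q.2) T.2) :
  comp (sis_mor h k) (sis_mor f g) =
  @sis_mor P T (tens t s) (comp h (comp (tensm (idm t) f) (tassoc t s P.1)))
    (comp k (comp (tensm (idm t) g) (tassoc t s P.2))).
Proof. exact: sis_compE. Qed.

Definition isom A B X Y (a : hom A X) (b : hom B Y) : hom ((A, B) : C) ((X, Y) : C) :=
  @sis_mor (A, B) (X, Y) tunit (comp a (tunitl A)) (comp b (tunitl B)).

(** The unit summand of the composite triple is absorbed by [tunitl s]. *)
Lemma isom_sis_mor (P : S * S) A B X Y s (f : hom (tens s P.1) A) (g : hom (tens s P.2) B)
    (a : hom A X) (b : hom B Y) :
  comp (isom a b) (@sis_mor P (A, B) s f g) = @sis_mor P (X, Y) s (comp a f) (comp b g).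
Proof.
rewrite sis_morM; apply: (sis_mor_eq (u := tunitl s)); rewrite /=;
  by rewrite -!compA [comp (tunitl _) _]compA tunitl_nat -!compA tunitlA.
Qed.

Lemma sis_mor_isom A B X Y (Q : S * S) s (h : hom (tens s X) Q.1) (k : hom (tens s Y) Q.2)
    (a : hom A X) (b : hom B Y) :
  comp (@sis_mor (X, Y) Q s h k) (isom a b) =
  @sis_mor (A, B) Q s (comp h (tensm (idm s) a)) (comp k (tensm (idm s) b)).
Proof.
have E (A' X' : S) (a' : hom A' X') :
    comp (tensm (idm s) (comp a' (tunitl A'))) (tassoc s tunit A') =
    comp (tensm (idm s) a') (tensm (tunitr s) (idm A')).
  by rewrite -ttriangle compA -tensmM comp1m.
by rewrite sis_morM; apply: (sis_mor_eq (u := tunitr s)); rewrite /= E compA.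
Qed.

Lemma isomM A B X Y X' Y' (a' : hom X X') (b' : hom Y Y') (a : hom A X) (b : hom B Y) :
  comp (isom a' b') (isom a b) = isom (comp a' a) (comp b' b).
Proof. by rewrite isom_sis_mor /isom !compA. Qed.

(** The two morphisms add objects [s] and [t]; adding the missing one on either side
    makes both targets isomorphic to the sum of [P] with [s] and [t], up to the symmetry
    of [s] and [t]. *)
Lemma span_completion (P Q Q' : C) (y : hom P Q) (y' : hom P Q') :
  exists (T : C) (z : hom Q T) (z' : hom Q' T), comp z y = comp z' y'.
Proof.
have [s [f [g ->]]] := sis_morP y; have [t [f' [g' ->]]] := sis_morP y'.
pose w A : hom (tens s (tens t A)) (tens t (tens s A)) :=
  comp (tassoc t s A) (comp (tensm (tbraid s t) (idm A)) (invm (tassoc s t A))).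
exists (tens t (tens s P.1), tens t (tens s P.2)).
exists (@sis_mor Q (tens t (tens s P.1), tens t (tens s P.2)) t
  (tensm (idm t) (invm f)) (tensm (idm t) (invm g))).
exists (@sis_mor Q' (tens t (tens s P.1), tens t (tens s P.2)) s
  (comp (w P.1) (tensm (idm s) (invm f'))) (comp (w P.2) (tensm (idm s) (invm g')))).
have E (A B r1 r2 : S) (h : hom (tens r1 A) B) (r : hom (tens r2 (tens r1 A)) (tens t (tens s A))) :
    comp (comp r (tensm (idm r2) (invm h))) (comp (tensm (idm r2) h) (tassoc r2 r1 A)) =
    comp r (tassoc r2 r1 A).
  by rewrite -compA [X in comp r X]compA -tensmM comp1m invm_l tensm1 comp1m.
have E' A B (h : hom (tens s A) B) :
    comp (tensm (idm t) (invm h)) (comp (tensm (idm t) h) (tassoc t s A)) = tassoc t s A.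
  by rewrite compA -tensmM comp1m invm_l tensm1 comp1m.
have Ew A : comp (w A) (tassoc s t A) = comp (tassoc t s A) (tensm (tbraid s t) (idm A)).
  by rewrite /w -!compA invm_l compm1.
by rewrite !sis_morM; apply/esym/(sis_mor_eq (u := tbraid s t)); rewrite /= E E' Ew.
Qed.

Definition base : C := (tunit, tunit).
Notation pi := (pclass K (v base) (v base)).

(** Calculus of fractions: a zigzag from the base object is a fraction. *)
Lemma zigzag_fraction (P : C) (w : pclass K (v base) (v P)) :
  exists (R : C) (x : hom base R) (y : hom P R), w = pcmp (e x) (pinv (e y)).
Proof.
elim: (all_zigzag w) => {P w} [|P Q w f _ [R [x [y ->]]]|P Q w f _ [R [x [y ->]]]].
- by exists base, (idm base), (idm base); rewrite pcmpV.
- have [T [z [z' E]]] := span_completion y f.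
  exists T, (comp z x), z'; rewrite pedgeM -!pcmpA; apply: congr1.
  apply: (@pcmpI _ _ _ _ _ (e z')); rewrite -!pcmpA -pedgeM pcmpVl pcmp1r -E pedgeM.
  by rewrite pcmpA pcmpVl pcmp1.
- by exists R, x, (comp y f); rewrite pedgeM pinvM pcmpA.
Qed.

Definition iota X : hom base ((X, X) : C) := @sis_mor base (X, X) X (tunitr X) (tunitr X).

Lemma isom_iota X Y (a : hom X Y) : comp (isom a a) (iota X) = iota Y.
Proof. by rewrite isom_sis_mor; apply: (sis_mor_eq (u := a)); rewrite tunitr_nat. Qed.

Lemma sis_mor_iota X Y s (f : hom (tens s tunit) X) (g : hom (tens s tunit) Y) :
  @sis_mor base (X, Y) s f g =
  comp (isom (idm X) (comp g (invm f))) (iota X).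
Proof.
pose a := comp f (invm (tunitr s)).
rewrite -(isom_iota a) compA isomM isom_sis_mor /a.
by congr sis_mor; rewrite /= ?comp1m -!compA invm_l compm1// invm_l compm1.
Qed.

(** The loop that goes to the object [(X, X)], then around its automorphism [(1, th)],
    and back. *)
Definition aut_class X (th : hom X X) : pi :=
  pcmp (pcmp (e (iota X)) (e (isom (idm X) th))) (pinv (e (iota X))).

(** A loop at the base object is a fraction of two morphisms to the same pair [(X, Y)];
    each of them is an isomorphism of [X] with [Y], and the loop compares the two. *)
Lemma aut_class_surj (w : pi) : exists X (th : hom X X), w = aut_class th.
Proof.
have [[X Y] [x [y ->]]] := zigzag_fraction w.
have [s [f [g ->]]] := sis_morP x; have [t [f' [g' ->]]] := sis_morP y.
rewrite !sis_mor_iota; set b := comp g _; set b' := comp g' _.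
exists X, (comp (invm b') b).
have -> : isom (idm X) b = comp (isom (idm X) b') (isom (idm X) (comp (invm b') b)).
  by rewrite isomM comp1m compA invm_r comp1m.
by rewrite !pedgeM pinvM /aut_class -!pcmpA; do 2 congr pcmp; rewrite pcmpA pcmpV pcmp1.
Qed.

Lemma aut_classM X (th th' : hom X X) :
  aut_class (comp th' th) = pcmp (aut_class th) (aut_class th').
Proof.
rewrite /aut_class -(comp1m (idm X)) -isomM pedgeM comp1m -!pcmpA; do 2 apply: congr1.
by rewrite [in RHS]pcmpA pcmpVl pcmp1.
Qed.

Lemma aut_class_conj X Y (b : hom X Y) (th : hom X X) :
  aut_class (comp b (comp th (invm b))) = aut_class th.
Proof.
rewrite /aut_class -(isom_iota b) pedgeM pinvM.
rewrite -!pcmpA; congr pcmp; rewrite !pcmpA -pedgeM.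
have -> : comp (isom (idm Y) (comp b (comp th (invm b)))) (isom b b) =
    comp (isom b b) (isom (idm X) th).
  by rewrite !isomM comp1m compm1 -!compA invm_l compm1.
by rewrite pedgeM pcmpK.
Qed.

(** The morphism [(X, X) -> (s + X, s + X)] that adds [s] carries the automorphism
    [(1, th)] to [(1, 1 + th)]. *)
Lemma aut_class_tens s X (th : hom X X) : aut_class (tensm (idm s) th) = aut_class th.
Proof.
pose j : hom ((X, X) : C) ((tens s X, tens s X) : C) :=
  @sis_mor (X, X) (tens s X, tens s X) s (idm _) (idm _).
have jiota : comp j (iota X) = iota (tens s X).
  rewrite /j sis_morM sis_mor_iota invm_r; apply: isom_iota.
have jth : comp (isom (idm (tens s X)) (tensm (idm s) th)) j = comp j (isom (idm X) th).
  by rewrite sis_mor_isom isom_sis_mor tensm1 !comp1m !compm1.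
rewrite /aut_class -jiota pedgeM pinvM.
rewrite -!pcmpA; congr pcmp; rewrite !pcmpA -pedgeM.
by rewrite jth pedgeM pcmpK.
Qed.

(** Conjugation by the symmetry moves [th'] to the other summand of [X + X], where it
    commutes with [th]. *)
Lemma aut_classC X (th th' : hom X X) :
  pcmp (aut_class th) (aut_class th') = pcmp (aut_class th') (aut_class th).
Proof.
have E : aut_class th' = aut_class (tensm th' (idm X)).
  rewrite -(aut_class_tens X) -(aut_class_conj (tbraid X X)); congr aut_class.
  by rewrite compA tbraid_nat -compA invm_r compm1.
rewrite -(aut_class_tens X th) E -!aut_classM; congr aut_class.
by rewrite -!tensmM !comp1m !compm1.
Qed.

End GroupCompletion.

(** * Definable embeddings and their complements *)

Section DefinableInjections.
Variables (R : comNzRingType) (M : lmodType R).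
Implicit Types X Y Z : defset M.

Record definj X Y := DefInj {
  jfun :> X -> Y;
  jinj : injective jfun;
  jdef : definable (graph jfun)
}.

Definition definj_comp X Y Z (j : definj Y Z) (i : definj X Y) : definj X Z :=
  DefInj (inj_comp (@jinj _ _ j) (@jinj _ _ i)) (graph_comp_definable (jdef j) (jdef i)).

Definition definj_bij X Y (b : defbij X Y) : definj X Y :=
  DefInj (can_inj (dfunK b)) (dfun_def b).

Lemma defbij_of X Y (i : definj X Y) : (forall y, exists x, i x = y) ->
  exists b : defbij X Y, b =1 i.
Proof.
move=> /choice[g gK].
have gK' : cancel i g by move=> x; apply: (@jinj _ _ i); rewrite gK.
by exists (DefBij gK' gK (jdef i)).
Qed.

Section Inclusion.
Variables (m : nat) (A B : set (m.-tuple M)).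
Hypotheses (dA : definable A) (AB : A `<=` B).

Definition subincl (a : A) : B :=
  exist (fun v => v \in B) (val a) (mem_set (AB (set_mem (valP a)))).

Lemma subincl_inj : injective subincl.
Proof. by move=> a a' /(congr1 val) /= /val_inj. Qed.

Lemma subincl_definable : definable (graph subincl).
Proof.
apply/graph_definable; have := (graph_definable _).1 (graph_id_definable dA).
apply: dpred_ext => e; split=> -[x [E E']]; exists x; split=> //.
Qed.

End Inclusion.

Lemma image_definable X Y (i : definj X Y) :
  definable [set y | @dcar R M Y y /\ ~ exists x : X, val (i x) = y].
Proof.
have d1 := definable_dpred (dcar_def Y).
have d2 := dpred_exs (dpred_graph (@lshift (ddim X) (ddim Y)) (@rshift (ddim X) (ddim Y)) (jdef i)).
apply: dpred_definable (dpred_and d1 (dpred_not d2)) _ => y.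
have Er (w : 'I_(ddim X) -> M) : (fun k => env_cat w (tnth y) (rshift (ddim X) k)) = tnth y.
  by apply/funext => k; rewrite env_catr.
have El (w : 'I_(ddim X) -> M) : (fun k => env_cat w (tnth y) (lshift (ddim Y) k)) = w.
  by apply/funext => k; rewrite env_catl.
rewrite /= mktuple_tnth; split=> -[Yy H]; split=> // -[].
  by move=> w [x]; rewrite El Er => -[_ E]; apply: H; exists x; exact/esym/tnth_inj.
move=> x ix; apply: H; exists (tnth (val x)), x; rewrite El Er; split=> //.
by congr tnth; rewrite -ix.
Qed.

Variables (c : M) (c0 : c != 0).
Notation "A +d B" := (defsum c A B) (at level 50, left associativity).

Lemma dinl_inj X Y : injective (@dinl R M c X Y).
Proof. by move=> x x' /join_inj -/(_ c0) []. Qed.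

Lemma dinr_inj X Y : injective (@dinr R M c X Y).
Proof. by move=> x x' /join_inj -/(_ c0) []. Qed.

Lemma dinl_neq_dinr X Y (x : X) (y : Y) : dinl c Y x <> dinr c X y.
Proof. by move=> /join_inj -/(_ c0). Qed.

Definition jinl X Y : definj X (X +d Y) := DefInj (@dinl_inj X Y) (dinl_definable c X Y).
Definition jinr X Y : definj Y (X +d Y) := DefInj (@dinr_inj X Y) (dinr_definable c X Y).

Lemma copair_inj X Y Z (i : definj X Z) (j : definj Y Z) :
  (forall x y, i x <> j y) -> injective (copair i j : X +d Y -> Z).
Proof.
move=> ij; elim/defsum_ind=> x; elim/defsum_ind=> y; rewrite ?copair_inl ?copair_inr//.
- by move=> /jinj ->.
- by move=> /ij.
- by move=> /esym/ij.
- by move=> /jinj ->.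
Qed.

Definition jcopair X Y Z (i : definj X Z) (j : definj Y Z) (ij : forall x y, i x <> j y) :
  definj (X +d Y) Z := DefInj (copair_inj ij) (copair_definable c0 (jdef i) (jdef j)).

(** Up to an isomorphism, an embedding is the inclusion of a summand: the other summand
    is the complement of the image, which is definable. *)
Lemma complement X Y (i : definj X Y) :
  exists s : defset M, exists2 k : defbij (s +d X) Y,
    forall x, k (dinr c s x) = i x & forall y, (forall x, y <> i x) -> exists z, k (dinl c X z) = y.
Proof.
pose s := DefSet (ddim_gt0 Y) (image_definable i).
have sY : @dcar R M s `<=` @dcar R M Y by move=> y [].
pose inc : definj s Y := @DefInj s Y (@subincl (ddim Y) (@dcar R M s) (@dcar R M Y) sY)
  (@subincl_inj _ _ _ sY) (subincl_definable (dcar_def s) sY).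
have disj (z : s) (x : X) : inc z <> i x.
  by move=> e; have [_] := set_mem (valP z); apply; exists x; rewrite -e.
have out y : (forall x, y <> i x) -> exists z, inc z = y.
  move=> H; have sy : @dcar R M s (val y).
    by split; [exact: set_mem (valP y)|move=> [x /val_inj/esym]; exact: H].
  by exists (exist (fun v => v \in @dcar R M s) _ (mem_set sy)); exact: val_inj.
have [|k kE] := @defbij_of _ _ (jcopair disj).
  move=> y; have [[x e]|H] := pselect (exists x, y = i x).
    by exists (dinr c s x); rewrite /= copair_inr.
  have [|z e] := out y; first by move=> x e; apply: H; exists x.
  by exists (dinl c X z); rewrite /= copair_inl.
exists s, k => [x|y /out[z e]]; first by rewrite kE /= copair_inr.
by exists z; rewrite kE /= copair_inl.
Qed.

Definition extends_along X Y (i : definj X Y) (th : defbij X X) (th' : defbij Y Y) : Prop :=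
  (forall x, th' (i x) = i (th x)) /\ (forall y, (forall x, y <> i x) -> th' y = y).

Lemma extends_unique X Y (i : definj X Y) th th1 th2 :
  extends_along i th th1 -> extends_along i th th2 -> th1 = th2.
Proof.
move=> [a1 b1] [a2 b2]; apply: defbij_eq => y.
have [[x ->]|H] := pselect (exists x, y = i x); first by rewrite a1 a2.
by rewrite b1 ?b2// => x e; apply: H; exists x.
Qed.

(** Extension along an embedding is, up to conjugation, the sum with an identity. *)
Lemma extends_conj X Y (i : definj X Y) : exists s : defset M, exists k : defbij (s +d X) Y,
  forall th, extends_along i th
    (defbij_comp k (defbij_comp (defbij_sum c0 (defbij_id s) th) (defbij_inv k))).
Proof.
have [s [k kr kl]] := complement i; exists s, k => th; split=> [x|y /kl[z <-]].
  by rewrite !defbij_compE -(kr x) [defbij_inv k _]dfunK defbij_sum_inr kr.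
by rewrite !defbij_compE [defbij_inv k _]dfunK defbij_sum_inl.
Qed.

Lemma extends_exists X Y (i : definj X Y) th : exists th', extends_along i th th'.
Proof. by have [s [k h]] := extends_conj i; eexists; exact: h. Qed.

Lemma extends_comp X Y Z (i : definj X Y) (j : definj Y Z) th th' th'' :
  extends_along i th th' -> extends_along j th' th'' -> extends_along (definj_comp j i) th th''.
Proof.
move=> [a b] [a' b']; split=> [x|z H] /=; first by rewrite a' a.
have [[y e]|H'] := pselect (exists y, z = j y); last first.
  by apply: b' => y e; apply: H'; exists y.
by rewrite e a' b// => x e'; apply: (H x); rewrite e e'.
Qed.

Lemma extendsM X Y (i : definj X Y) th1 th2 th1' th2' :
  extends_along i th1 th1' -> extends_along i th2 th2' ->
  extends_along i (defbij_comp th1 th2) (defbij_comp th1' th2').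
Proof.
move=> [a b] [a' b']; split=> [x|y H] /=; first by rewrite a' a.
by rewrite b' ?b.
Qed.

Lemma eq_extends X Y (i i' : definj X Y) th th' : i =1 i' ->
  extends_along i th th' -> extends_along i' th th'.
Proof.
move=> ii' [a b]; split=> [x|y H]; first by rewrite -!ii' a.
by apply: b => x; rewrite ii'.
Qed.

Lemma extends_bij X Y (b : defbij X Y) th :
  extends_along (definj_bij b) th (defbij_comp b (defbij_comp th (defbij_inv b))).
Proof.
split=> [x|y H] /=; first by rewrite dfunK.
by case: (H (dinv b y)); rewrite /= dinvK.
Qed.

End DefinableInjections.

(** * Powers of the module *)

Section FullPowers.
Variables (R : comNzRingType) (M : lmodType R).
Implicit Types X Y Z : defset M.

Definition Mn (n : nat) : defset M := @DefSet R M n.+1 isT setT (@definableT R M n.+1).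

Definition defbij_of_Omega n (f : Omega M n.+1) : defbij (Mn n) (Mn n).
Proof.
apply: (@DefBij R M (Mn n) (Mn n) (@toT R M n.+1 \o (f \o val)) (@toT R M n.+1 \o (oinv f \o val))).
- by move=> x; apply: val_inj; rewrite /= ofunK.
- by move=> x; apply: val_inj; rewrite /= oinvK.
- by have := ofun_def f; rewrite graphTE.
Defined.

Definition Omega_of_defbij n (b : defbij (Mn n) (Mn n)) : Omega M n.+1.
Proof.
apply: (@MkOmega R M n.+1 (fun v => val (b (toT v))) (fun v => val (dinv b (toT v)))).
- by move=> v; rewrite (_ : toT _ = b (toT v)) ?dfunK//; exact: val_inj.
- by move=> v; rewrite (_ : toT _ = dinv b (toT v)) ?dinvK//; exact: val_inj.
- rewrite graphTE (_ : _ \o _ = b); first exact: dfun_def b.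
  by apply/funext => x; apply: val_inj; rewrite /=; congr (val (b _)); exact: val_inj.
Defined.

Lemma Omega_of_defbijK n (b : defbij (Mn n) (Mn n)) :
  defbij_of_Omega (Omega_of_defbij b) = b.
Proof.
by apply: defbij_eq => x; apply: val_inj; rewrite /=; congr (val (b _)); exact: val_inj.
Qed.

Lemma defbij_of_OmegaK n (f : Omega M n.+1) : Omega_of_defbij (defbij_of_Omega f) = f.
Proof. exact: Omega_eq. Qed.

Lemma Omega_of_defbijM n (b b' : defbij (Mn n) (Mn n)) :
  Omega_of_defbij (defbij_comp b b') = (Omega_of_defbij b * Omega_of_defbij b')%g.
Proof.
by apply: Omega_eq => v /=; congr (val (b _)); exact: val_inj.
Qed.

Lemma defbij_of_OmegaM n (f g : Omega M n.+1) :
  defbij_of_Omega (f * g)%g = defbij_comp (defbij_of_Omega f) (defbij_of_Omega g).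
Proof. exact: defbij_eq. Qed.

(** The entry [d] in the last coordinate lets two such embeddings have disjoint images
    in a larger power. *)
Definition padv (d : M) n N (v : n.+1.-tuple M) : N.+1.-tuple M :=
  [tuple if (i <= n)%N then tnth v (inord i) else if i == N :> nat then d else 0 | i < N.+1].

Definition padf d n N : Mn n -> Mn N := @toT R M N.+1 \o (@padv d n N \o val).

Lemma padv_inj d n N : (n <= N)%N -> injective (@padv d n N).
Proof.
move=> nN u v E; apply: eq_from_tnth => i.
have := congr1 (fun w => tnth w (inord i)) E; rewrite !tnth_mktuple.
have iN : (i < N.+1)%N by apply: leq_trans (ltn_ord i) _.
by rewrite inordK// -ltnS ltn_ord inord_val.
Qed.

Lemma padf_definable d n N : definable (graph (@padf d n N)).
Proof.
apply/graph_definable.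
have dP : dpred (fun e : 'I_(n.+1 + N.+1) -> M => forall i : 'I_N.+1,
    e (rshift n.+1 i) = if (i <= n)%N then e (lshift N.+1 (inord i))
      else if i == N :> nat then d else 0).
  apply: dpred_all => i; pose x := MVar M (rshift n.+1 i).
  case: (i <= n)%N; first exact: (dpred_eq x (MVar _ (lshift N.+1 (inord i)))).
  by case: (i == N :> nat); [exact: (dpred_eq x (MPar _ d))|exact: (dpred_eq x (MZero M _))].
apply: dpred_ext dP => e; split=> [E|[x [E E']] i].
  exists (toT (mktuple (fun i => e (lshift N.+1 i)))); rewrite /= tnth_mktupleE.
  by split=> //; apply/funext => i; rewrite E tnth_mktuple tnth_mktupleE.
rewrite (congr1 (@^~ i) E') /= tnth_mktuple.
by rewrite -(congr1 (@^~ (inord i)) E).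
Qed.

Definition padj (d : M) n N (nN : (n <= N)%N) : definj (Mn n) (Mn N).
Proof.
apply: (@DefInj R M _ _ (@padf d n N) _ (@padf_definable d n N)).
by move=> x y /(congr1 val) /(padv_inj nN)/val_inj.
Defined.

Lemma padv_id n v : @padv 0 n n v = v.
Proof.
apply: eq_from_tnth => i; rewrite tnth_mktuple -ltnS ltn_ord.
by rewrite inord_val.
Qed.

Lemma padv0_comp n m N v : (n <= m)%N -> (m <= N)%N ->
  @padv 0 m N (@padv 0 n m v) = @padv 0 n N v.
Proof.
move=> nm mN; apply: eq_from_tnth => i; rewrite !tnth_mktuple !if_same.
case: leqP => im; last by rewrite leqNgt (leq_ltn_trans nm im).
by rewrite inordK ?ltnS.
Qed.

Lemma padv_last d n N v : (n < N)%N -> tnth (@padv d n N v) ord_max = d.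
Proof. by move=> nN; rewrite tnth_mktuple /= leqNgt nN /= eqxx. Qed.

Lemma padv_rcons n v : @padv 0 n n.+1 v = [tuple of rcons v 0].
Proof.
apply: eq_tuple_last; rewrite ?tinit_rcons ?tnth_rcons_last ?padv_last//.
apply: eq_from_tnth => i; rewrite !tnth_mktuple /= -ltnS ltn_ord.
by rewrite inord_val.
Qed.

(** The transition maps of the direct system are extensions along [v |-> (v, 0)]. *)
Lemma ext_extends n (f : Omega M n.+1) :
  extends_along (padj 0 (leqnSn n)) (defbij_of_Omega f) (defbij_of_Omega (Omega_ext f)).
Proof.
split=> [x|y H]; apply: val_inj; rewrite /=.
  by rewrite !padv_rcons /ext_fun tnth_rcons_last eqxx tinit_rcons.
rewrite /ext_fun ifF//; apply/negP => /eqP y0.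
apply: (H (toT (tinit (val y)))); apply: val_inj; rewrite /= padv_rcons.
by rewrite -[LHS]rcons_tinit y0.
Qed.

Lemma embedding X : exists n, exists i : definj X (Mn n), True.
Proof.
case: X => -[//|n] n0 A dA; exists n.
pose X := DefSet n0 dA.
have XT : @dcar R M X `<=` [set: (ddim X).-tuple M] by [].
by exists (@DefInj R M X (Mn n) (@subincl _ _ _ _ _ XT) (@subincl_inj _ _ _ _ _ XT)
  (subincl_definable dA XT)).
Qed.

End FullPowers.

(** * The value of a definable bijection *)

Section Invariant.
Variables (R : comNzRingType) (M : lmodType R) (c : M) (c0 : c != 0).
Implicit Types X Y Z : defset M.
Notation "A +d B" := (defsum c A B) (at level 50, left associativity).
Local Open Scope group_scope.

Lemma ab_piM (G : groupType) (x y : G) : ab_pi (x * y) = ab_pi x * ab_pi y.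
Proof. exact: esym (ab_mulE x y). Qed.

Lemma ab_piC (G : groupType) (x y : G) : ab_pi (x * y) = ab_pi (y * x).
Proof.
apply/esym/ab_piP; rewrite /ab_eq.
have -> : (y * x)^-1 * (x * y) = [~ x, y] by rewrite /commg /conjg invgM !mulgA.
exact: derived_comm.
Qed.

Variables (H : groupType) (vn : forall n, {multiplicative ab (Omega M n.+1) -> H}).
Hypothesis vn_ext : forall n x, vn n.+1 (ab_map (@Omega_ext R M n.+1) x) = vn n x.

Definition Omega_value n (b : defbij (Mn M n) (Mn M n)) : H := vn n (ab_pi (Omega_of_defbij b)).

Lemma Omega_valueM n (b b' : defbij (Mn M n) (Mn M n)) :
  Omega_value (defbij_comp b b') = Omega_value b * Omega_value b'.
Proof. by rewrite /Omega_value Omega_of_defbijM ab_piM gmulfM. Qed.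

Lemma Omega_valueC n (b b' : defbij (Mn M n) (Mn M n)) :
  Omega_value b * Omega_value b' = Omega_value b' * Omega_value b.
Proof. by rewrite -!Omega_valueM /Omega_value !Omega_of_defbijM ab_piC. Qed.

Lemma Omega_value_conj n (t b : defbij (Mn M n) (Mn M n)) :
  Omega_value (defbij_comp t (defbij_comp b (defbij_inv t))) = Omega_value b.
Proof.
rewrite Omega_valueM Omega_valueC -Omega_valueM; congr Omega_value; apply: defbij_eq => x /=.
by rewrite dfunK.
Qed.

Lemma Omega_value_ext n b b' :
  extends_along (padj 0 (leqnSn n)) b b' -> Omega_value b' = Omega_value b.
Proof.
move=> bb'; rewrite -(Omega_of_defbijK b) in bb'.
rewrite (extends_unique bb' (ext_extends (Omega_of_defbij b))) /Omega_value defbij_of_OmegaK.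
by rewrite -ab_mapE vn_ext.
Qed.

Lemma Omega_value_pad n N (nN : (n <= N)%N) b b' :
  extends_along (padj 0 nN) b b' -> Omega_value b' = Omega_value b.
Proof.
elim: N nN b' => [|N IH] nN b'.
  have n0 : n = 0%N by apply/eqP; rewrite -leqn0.
  case: _ / (esym n0) nN b b' => nN b b' bb'; congr Omega_value; apply: defbij_eq => x.
  have pid (y : Mn M 0) : padj 0 nN y = y by apply: val_inj; exact: padv_id.
  by rewrite -[in LHS](pid x) bb'.1 pid.
have [nN'|Nn] := leqP n N; last first.
  have En : n = N.+1 by apply/eqP; rewrite eqn_leq nN Nn.
  clear IH; move: b b'; case: _ / (esym En) nN {Nn} => nN b b' bb'.
  congr Omega_value; apply: defbij_eq => x.
  have pid (y : Mn M N.+1) : padj 0 nN y = y by apply: val_inj; exact: padv_id.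
  by rewrite -[in LHS](pid x) bb'.1 pid.
move=> bb'; have [b1 bb1] := extends_exists c0 (padj 0 nN') b.
have [b2 b12] := extends_exists c0 (padj 0 (leqnSn N)) b1.
have E : extends_along (padj 0 nN) b b2.
  apply: eq_extends (extends_comp bb1 b12) => x; apply: val_inj.
  by rewrite /= padv0_comp.
by rewrite (extends_unique bb' E) (Omega_value_ext b12); exact: IH bb1.
Qed.

(** If two embeddings have disjoint images, then the involution that exchanges the images
    conjugates one extension to the other. *)
Lemma Omega_value_disjoint X N (a b : definj X (Mn M N)) th w w' :
  (forall x y, a x <> b y) -> extends_along a th w -> extends_along b th w' ->
  Omega_value w = Omega_value w'.
Proof.
move=> ab aw bw'.
have [t [t1 t2]] := extends_exists c0 (jcopair c0 ab) (defbraid c0 X X).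
have ta x : t (a x) = b x.
  have := t1 (dinl c X x); rewrite /= copair_inl//.
  by rewrite -[dbraid_fun _]/(defbraid c0 X X _) defbraid_l copair_inr.
have ti x : dinv t (b x) = a x by rewrite -ta dfunK.
rewrite -(Omega_value_conj t w); congr Omega_value.
apply: (extends_unique _ bw'); split=> [x|y yb] /=.
  by rewrite ti aw.1 ta.
rewrite aw.2 ?dinvK// => x e; apply: (yb x).
by rewrite -ta -e dinvK.
Qed.

(** The value of a bijection of an embedded set does not depend on the embedding: move
    one of the two embeddings off the other in a larger power of the module, and
    conjugate by the involution that exchanges the two copies. *)
Lemma Omega_value_indep X n n' (i : definj X (Mn M n)) (i' : definj X (Mn M n')) th w w' :
  extends_along i th w -> extends_along i' th w' -> Omega_value w = Omega_value w'.
Proof.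
move=> iw iw'; pose N := (n + n').+1.
have nN : (n < N)%N by rewrite ltnS leq_addr.
have nN' : (n' < N)%N by rewrite ltnS leq_addl.
have [w1 ww1] := extends_exists c0 (padj 0 (ltnW nN)) w.
have [w2 ww2] := extends_exists c0 (padj 0 (ltnW nN')) w'.
have [w3 ww3] := extends_exists c0 (padj c (ltnW nN')) w'.
rewrite -(Omega_value_pad ww1) -(Omega_value_pad ww2).
have off n1 (h : (n1 < N)%N) x y :
    padj 0 (ltnW h) x <> padj c (ltnW nN') y.
  move=> /(congr1 (fun z => tnth (val z) ord_max)); rewrite /= !padv_last// => /eqP.
  by rewrite eq_sym (negbTE c0).
rewrite (Omega_value_disjoint _ (extends_comp iw ww1) (extends_comp iw' ww3)); last first.
  by move=> x y; exact: off.
apply/esym/(Omega_value_disjoint _ (extends_comp iw' ww2) (extends_comp iw' ww3)) => x y.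
exact: off.
Qed.

(** All the [w] have the same value, by [Omega_value_indep]. *)
Definition value X (th : defbij X X) : H := xget 1 [set h |
  exists n (i : definj X (Mn M n)) w, extends_along i th w /\ Omega_value w = h].

Lemma valueE X n (i : definj X (Mn M n)) th w : extends_along i th w -> value th = Omega_value w.
Proof.
move=> iw; have : [set h | exists n (i : definj X (Mn M n)) w,
    extends_along i th w /\ Omega_value w = h] (value th).
  by apply: (@xgetI _ _ _ (Omega_value w)); exists n, i, w.
by move=> [n' [i' [w' [iw' <-]]]]; exact: Omega_value_indep iw' iw.
Qed.

Lemma value_extends X Y (i : definj X Y) th th' : extends_along i th th' -> value th' = value th.
Proof.
move=> ii'; have [n [j _]] := embedding Y; have [w jw] := extends_exists c0 j th'.
by rewrite (valueE jw) (valueE (extends_comp ii' jw)).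
Qed.

Lemma value_conj X Y (b : defbij X Y) th :
  value (defbij_comp b (defbij_comp th (defbij_inv b))) = value th.
Proof. exact: value_extends (extends_bij b th). Qed.

Lemma value_comp X (th th' : defbij X X) : value (defbij_comp th th') = value th * value th'.
Proof.
have [n [j _]] := embedding X.
have [[w jw] [w' jw']] := (extends_exists c0 j th, extends_exists c0 j th').
by rewrite (valueE jw) (valueE jw') (valueE (extendsM jw jw')) Omega_valueM.
Qed.

Lemma extends_dinl X Y (th : defbij X X) :
  extends_along (jinl c0 X Y) th (defbij_sum c0 th (defbij_id Y)).
Proof.
split=> [x|]; first exact: defbij_sum_inl.
elim/defsum_ind=> [x /(_ x)//|y _]; exact: defbij_sum_inr.
Qed.

Lemma extends_dinr X Y (th : defbij Y Y) :
  extends_along (jinr c0 X Y) th (defbij_sum c0 (defbij_id X) th).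
Proof.
split=> [x|]; first exact: defbij_sum_inr.
elim/defsum_ind=> [y _|x /(_ x)//]; exact: defbij_sum_inl.
Qed.

(** The two bijections act on different summands of [X + Y]. *)
Lemma value_comm X Y (th : defbij X X) (th' : defbij Y Y) :
  value th * value th' = value th' * value th.
Proof.
rewrite -(value_extends (extends_dinl Y th)) -(value_extends (extends_dinr X th')).
by rewrite -!value_comp -!defbij_sumM.
Qed.

End Invariant.

(** * Stable isomorphisms of pairs of definable sets *)

Section StableLoops.
Variables (R : comNzRingType) (M : lmodType R) (c : M) (c0 : c != 0).
Implicit Types A B D E s t r : defset M.
Notation "A +d B" := (defsum c A B) (at level 50, left associativity).
Notation "f +b g" := (defbij_sum c0 f g) (at level 50, left associativity).
Notation "f \b g" := (defbij_comp f g) (at level 47, right associativity).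
Notation il := (dinl c _).
Notation ir := (dinr c _).
Notation id1 := (defbij_id _).

Let dE := (defbij_idE, defbij_sum_inl c0, defbij_sum_inr c0,
  defassoc_ll c0, defassoc_lr c0, defassoc_r c0, defunitl_r c0, defbraid_l c0, defbraid_r c0).

Lemma defassoc_inv_l A B D a : defbij_inv (defassoc c0 A B D) (il a) = il (il a).
Proof. by rewrite -(defassoc_ll c0 B D a) [LHS]dfunK. Qed.

Lemma defassoc_inv_rl A B D b : defbij_inv (defassoc c0 A B D) (ir (il b)) = il (ir b).
Proof. by rewrite -(defassoc_lr c0 A D b) [LHS]dfunK. Qed.

Lemma defassoc_inv_rr A B D d : defbij_inv (defassoc c0 A B D) (ir (ir d)) = ir d.
Proof. by rewrite -(defassoc_r c0 A B d) [LHS]dfunK. Qed.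

(** The exchange of the first two summands, which lets a bijection act on the first and the
    third. *)
Definition dswap t s A : defbij (t +d (s +d A)) (s +d (t +d A)) :=
  defassoc c0 s t A \b ((defbraid c0 t s +b id1) \b defbij_inv (defassoc c0 t s A)).

Lemma dswap_l t s A x : dswap t s A (il x) = ir (il x).
Proof. by rewrite !defbij_compE defassoc_inv_l !dE. Qed.

Lemma dswap_rl t s A z : dswap t s A (ir (il z)) = il z.
Proof. by rewrite !defbij_compE defassoc_inv_rl !dE. Qed.

Lemma dswap_rr t s A a : dswap t s A (ir (ir a)) = ir (ir a).
Proof. by rewrite !defbij_compE defassoc_inv_rr !dE. Qed.

Section Skip.
Variables (t s : defset M).

Lemma skip_disj A (x : t) (a : A) :
  jinl c0 t (s +d A) x <> definj_comp (jinr c0 t (s +d A)) (jinr c0 s A) a.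
Proof. exact: dinl_neq_dinr. Qed.

Definition jskip A : definj (t +d A) (t +d (s +d A)) := jcopair c0 (@skip_disj A).

Lemma jskip_l A x : jskip A (il x) = il x. Proof. exact: copair_inl. Qed.
Lemma jskip_r A a : jskip A (ir a) = ir (ir a). Proof. exact: copair_inr. Qed.

Lemma jskip_ind A (P : t +d (s +d A) -> Prop) : (forall x, P (jskip A x)) ->
  (forall z, P (ir (il z))) -> forall w, P w.
Proof.
move=> Px Pz; elim/defsum_ind=> [x|]; first by rewrite -jskip_l.
by elim/defsum_ind=> [z//|a]; rewrite -jskip_r.
Qed.

Lemma jskip_dswap A x : dswap t s A (jskip A x) = ir x.
Proof. by elim/defsum_ind: x => x; rewrite ?jskip_l ?jskip_r ?dswap_l ?dswap_rr. Qed.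

Lemma dswap_jskip A x : dswap s t A (ir x) = jskip A x.
Proof. by elim/defsum_ind: x => x; rewrite ?jskip_l ?jskip_r ?dswap_rl ?dswap_rr. Qed.

Definition skip A B (al : defbij (t +d A) (t +d B)) :
  defbij (t +d (s +d A)) (t +d (s +d B)) :=
  dswap s t B \b ((id1 +b al) \b dswap t s A).

Lemma skipE A B (al : defbij (t +d A) (t +d B)) z :
  skip al z = dswap s t B ((id1 +b al) (dswap t s A z)).
Proof. by []. Qed.

Lemma skip_emb A B (al : defbij (t +d A) (t +d B)) x : skip al (jskip A x) = jskip B (al x).
Proof. by rewrite skipE jskip_dswap defbij_sum_inr dswap_jskip. Qed.

Lemma skip_mid A B (al : defbij (t +d A) (t +d B)) z : skip al (ir (il z)) = ir (il z).
Proof. by rewrite skipE dswap_rl defbij_sum_inl dswap_l. Qed.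

Lemma skipM A B D (be : defbij (t +d B) (t +d D)) (al : defbij (t +d A) (t +d B)) :
  skip (be \b al) = skip be \b skip al.
Proof.
by apply: defbij_eq; elim/jskip_ind=> x; rewrite defbij_compE ?skip_emb ?skip_mid.
Qed.

Lemma skip1 A : skip (defbij_id (t +d A)) = id1.
Proof. by apply: defbij_eq; elim/jskip_ind=> x; rewrite ?skip_emb ?skip_mid. Qed.

Lemma skip_sum A B (b : defbij A B) : skip (defbij_id t +b b) = id1 +b (id1 +b b).
Proof.
apply: defbij_eq; elim/jskip_ind; last by move=> z; rewrite skip_mid !dE.
by move=> x; rewrite skip_emb; elim/defsum_ind: x => x; rewrite !dE ?jskip_l ?jskip_r ?dE.
Qed.

Lemma skip_extends A (th : defbij (t +d A) (t +d A)) :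
  extends_along (jskip A) th (skip th).
Proof.
split=> [x|]; first exact: skip_emb.
by elim/jskip_ind=> [x /(_ x)//|z _]; exact: skip_mid.
Qed.

End Skip.

Lemma skip_nat t s s' A B (u : defbij s s') (al : defbij (t +d A) (t +d B)) :
  (id1 +b (u +b id1)) \b skip s al = skip s' al \b (id1 +b (u +b id1)).
Proof.
have E D (x : t +d D) : (defbij_id t +b (u +b defbij_id D)) (jskip t s D x) = jskip t s' D x.
  by elim/defsum_ind: x => x; rewrite ?jskip_l ?jskip_r !dE.
apply: defbij_eq; elim/jskip_ind=> x; rewrite [LHS]defbij_compE [RHS]defbij_compE.
  by rewrite skip_emb !E skip_emb.
by rewrite skip_mid !dE skip_mid.
Qed.

Lemma skip_unit t A B (al : defbij (t +d A) (t +d B)) :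
  (id1 +b defunitl c0 B) \b skip (defempty M) al = al \b (id1 +b defunitl c0 A).
Proof.
have E D (x : t +d D) : (defbij_id t +b defunitl c0 D) (jskip t (defempty M) D x) = x.
  by elim/defsum_ind: x => x; rewrite ?jskip_l ?jskip_r !dE.
apply: defbij_eq; elim/jskip_ind=> x; last by case: (defempty_false x).
by rewrite [LHS]defbij_compE [RHS]defbij_compE skip_emb !E.
Qed.

Lemma skip_skip t r s A B (al : defbij (t +d A) (t +d B)) :
  (id1 +b defassoc c0 r s B) \b skip (r +d s) al =
  skip r (skip s al) \b (id1 +b defassoc c0 r s A).
Proof.
have E D (x : t +d D) : (defbij_id t +b defassoc c0 r s D) (jskip t (r +d s) D x) =
    jskip t r (s +d D) (jskip t s D x).
  by elim/defsum_ind: x => x; rewrite ?(jskip_l, jskip_r, dE).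
apply: defbij_eq; elim/jskip_ind=> x; rewrite [LHS]defbij_compE [RHS]defbij_compE.
  by rewrite skip_emb !E !skip_emb.
rewrite skip_mid !dE; elim/defsum_ind: x => z; rewrite !dE ?skip_mid//.
by rewrite -[X in skip r _ X]jskip_r skip_emb skip_mid jskip_r.
Qed.

Section Loop.
Variables (t s A B D E : defset M).
Variables (a : defbij (s +d A) D) (b : defbij (s +d B) E)
  (al : defbij (t +d A) (t +d B)) (ga : defbij (t +d D) (t +d E)).

(** A morphism [(s, a, b)] of the group completion carries a stable isomorphism [al] of
    [A] with [B] to one of [D] with [E]; the loop compares the result with [ga]. *)
Definition loop : defbij (t +d D) (t +d D) :=
  defbij_inv ga \b ((id1 +b b) \b (skip s al \b defbij_inv (id1 +b a))).

Lemma loop_sum : loop \b (id1 +b a) = defbij_inv ga \b ((id1 +b b) \b skip s al).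
Proof. by apply: defbij_eq => x; rewrite !defbij_compE [defbij_inv (id1 +b a) _]dfunK. Qed.

Lemma loopE x : loop ((id1 +b a) x) = defbij_inv ga ((id1 +b b) (skip s al x)).
Proof. by rewrite -[LHS]/((loop \b (id1 +b a)) x) loop_sum. Qed.

End Loop.

Lemma sum_surj t A B (a : defbij A B) (z : t +d B) : exists x, z = (defbij_id t +b a) x.
Proof. by exists (defbij_inv (defbij_id t +b a) z); rewrite [RHS]dinvK. Qed.

(** Triples that are isomorphic through [u] give the same loop, because [u] and [al] act on
    different summands. *)
Lemma loop_iso t s s' A B D E (u : defbij s s') (a : defbij (s' +d A) D)
    (b : defbij (s' +d B) E) (al : defbij (t +d A) (t +d B)) (ga : defbij (t +d D) (t +d E)) :
  loop (a \b (u +b id1)) (b \b (u +b id1)) al ga = loop a b al ga.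
Proof.
apply: defbij_eq => z; have [x ->] := sum_surj (a \b (u +b id1)) z.
rewrite loopE.
have E' X Y (f : defbij X Y) (g : defbij Y D) y :
    (defbij_id t +b (g \b f)) y = (defbij_id t +b g) ((defbij_id t +b f) y).
  by elim/defsum_ind: y => y; rewrite !dE.
have E'' X Y (f : defbij X Y) (g : defbij Y E) y :
    (defbij_id t +b (g \b f)) y = (defbij_id t +b g) ((defbij_id t +b f) y).
  by elim/defsum_ind: y => y; rewrite !dE.
rewrite E' E'' loopE; do 2 congr (dfun _ _).
exact: (congr1 (fun f => dfun f x) (skip_nat u al)).
Qed.

(** The loop of a composite is the product of the two loops, after the first one has been
    carried across the new summand [r] and conjugated: the stable isomorphism [ga] in the
    middle cancels. *)
Lemma loop_comp t r s A B D E X Y (a : defbij (s +d A) D) (b : defbij (s +d B) E)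
    (p : defbij (r +d D) X) (q : defbij (r +d E) Y)
    (al : defbij (t +d A) (t +d B)) (ga : defbij (t +d D) (t +d E))
    (ep : defbij (t +d X) (t +d Y)) :
  loop (p \b ((id1 +b a) \b defassoc c0 r s A)) (q \b ((id1 +b b) \b defassoc c0 r s B)) al ep =
  loop p q ga ep \b ((id1 +b p) \b (skip r (loop a b al ga) \b defbij_inv (id1 +b p))).
Proof.
have sM (X1 X2 X3 : defset M) (g : defbij X2 X3) (f : defbij X1 X2) (y : t +d X1) :
    (defbij_id t +b (g \b f)) y = (defbij_id t +b g) ((defbij_id t +b f) y).
  by elim/defsum_ind: y => y; rewrite !dE.
apply: defbij_eq => z.
have [x ->] := sum_surj (p \b ((id1 +b a) \b defassoc c0 r s A)) z.
have E' y : skip r (loop a b al ga) ((id1 +b (id1 +b a)) y) =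
    skip r (defbij_inv ga) ((id1 +b (id1 +b b)) (skip r (skip s al) y)).
  by rewrite -(@skip_sum t r _ _ a) -[LHS]defbij_compE -skipM loop_sum !skipM skip_sum.
have gaK y : skip r ga (skip r (defbij_inv ga) y) = y.
  rewrite -[LHS]defbij_compE -skipM.
  have -> : ga \b defbij_inv ga = id1 by apply: defbij_eq => w; exact: dinvK.
  by rewrite skip1.
rewrite loopE !sM [RHS]defbij_compE [X in _ = loop _ _ _ _ X]defbij_compE.
rewrite [X in _ = loop _ _ _ _ ((id1 +b p) X)]defbij_compE.
rewrite [defbij_inv (id1 +b p) _]dfunK E' loopE gaK; do 3 congr (dfun _ _).
exact: (congr1 (fun f => dfun f x) (skip_skip r s al)).
Qed.

Lemma loop_unit t A B A' B' (a : defbij A A') (b : defbij B B') (al : defbij (t +d A) (t +d B))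
    (ga : defbij (t +d A') (t +d B')) :
  loop (a \b defunitl c0 A) (b \b defunitl c0 B) al ga =
  defbij_inv ga \b ((id1 +b b) \b (al \b defbij_inv (id1 +b a))).
Proof.
have sM (X1 X2 X3 : defset M) (g : defbij X2 X3) (f : defbij X1 X2) (y : t +d X1) :
    (defbij_id t +b (g \b f)) y = (defbij_id t +b g) ((defbij_id t +b f) y).
  by elim/defsum_ind: y => y; rewrite !dE.
apply: defbij_eq => z; have [x ->] := sum_surj (a \b defunitl c0 A) z.
rewrite loopE !sM !defbij_compE [defbij_inv (id1 +b a) _]dfunK; do 2 congr (dfun _ _).
exact: (congr1 (fun f => dfun f x) (skip_unit al)).
Qed.

Section Stabilization.
Variables (t t' : defset M) (i : definj t t').

Lemma jpush_disj A (x : t) (a : A) :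
  definj_comp (jinl c0 t' A) i x <> jinr c0 t' A a.
Proof. exact: dinl_neq_dinr. Qed.

Definition jpush A : definj (t +d A) (t' +d A) := jcopair c0 (@jpush_disj A).

Lemma jpush_l A x : jpush A (il x) = il (i x). Proof. exact: copair_inl. Qed.
Lemma jpush_r A a : jpush A (ir a) = ir a. Proof. exact: copair_inr. Qed.

Definition stab A B (al : defbij (t +d A) (t +d B)) (al' : defbij (t' +d A) (t' +d B)) : Prop :=
  (forall x, al' (jpush A x) = jpush B (al x)) /\
  (forall y, (forall x, y <> i x) -> al' (il y) = il y).

Lemma jpush_ind A (P : t' +d A -> Prop) : (forall x, P (jpush A x)) ->
  (forall y, (forall x, y <> i x) -> P (il y)) -> forall z, P z.
Proof.
move=> Px Py; elim/defsum_ind=> [y|a]; last by rewrite -jpush_r.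
have [[x ->]|H] := pselect (exists x, y = i x); first by rewrite -jpush_l.
by apply: Py => x e; apply: H; exists x.
Qed.

Lemma stab_exists A B (al : defbij (t +d A) (t +d B)) : exists al', stab al al'.
Proof.
have [s [k kr kl]] := complement c0 i.
pose kk D : defbij (s +d (t +d D)) (t' +d D) := (k +b id1) \b defbij_inv (defassoc c0 s t D).
have kkr D x : kk D (ir x) = jpush D x.
  elim/defsum_ind: x => x; rewrite /kk defbij_compE.
    by rewrite defassoc_inv_rl !dE kr jpush_l.
  by rewrite defassoc_inv_rr !dE jpush_r.
have kkl D z : kk D (il z) = il (k (il z)).
  by rewrite /kk defbij_compE defassoc_inv_l !dE.
pose al' := kk B \b ((id1 +b al) \b defbij_inv (kk A)).
have al'E w : al' (kk A w) = kk B ((id1 +b al) w).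
  by rewrite -[X in _ = kk B (_ X)](dfunK (kk A) w).
exists al'; split=> [x|y /kl[z <-]]; first by rewrite -(kkr A) al'E !dE kkr.
by rewrite -(kkl A) al'E !dE kkl.
Qed.

Lemma stab_unique A B (al : defbij (t +d A) (t +d B)) al1 al2 :
  stab al al1 -> stab al al2 -> al1 = al2.
Proof.
move=> [a1 b1] [a2 b2]; apply: defbij_eq; elim/jpush_ind=> [x|y H].
  by rewrite a1 a2.
by rewrite b1 ?b2.
Qed.

Lemma stabM A B D (be : defbij (t +d B) (t +d D)) (al : defbij (t +d A) (t +d B)) be' al' :
  stab be be' -> stab al al' -> stab (be \b al) (be' \b al').
Proof.
move=> [a1 b1] [a2 b2]; split=> [x|y H]; rewrite !defbij_compE ?a2 ?a1//.
by rewrite b2 ?b1.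
Qed.

Lemma stabV A B (al : defbij (t +d A) (t +d B)) al' : stab al al' ->
  stab (defbij_inv al) (defbij_inv al').
Proof.
move=> [a b]; split=> [x|y H].
  by rewrite -[X in jpush B X](dinvK al x) -a [LHS]dfunK.
by rewrite -[X in defbij_inv al' X](b _ H) [LHS]dfunK.
Qed.

Lemma stab_sum A B (b : defbij A B) : stab (id1 +b b) (id1 +b b).
Proof.
split=> [x|y _]; last by rewrite !dE.
by elim/defsum_ind: x => x; rewrite ?(jpush_l, jpush_r, dE).
Qed.

Lemma stab_skip s A B (al : defbij (t +d A) (t +d B)) al' : stab al al' ->
  stab (skip s al) (skip s al').
Proof.
move=> [a b].
have E D x : jpush (s +d D) (jskip t s D x) = jskip t' s D (jpush D x).
  by elim/defsum_ind: x => x; rewrite ?(jpush_l, jpush_r, jskip_l, jskip_r).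
split=> [|y H]; last by rewrite -(jskip_l s A) skip_emb b// jskip_l.
elim/jskip_ind=> x; first by rewrite E !skip_emb a E.
by rewrite jpush_r !skip_mid jpush_r.
Qed.

Lemma stab_loop s A B D E (a : defbij (s +d A) D) (b : defbij (s +d B) E)
    (al : defbij (t +d A) (t +d B)) (ga : defbij (t +d D) (t +d E)) al' ga' :
  stab al al' -> stab ga ga' -> stab (loop a b al ga) (loop a b al' ga').
Proof.
move=> ha hg; apply: stabM; first exact: stabV.
apply: stabM; first exact: stab_sum.
by apply: stabM; [exact: stab_skip|apply: stabV; exact: stab_sum].
Qed.

Lemma stab_extends A (th : defbij (t +d A) (t +d A)) th' :
  stab th th' -> extends_along (jpush A) th th'.
Proof.
move=> [a b]; split=> // z; elim/jpush_ind: z => [x /(_ x)//|y H _].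
exact: b.
Qed.

End Stabilization.

Lemma stab_trans t t' t'' (i : definj t t') (j : definj t' t'') (k : definj t t'') A B
    (al : defbij (t +d A) (t +d B)) al' al'' : (forall x, k x = j (i x)) ->
  stab i al al' -> stab j al' al'' -> stab k al al''.
Proof.
move=> kE [a b] [a' b'].
have E D x : jpush k D x = jpush j D (jpush i D x).
  by elim/defsum_ind: x => x; rewrite ?(jpush_l, jpush_r) ?kE.
split=> [x|z H]; first by rewrite E a' a -E.
have [[y e]|H'] := pselect (exists y, z = j y); last first.
  by apply: b' => y e; apply: H'; exists y.
rewrite e -(jpush_l j A) a' b ?jpush_l// => x e'.
by apply: (H x); rewrite kE -e' e.
Qed.

End StableLoops.

(** * The determinant of a morphism of the group completion *)

Section AbelianizationLift.
Local Open Scope group_scope.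
Variables (G P : groupType) (f : {multiplicative G -> P}).
Hypothesis fC : forall x y, f x * f y = f y * f x.

Lemma derived_trivial x : in_derived x -> f x = 1.
Proof.
elim=> [a b||a b _ ha _ hb|a _ ha].
- by rewrite /commg /conjg !gmulfM !multV fC mulKg mulVg.
- exact: mult1.
- by rewrite gmulfM ha hb mulg1.
- by rewrite multV ha invg1.
Qed.

(** The proof of commutativity is an argument so that the structure of group morphism can be
    attached to the map. *)
Definition ab_lift (a : ab G) : P := let _ := fC in f (repr a).

Lemma ab_liftE x : ab_lift (ab_pi x) = f x.
Proof.
have /derived_trivial : ab_eq (repr (ab_pi x)) x by exact: equiv_repr (@ab_eq_equiv G) x.
rewrite gmulfM multV => /(congr1 (fun y => f (repr (ab_pi x)) * y)).
by rewrite mulVKg mulg1.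
Qed.

Lemma ab_liftM : {morph ab_lift : a b / a * b}.
Proof.
by elim/ab_ind=> x; elim/ab_ind=> y; rewrite -ab_piM !ab_liftE gmulfM.
Qed.

HB.instance Definition _ := isMultiplicative.Build (ab G) P ab_lift ab_liftM.

End AbelianizationLift.

Section Determinant.
Variables (R : comNzRingType) (M : lmodType R) (c : M) (c0 : c != 0).
Implicit Types A B D E s t : defset M.
Notation "A +d B" := (defsum c A B) (at level 50, left associativity).
Notation "f +b g" := (defbij_sum c0 f g) (at level 50, left associativity).
Notation "f \b g" := (defbij_comp f g) (at level 47, right associativity).
Notation id1 := (defbij_id _).
Notation S := (defset_smg c0).
Notation C := (SinvS S).
Local Open Scope group_scope.

Variables (H : groupType) (vn : forall n, {multiplicative ab (Omega M n.+1) -> H}).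
Hypothesis vn_ext : forall n x, vn n.+1 (ab_map (@Omega_ext R M n.+1) x) = vn n x.
Notation V := (value vn).

(** The component of the base object: the two entries are stably isomorphic. *)
Definition good A B : Prop := exists n (al : defbij (Mn M n +d A) (Mn M n +d B)), True.

Lemma good_fwd s A B D E (a : defbij (s +d A) D) (b : defbij (s +d B) E) :
  good A B -> good D E.
Proof.
move=> [n [al _]]; exists n.
by exists ((id1 +b b) \b (skip c0 s al \b defbij_inv (id1 +b a))).
Qed.

Lemma good_bwd s A B D E (a : defbij (s +d A) D) (b : defbij (s +d B) E) :
  good D E -> good A B.
Proof.
move=> [n [ga _]]; pose t := Mn M n +d s.
pose al : defbij (t +d A) (t +d B) :=
  defbij_inv (defassoc c0 _ _ _) \b (defbij_inv (id1 +b b) \b (ga \b ((id1 +b a) \b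
    defassoc c0 _ _ _))).
have [N [i _]] := embedding t; have [al' _] := stab_exists c0 i al.
by exists N, al'.
Qed.

(** A chosen stable isomorphism, against which all others are measured. *)
Definition ref A B : option {n : nat & defbij (Mn M n +d A) (Mn M n +d B)} :=
  if pselect (good A B) is left h then
    Some (existT _ (sval (cid h)) (sval (cid (svalP (cid h)))))
  else None.

Lemma ref_good A B : good A B -> exists r, ref A B = Some r.
Proof. by rewrite /ref; case: pselect => // h _; eexists. Qed.

(** The index [N] stands for the power [M^(N+1)]. *)
Definition is_ref A B N (al : defbij (Mn M N +d A) (Mn M N +d B)) : Prop :=
  exists r, ref A B = Some r /\
    exists h : (tag r <= N)%N, stab c0 (padj 0 h) (tagged r) al.

Lemma is_ref_unique A B N (al al' : defbij (Mn M N +d A) (Mn M N +d B)) :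
  is_ref al -> is_ref al' -> al = al'.
Proof.
move=> [r [rE [h st]]] [r' [rE' [h' st']]].
have err : r' = r by move: rE'; rewrite rE => -[].
subst r'.
by rewrite (eq_irrelevance h' h) in st'; exact: stab_unique st st'.
Qed.

Lemma is_ref_raise A B N N' (NN' : (N <= N')%N) (al : defbij (Mn M N +d A) (Mn M N +d B)) :
  is_ref al -> exists al', stab c0 (padj 0 NN') al al' /\ is_ref al'.
Proof.
move=> [r [rE [h st]]]; have [al' st'] := stab_exists c0 (padj 0 NN') al.
exists al'; split=> //; exists r; split=> //; exists (leq_trans h NN').
by apply: stab_trans st st' => x; apply: val_inj; rewrite /= padv0_comp.
Qed.

Lemma is_ref_good A B N (al : defbij (Mn M N +d A) (Mn M N +d B)) : is_ref al -> good A B.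
Proof. by move=> [r [_ _]]; exists N, al. Qed.

Lemma is_ref_exists A B : good A B -> exists N0, forall N, (N0 <= N)%N ->
  exists al : defbij (Mn M N +d A) (Mn M N +d B), is_ref al.
Proof.
move=> /ref_good[r rE]; exists (tag r) => N h.
have [al st] := stab_exists c0 (padj 0 h) (tagged r).
by exists al, r; split=> //; exists h.
Qed.

(** The value of a morphism of the group completion: the reference stable isomorphism
    of the source, transported along the morphism, compared with the one of the
    target. *)
Definition is_det (P Q : C) (f : hom P Q) (h : H) : Prop :=
  exists N s (a : defbij (s +d P.1) Q.1) (b : defbij (s +d P.2) Q.2)
    (al : defbij (Mn M N +d P.1) (Mn M N +d P.2)) (ga : defbij (Mn M N +d Q.1) (Mn M N +d Q.2)),
  [/\ f = @sis_mor S P Q s a b, is_ref al, is_ref ga & h = V (loop c0 a b al ga)].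

Lemma is_det_raise (P Q : C) (f : hom P Q) h N0 : is_det f h ->
  exists2 N, (N0 <= N)%N & exists s (a : defbij (s +d P.1) Q.1) (b : defbij (s +d P.2) Q.2)
    (al : defbij (Mn M N +d P.1) (Mn M N +d P.2)) (ga : defbij (Mn M N +d Q.1) (Mn M N +d Q.2)),
  [/\ f = @sis_mor S P Q s a b, is_ref al, is_ref ga & h = V (loop c0 a b al ga)].
Proof.
move=> [N [s [a [b [al [ga [fE ral rga ->]]]]]]].
exists (maxn N0 N); first exact: leq_maxl.
have [al' [sal ral']] := is_ref_raise (leq_maxr N0 N) ral.
have [ga' [sga rga']] := is_ref_raise (leq_maxr N0 N) rga.
exists s, a, b, al', ga'; split=> //.
exact: esym (value_extends c0 vn_ext (stab_extends (stab_loop a b sal sga))).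
Qed.

(** Neither the power of the module in which the loop lives nor the triple that represents
    [f] matters: stabilization and isomorphisms of triples preserve the value. *)
Lemma is_det_fun (P Q : C) (f : hom P Q) h h' : is_det f h -> is_det f h' -> h = h'.
Proof.
move=> hh hh'; have [N [s [a [b [al [ga [fE ral rga ->]]]]]]] := hh.
have [N' NN' [s' [a' [b' [al' [ga' [fE' ral' rga' ->]]]]]]] := is_det_raise N hh'.
have [al1 [sal ral1]] := is_ref_raise NN' ral.
have [ga1 [sga rga1]] := is_ref_raise NN' rga.
rewrite -(value_extends c0 vn_ext (stab_extends (stab_loop a b sal sga))).
rewrite (is_ref_unique ral1 ral') (is_ref_unique rga1 rga').
have /sis_classP[u [/= ua ub]] : sis_mor (S := S) (P := P) (Q := Q) (s := s) a b =
    sis_mor (S := S) (P := P) (Q := Q) (s := s') a' b' by rewrite -fE.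
congr V; rewrite (_ : a = a' \b (u +b id1))// (_ : b = b' \b (u +b id1))//.
exact: loop_iso.
Qed.

Lemma is_det_comp (P Q T : C) (f : hom P Q) (g : hom Q T) hf hg :
  is_det f hf -> is_det g hg -> is_det (comp g f) (hf * hg).
Proof.
move=> [N1 [s [a [b [al [ga [fE ral rga ->]]]]]]] h2.
have [N NN [t [p [q [ga' [ep [gE rga' rep ->]]]]]]] := is_det_raise N1 h2.
have [al1 [sal ral1]] := is_ref_raise NN ral.
have [ga1 [sga rga1]] := is_ref_raise NN rga.
rewrite -(value_extends c0 vn_ext (stab_extends (stab_loop a b sal sga))).
rewrite (is_ref_unique rga1 rga').
exists N, (t +d s), (p \b ((id1 +b a) \b defassoc c0 t s P.1)),
  (q \b ((id1 +b b) \b defassoc c0 t s P.2)), al1, ep.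
split=> //; first by rewrite fE gE sis_morM.
rewrite (loop_comp c0 a b p q al1 ga' ep) (value_comp c0 vn_ext) (value_conj c0 vn_ext).
rewrite (value_extends c0 vn_ext (skip_extends c0 t _)).
exact: (value_comm c0 vn_ext).
Qed.

Lemma is_det_good (P Q : C) (f : hom P Q) h : is_det f h -> good P.1 P.2.
Proof. by move=> [N [s [a [b [al [ga [_ ral _ _]]]]]]]; exact: is_ref_good ral. Qed.

Lemma is_det_exists (P Q : C) (f : hom P Q) : good P.1 P.2 -> exists h, is_det f h.
Proof.
move=> gP; have [s [a [b fE]]] := sis_morP f.
have [N1 H1] := is_ref_exists gP.
have [N2 H2] := is_ref_exists (good_fwd (a : defbij (s +d P.1) Q.1) (b : defbij (s +d P.2) Q.2) gP).
have [al ral] := H1 (maxn N1 N2) (leq_maxl _ _).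
have [ga rga] := H2 (maxn N1 N2) (leq_maxr _ _).
by exists (V (loop c0 a b al ga)), (maxn N1 N2), s, a, b, al, ga.
Qed.

Lemma good_source (P Q : C) (f : hom P Q) : good Q.1 Q.2 -> good P.1 P.2.
Proof.
by move=> gQ; have [s [a [b _]]] := sis_morP f;
  exact: good_bwd (a : defbij (s +d P.1) Q.1) (b : defbij (s +d P.2) Q.2) gQ.
Qed.

Lemma good_target (P Q : C) (f : hom P Q) : good P.1 P.2 -> good Q.1 Q.2.
Proof.
by move=> gP; have [s [a [b _]]] := sis_morP f;
  exact: good_fwd (a : defbij (s +d P.1) Q.1) (b : defbij (s +d P.2) Q.2) gP.
Qed.

(** The value is [1] on the components that do not contain the base object, where there is
    no stable isomorphism to compare. *)
Definition det (P Q : C) (f : hom P Q) : H := xget 1 [set h | is_det f h].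

Lemma detE (P Q : C) (f : hom P Q) h : is_det f h -> det f = h.
Proof.
move=> fh; have lh : is_det f (det f) by exact: (@xgetI _ 1 [set h | is_det f h] h fh).
exact: is_det_fun lh fh.
Qed.

Lemma det_bad (P Q : C) (f : hom P Q) : ~ good P.1 P.2 -> det f = 1.
Proof. by move=> nP; apply: xgetPN => h /is_det_good. Qed.

Lemma detM (P Q T : C) (g : hom Q T) (f : hom P Q) : det (comp g f) = det f * det g.
Proof.
have [gP|nP] := pselect (good P.1 P.2); last first.
  rewrite !det_bad ?mulg1// => gQ; apply: nP; exact: good_source f gQ.
have [hf fP] := is_det_exists f gP; have [hg gPr] := is_det_exists g (good_target f gP).
by rewrite (detE fP) (detE gPr); apply: detE; exact: is_det_comp.
Qed.

Definition det_functor : gfunctor C H := GFunctor detM.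

Lemma det_comm (P Q : C) (f : hom P Q) A (th : defbij A A) : det f * V th = V th * det f.
Proof.
have [gP|nP] := pselect (good P.1 P.2); last by rewrite det_bad// mul1g mulg1.
have [h fh] := is_det_exists f gP; rewrite (detE fh).
by move: fh => [N [s [a [b [al [ga [_ _ _ ->]]]]]]]; exact: (value_comm c0 vn_ext).
Qed.

Lemma det_isom A (th : defbij A A) :
  det (@isom S A A A A (idm (A : S)) (th : hom (A : S) A)) = V th.
Proof.
have gA : good A A by exists 0%N, id1.
have [N HN] := is_ref_exists gA; have [al ral] := HN N (leqnn N).
apply: detE; exists N, (defempty M), (id1 \b defunitl c0 A), (th \b defunitl c0 A), al, al.
split=> //; rewrite loop_unit -(value_extends c0 vn_ext (extends_dinr c0 (Mn M N) th)).
rewrite -(value_conj c0 vn_ext (defbij_inv al)); congr V; apply: defbij_eq => x.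
have -> : defbij_id (Mn M N) +b defbij_id A = id1.
  by apply: defbij_eq; elim/defsum_ind=> y; rewrite ?defbij_sum_inl ?defbij_sum_inr.
by [].
Qed.

End Determinant.

Section Generators.
Variables (K : realType) (R : comNzRingType) (M : lmodType R) (c : M) (c0 : c != 0).
Implicit Types X Y : defset M.
Notation S := (defset_smg c0).
Local Open Scope group_scope.

Lemma aut_class_extends X Y (i : definj X Y) th th' : extends_along i th th' ->
  aut_class K (S := S) (X := Y) th' = aut_class K (S := S) (X := X) th.
Proof.
move=> h; have [s [k kP]] := extends_conj c0 i.
rewrite (extends_unique h (kP th)).
rewrite -(aut_class_tens K (S := S) s (X := X) th).
exact: (aut_class_conj K (S := S) (k : hom (tens (s : S) (X : S)) Y)).
Qed.

Definition unit_gen n (f : Omega M n.+1) : K1 K S :=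
  aut_class K (S := S) (X := Mn M n) (defbij_of_Omega f).

Lemma unit_genC n (f g : Omega M n.+1) : unit_gen f * unit_gen g = unit_gen g * unit_gen f.
Proof. exact: aut_classC. Qed.

Lemma unit_genM n : {morph @unit_gen n : f g / f * g}.
Proof.
move=> f g; rewrite unit_genC /unit_gen defbij_of_OmegaM.
exact: (aut_classM K (S := S) (X := Mn M n)).
Qed.

HB.instance Definition _ n :=
  isMultiplicative.Build (Omega M n.+1) (K1 K S) (@unit_gen n) (@unit_genM n).

Lemma unit_gen_ext n (f : Omega M n.+1) : unit_gen (Omega_ext f) = unit_gen f.
Proof. exact: aut_class_extends (ext_extends f). Qed.

Lemma unit_gen_surj (w : K1 K S) : exists n (f : Omega M n.+1), w = unit_gen f.
Proof.
have [X [th ->]] := aut_class_surj (w : pclass K _ _).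
have [n [i _]] := embedding (X : defset M).
have [th' h] := extends_exists c0 i th.
exists n, (Omega_of_defbij th'); rewrite /unit_gen Omega_of_defbijK.
exact: esym (aut_class_extends h).
Qed.

End Generators.

(** The morphisms [u n] send a bijection to its loop, and they are jointly surjective. A
    compatible family [vn] gives the functor [det], whose holonomy sends the loop of a
    bijection back to its value under [vn]. *)
Theorem K1_direct_limit (K : realType) (R : comNzRingType) (M : lmodType R) (c : M)
    (c0 : c != 0) :
  exists u : forall n : nat, {multiplicative ab (Omega M n.+1) -> K1 K (defset_smg c0)},
    is_direct_limit (fun n : nat => ab_map (@Omega_ext R M n.+1)) u.
Proof.
exists (fun n => ab_lift (@unit_genC K R M c c0 n) : {multiplicative _ -> _}).
split=> [n|H vn vn_ext].
  move=> x; elim/ab_ind: x => f.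
  have E m (g : Omega M m.+1) := ab_liftE (@unit_genC K R M c c0 m) g.
  exact: (etrans (congr1 (ab_lift _) (ab_mapE (@Omega_ext R M n.+1) f))
    (etrans (E n.+1 _) (etrans (unit_gen_ext K c0 f) (esym (E n f))))).
have [hol [holM holE]] := functor_holonomy K (det_functor c0 vn_ext).
pose h (w : K1 K (defset_smg c0)) : H := hol (base (defset_smg c0)) (base (defset_smg c0)) w.
have hM : {morph h : x y / (x * y)%g} by move=> x y; exact: holM.
pose hmul := isMultiplicative.Build _ _ h hM.
pose hm : {multiplicative K1 K (defset_smg c0) -> H} := HB.pack h hmul.
have hol1 P : hol P P (pone K _) = 1%g.
  by apply: (mulgI (hol P P (pone K _))); rewrite -holM pcmp1 mulg1.
have holV P Q p : hol Q P (pinv p) = (hol P Q p)^-1%g.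
  by apply: (mulgI (hol P Q p)); rewrite -holM pcmpV hol1 mulgV.
have hu n (f : Omega M n.+1) : hm (unit_gen K c0 f) = vn n (ab_pi f).
  rewrite -[LHS]/(hol _ _ (unit_gen K c0 f)) /unit_gen /aut_class !holM holV !holE /=.
  rewrite (det_isom c0 vn_ext) (det_comm vn_ext) mulgK.
  have e : extends_along (definj_bij (defbij_id (Mn M n))) (defbij_of_Omega f) (defbij_of_Omega f).
    by split=> // y /(_ y).
  by rewrite (valueE c0 vn_ext e) /Omega_value defbij_of_OmegaK.
have hab n (x : ab (Omega M n.+1)) : hm (ab_lift (@unit_genC K R M c c0 n) x) = vn n x.
  by elim/ab_ind: x => f; rewrite ab_liftE hu.
exists hm; split=> [//|h' h'u w].
have [n [f ->]] := unit_gen_surj w.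
by rewrite -(ab_liftE (@unit_genC K R M c c0 n)) h'u hab.
Qed.

Theorem theorem6p13 (K : realType) (R : idomainType) (M : lmodType R)
    (R_PID : is_PID R) (M_free : is_free_module M)
    (M_infinite : infinite_set [set: M]) :
  exists u : forall n : nat,
      {multiplicative ab (Omega M n.+1) -> module_K1 K M_infinite},
    is_direct_limit (fun n : nat => ab_map (@Omega_ext R M n.+1)) u.
Proof. exact: (K1_direct_limit K (xchooseP (infinite_neq0 M_infinite))). Qed.
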